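(* The following decision problem is NP-complete: given a snark $G$, decide whether $\phi_c(G)<5$.
   Context: A snark is a $3$-regular graph that is cyclically $4$-edge-connected, has girth at least $5$, and has circular flow number greater than $4$ (equivalently, it has no proper $3$-edge-coloring). The circular flow number $\phi_c(G)$ is the infimum of the reals $r$ such that some orientation of $G$ admits a real-valued flow (conservation at every vertex) with all values in $[1,r-1]$; it is $\infty$ if $G$ has a bridge. *)

(* Defs.v *)
From HB Require Import structures.
From mathcomp Require Import all_boot all_order all_algebra.
From mathcomp Require Import all_classical all_reals ereal.

Set Implicit Arguments.
Unset Strict Implicit.
Unset Printing Implicit Defensive.

Import Order.TTheory GRing.Theory Num.Theory.

Local Open Scope ring_scope.

(* Deterministic multi-tape Turing machines over binary words. Tapes are
   one-way infinite; a cell holds a blank (None), a bit (Some (inl b)) or an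
   auxiliary work symbol (Some (inr a)). *)

Variant direction := GoLeft | Stay | GoRight.

Record turing_machine := TuringMachine {
  tm_tapes : nat;  (* the machine has tm_tapes.+1 tapes *)
  tm_aux   : finType;
  tm_state : finType;
  tm_start : tm_state;
  tm_halt  : pred tm_state;
  tm_trans : tm_state ->
    {ffun 'I_tm_tapes.+1 -> option (bool + tm_aux)} ->
    tm_state * ('I_tm_tapes.+1 -> option (bool + tm_aux) * direction)
}.

Definition tm_cell (M : turing_machine) : Type := option (bool + tm_aux M).

Record tm_config (M : turing_machine) := TMConfig {
  cfg_state : tm_state M;
  cfg_head  : 'I_(tm_tapes M).+1 -> nat;
  cfg_tape  : 'I_(tm_tapes M).+1 -> nat -> tm_cell M
}.

(* Moving left from cell 0 leaves the head on cell 0. *)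
Definition move_head (d : direction) (i : nat) : nat :=
  match d with GoLeft => i.-1 | Stay => i | GoRight => i.+1 end.

Definition tm_step (M : turing_machine) (c : tm_config M) : tm_config M :=
  if tm_halt (cfg_state c) then c else
  let out := tm_trans (cfg_state c) [ffun k => cfg_tape c k (cfg_head c k)] in
  TMConfig out.1
    (fun k => move_head (out.2 k).2 (cfg_head c k))
    (fun k i => if i == cfg_head c k then (out.2 k).1 else cfg_tape c k i).

Definition word_tape (M : turing_machine) (x : seq bool) : nat -> tm_cell M :=
  fun i => nth None [seq Some (inl b) | b <- x] i.

Definition tm_init (M : turing_machine) (x : seq bool) : tm_config M :=
  TMConfig (tm_start M) (fun=> 0%N)
    (fun k => if k == ord0 then word_tape M x else fun=> None).

(* The output is the word on tape 0 preceding its first blank cell. *)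
Definition tm_output (M : turing_machine) (c : tm_config M) (y : seq bool) :=
  forall i, (i <= size y)%N -> cfg_tape c ord0 i = word_tape M y i.

(* A halted configuration is fixed by tm_step, so this says that M halts on x
   within t steps with output y. *)
Definition tm_computes_within (M : turing_machine) (x : seq bool) (t : nat)
    (y : seq bool) : Prop :=
  let c := iter t (@tm_step M) (tm_init M x) in
  tm_halt (cfg_state c) /\ tm_output c y.

Definition polytime (f : seq bool -> seq bool) : Prop :=
  exists (M : turing_machine) (p : {poly nat}),
    forall x, tm_computes_within M x p.[size x] (f x).

(* A decision problem whose input is promised to be (the code of) an instance:
   nothing is required of an algorithm on words that encode no instance. *)
Record decision_problem := DecisionProblem {
  instance : Type;
  encode   : instance -> seq bool;
  answer   : instance -> Prop
}.

Definition language_problem (L : seq bool -> Prop) : decision_problem :=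
  DecisionProblem id L.

(* Self-delimiting code of a pair of words. *)
Definition pair_code (x w : seq bool) : seq bool :=
  flatten [seq [:: true; b] | b <- x] ++ false :: w.

Definition in_NP (P : decision_problem) : Prop :=
  exists (V : seq bool -> seq bool) (q : {poly nat}),
    polytime V /\
    forall a : instance P,
      answer a <->
      exists w : seq bool,
        (size w <= q.[size (encode a)])%N /\
        V (pair_code (encode a) w) = [:: true].

Definition karp_reducible (P Q : decision_problem) : Prop :=
  exists f : seq bool -> seq bool,
    polytime f /\
    forall a : instance P, exists b : instance Q,
      f (encode a) = encode b /\ (answer a <-> answer b).

Definition NP_hard (P : decision_problem) : Prop :=
  forall L : seq bool -> Prop,
    in_NP (language_problem L) -> karp_reducible (language_problem L) P.

Definition NP_complete (P : decision_problem) : Prop := in_NP P /\ NP_hard P.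

(* Graphs of girth at least 5 have no loops or parallel edges, so simple graphs
   suffice for snarks. *)
Record graph := Graph {
  nverts  : nat;
  adj     : rel 'I_nverts;
  adj_sym : symmetric adj;
  adj_irr : irreflexive adj
}.

Definition graph_code (G : graph) : seq bool :=
  nseq (nverts G) true ++
  false :: [seq adj i j | i <- enum 'I_(nverts G), j <- enum 'I_(nverts G)].

Definition cubic (G : graph) : Prop :=
  forall x : 'I_(nverts G), #|[set y | adj x y]| = 3%N.

Definition is_cycle (G : graph) (c : seq 'I_(nverts G)) : Prop :=
  (3 <= size c)%N /\ ucycle (@adj G) c.

Definition girth_at_least (G : graph) (k : nat) : Prop :=
  forall c : seq 'I_(nverts G), is_cycle c -> (k <= size c)%N.

(* Each edge of the cut is counted once, as the pair (end in A, end outside). *)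
Definition edge_cut (G : graph) (A : {set 'I_(nverts G)}) :
    {set 'I_(nverts G) * 'I_(nverts G)} :=
  [set p | [&& p.1 \in A, p.2 \notin A & adj p.1 p.2]].

Definition contains_cycle (G : graph) (A : {set 'I_(nverts G)}) : Prop :=
  exists c : seq 'I_(nverts G), is_cycle c /\ {subset c <= A}.

(* The case A = a union of components (empty cut) forces all cycles of G to lie
   in one component. *)
Definition cyclically_edge_connected (G : graph) (k : nat) : Prop :=
  forall A : {set 'I_(nverts G)},
    contains_cycle A -> contains_cycle (~: A) -> (k <= #|edge_cut A|)%N.

Definition orientation (G : graph) (D : rel 'I_(nverts G)) : Prop :=
  (forall x y, D x y -> adj x y) /\
  (forall x y, adj x y -> D x y (+) D y x).

Definition flow (R : realType) (G : graph) (D : rel 'I_(nverts G))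
    (f : 'I_(nverts G) -> 'I_(nverts G) -> R) : Prop :=
  forall x, \sum_(y | D x y) f x y = \sum_(y | D y x) f y x.

Definition circular_flow (R : realType) (G : graph) (r : R) : Prop :=
  exists (D : rel 'I_(nverts G)) (f : 'I_(nverts G) -> 'I_(nverts G) -> R),
    [/\ orientation D, flow D f
      & forall x y, D x y -> 1 <= f x y <= r - 1].

(* The infimum of the empty set is +oo, which covers graphs with a bridge. *)
Definition circular_flow_number (R : realType) (G : graph) : \bar R :=
  ereal_inf [set r%:E | r in [set r : R | circular_flow G r]]%classic.

Definition snark (R : realType) (G : graph) : Prop :=
  [/\ cubic G, cyclically_edge_connected G 4, girth_at_least G 5
    & (4%:E < circular_flow_number R G)%E].

Definition snark_flow_lt5 (R : realType) : decision_problem :=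
  @DecisionProblem {G : graph | snark R G}
    (fun G => graph_code (sval G))
    (fun G => (circular_flow_number R (sval G) < 5%:E)%E).

(* Main.v *)
From HB Require Import structures.
Require Import Defs.
From mathcomp Require Import all_boot all_order all_algebra.
From mathcomp Require Import all_classical all_reals ereal.
From mathcomp Require Import ring lra zify.

(** Membership: scaling by r turns a circular flow with values in (1, r - 1) into
    a function f on arcs with f(x,y) + f(y,x) = r, f > 1 and vertex sums in r N. For
    r = 5 the roundings of f to integer functions, one per arc, add up to an
    integral certificate of polynomial size.

    Hardness: the computation of a verifier is written as a CNF, and the CNF as
    not-all-equal rows of four literals. Every row becomes a cell, a cubic piece
    with four input and four output ports built from copies of the Petersen graph
    minus two adjacent vertices; modulo 5 such a copy only transmits flow values
    away from 5/2, so a port carries a bit, and the centre of the cell forbids the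
    four bits to agree. The ports of the occurrences of a variable are joined in a
    cycle and the cells in a ring; modulo 4 + 1/1000 already one port is blocked,
    so the graph is always a snark. Functions definable by bounded first-order
    formulas over the input word are polynomial-time, by compilation to counter
    programs and then to Turing machines. *)

Set Implicit Arguments.
Unset Strict Implicit.
Unset Printing Implicit Defensive.

Import Order.TTheory GRing.Theory Num.Theory.

Local Open Scope nat_scope.

(** * Counter programs *)

(** The bound 5 is strict, so a certificate must keep all values strictly inside (1, 4). A rounding
    only respects the closed bounds, but it can be made not to decrease one prescribed arc. With one
    rounding per arc, their average is strict again and has denominator 3n on a cubic graph with n
    vertices.

    The gadget rests on the rigidity of the Petersen graph. Modulo 5, what a block transmits is at
    most 1 in absolute value. A port adds two such amounts and must itself avoid [-1, 1], so both
    have the same sign: this sign is the bit. The centre asks that four transmitted amounts cancel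
    modulo 5; being at most 1 each, they really sum to 0 and cannot share a sign. Modulo 4 + 1/1000
    the transmitted amounts are nearly 0, which no port admits; this excludes flow number at most 4
    without any edge colouring.

    The cycles of the variables give no control over small edge cuts, hence the two joins between
    consecutive cells of the ring. Joins inside one cell would spoil simplicity and girth, hence
    every row occurs twice, so that consecutive occurrences of a variable fall into different
    cells. *)

Variant cond := CReg of nat | CPtr | CBit | CEnd.
Variant act := AInc of nat | ADec of nat | APInc | APDec | APut of bool.

Inductive cmd :=
  | Skip
  | Act of act
  | Seq of cmd & cmd
  | If of cond & cmd & cmd
  | While of cond & cmd.

Record st := St { rg : nat -> nat; pt : nat; ou : seq bool }.

Lemma st_ext s s' : (forall x, rg s x = rg s' x) -> pt s = pt s' ->
  ou s = ou s' -> s = s'.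
Proof. by case: s s' => r p o [r' p' o'] /= /funext -> -> ->. Qed.

(* Pointer value 0 is the left-end marker; bit i of the word is under i.+1. *)
Definition holds (w : seq bool) (b : cond) (s : st) : bool :=
  match b with
  | CReg r => rg s r != 0
  | CPtr => pt s != 0
  | CBit => (0 < pt s) && nth false w (pt s).-1
  | CEnd => pt s <= size w
  end.

Definition setr (s : st) r v :=
  St (fun x => if x == r then v else rg s x) (pt s) (ou s).

Definition doact (a : act) (s : st) : st :=
  match a with
  | AInc r => setr s r (rg s r).+1
  | ADec r => setr s r (rg s r).-1
  | APInc => St (rg s) (pt s).+1 (ou s)
  | APDec => St (rg s) (pt s).-1 (ou s)
  | APut b => St (rg s) (pt s) (rcons (ou s) b)
  end.

Variant instr := IAct of act | IJf of cond & nat | IJmp of nat.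

Fixpoint len c := match c with
  | Skip => 0
  | Act _ => 1
  | Seq c1 c2 => len c1 + len c2
  | If _ c1 c2 => len c1 + len c2 + 2
  | While _ c => len c + 2
  end.

Fixpoint compile c pc := match c with
  | Skip => [::]
  | Act a => [:: IAct a]
  | Seq c1 c2 => compile c1 pc ++ compile c2 (pc + len c1)
  | If b c1 c2 => IJf b (pc + len c1 + 2) :: compile c1 pc.+1 ++
      IJmp (pc + len c1 + len c2 + 2) :: compile c2 (pc + len c1 + 2)
  | While b c => IJf b (pc + len c + 2) :: compile c pc.+1 ++ [:: IJmp pc]
  end.

Lemma size_compile c pc : size (compile c pc) = len c.
Proof.
elim: c pc => //= [c1 I1 c2 I2|b c1 I1 c2 I2|b c I] pc;
  by rewrite !size_cat /= ?I1 ?I2 ?I; lia.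
Qed.

Definition istep w (prog : seq instr) (x : nat * st) : nat * st :=
  if x.1 < size prog then
    match nth (IJmp 0) prog x.1 with
    | IAct a => (x.1.+1, doact a x.2)
    | IJf b l => (if holds w b x.2 then x.1.+1 else l, x.2)
    | IJmp l => (l, x.2)
    end
  else x.

Definition code_at prog pc c :=
  exists p1 p2, prog = p1 ++ compile c pc ++ p2 /\ size p1 = pc.

(** Quantifying over the surrounding program and the entry address lets fragments be composed
    without relocation. [T] is only an upper bound on the number of steps. *)
Definition runs w c s s' T := forall prog pc, code_at prog pc c ->
  exists2 t, t <= T & iter t (istep w prog) (pc, s) = (pc + len c, s').

Section Rules.
Variable w : seq bool.

Lemma istep_at p1 i p2 s pc : size p1 = pc ->
  istep w (p1 ++ i :: p2) (pc, s) =
    match i with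
    | IAct a => (pc.+1, doact a s)
    | IJf b l => (if holds w b s then pc.+1 else l, s)
    | IJmp l => (l, s)
    end.
Proof.
move=> <-; rewrite /istep /= nth_cat ltnn subnn /= size_cat /=.
by rewrite -[X in X < _]addn0 ltn_add2l.
Qed.

Lemma runs_le c s s' T T' : T <= T' -> runs w c s s' T -> runs w c s s' T'.
Proof.
by move=> le H prog pc /H[t lt e]; exists t => //; apply: leq_trans le.
Qed.

Lemma runs_skip s : runs w Skip s s 0.
Proof. by move=> prog pc _; exists 0 => //=; rewrite addn0. Qed.

Lemma runs_act a s : runs w (Act a) s (doact a s) 1.
Proof.
by move=> prog pc [p1 [p2 [-> e]]]; exists 1 => //=; rewrite istep_at ?addn1.
Qed.

Lemma runs_seq c1 c2 s s1 s2 T1 T2 : runs w c1 s s1 T1 -> runs w c2 s1 s2 T2 ->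
  runs w (Seq c1 c2) s s2 (T1 + T2).
Proof.
move=> H1 H2 prog pc [p1 [p2 [e1 e2]]].
have [|t1 l1 E1] := H1 prog pc.
  by exists p1, (compile c2 (pc + len c1) ++ p2); rewrite e1 /= -!catA.
have [|t2 l2 E2] := H2 prog (pc + len c1).
  exists (p1 ++ compile c1 pc), p2; rewrite e1 /= -!catA; split=> //.
  by rewrite size_cat size_compile e2.
exists (t2 + t1); first by rewrite addnC leq_add.
by rewrite iterD E1 E2 addnA.
Qed.

Lemma runs_ift b c1 c2 s s' T : holds w b s -> runs w c1 s s' T ->
  runs w (If b c1 c2) s s' (T + 2).
Proof.
move=> hb H prog pc [p1 [p2 [e1 e2]]].
have [|t l E] := H prog pc.+1.
  exists (rcons p1 (IJf b (pc + len c1 + 2))).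
  exists (IJmp (pc + len c1 + len c2 + 2) :: compile c2 (pc + len c1 + 2) ++ p2).
  by rewrite e1 /= cat_rcons -!catA size_rcons e2.
exists (1 + (t + 1)); first by lia.
have S1 : istep w prog (pc, s) = (pc.+1, s) by rewrite e1 /= istep_at // hb.
rewrite iterD iterD /= S1 E e1 /= -!catA /=.
rewrite -cat_rcons catA istep_at; first by congr pair; lia.
by rewrite size_cat size_rcons size_compile e2; lia.
Qed.

Lemma runs_iff b c1 c2 s s' T : ~~ holds w b s -> runs w c2 s s' T ->
  runs w (If b c1 c2) s s' (T + 1).
Proof.
move=> hb H prog pc [p1 [p2 [e1 e2]]].
have [|t l E] := H prog (pc + len c1 + 2).
  exists (p1 ++ IJf b (pc + len c1 + 2) :: compile c1 pc.+1 ++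
    [:: IJmp (pc + len c1 + len c2 + 2)]), p2.
  rewrite e1 /= -!catA /= -!catA /=; split=> //.
  by rewrite size_cat /= size_cat /= size_compile e2; lia.
exists (t + 1); first by lia.
have S1 : istep w prog (pc, s) = (pc + len c1 + 2, s).
  by rewrite e1 /= istep_at // (negbTE hb).
by rewrite iterD /= S1 E; congr pair; lia.
Qed.

Lemma runs_while_end b c s : ~~ holds w b s -> runs w (While b c) s s 1.
Proof.
move=> hb prog pc [p1 [p2 [-> e2]]]; exists 1 => //=.
by rewrite istep_at // (negbTE hb) addnA.
Qed.

Lemma runs_while_step b c s s1 s2 T1 T2 : holds w b s -> runs w c s s1 T1 ->
  runs w (While b c) s1 s2 T2 -> runs w (While b c) s s2 (T1 + T2 + 2).
Proof.
move=> hb H1 H2 prog pc H; have [p1 [p2 [e1 e2]]] := H.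
have [t2 l2 E2] := H2 _ _ H.
have [|t1 l1 E1] := H1 prog pc.+1.
  exists (rcons p1 (IJf b (pc + len c + 2))), (IJmp pc :: p2).
  by rewrite e1 /= cat_rcons -!catA size_rcons e2.
exists (t2 + (1 + (t1 + 1))); first by lia.
have S1 : istep w prog (pc, s) = (pc.+1, s) by rewrite e1 /= istep_at // hb.
rewrite iterD iterD iterD /= S1 E1.
have -> : istep w prog (pc.+1 + len c, s1) = (pc, s1).
  rewrite e1 /= -!catA /= -cat_rcons catA istep_at //.
  by rewrite size_cat size_rcons size_compile e2.
by rewrite E2.
Qed.

Lemma runs_while b c n (S : nat -> st) T :
  (forall i, i < n -> holds w b (S i)) -> ~~ holds w b (S n) ->
  (forall i, i < n -> runs w c (S i) (S i.+1) T) ->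
  runs w (While b c) (S 0) (S n) (n * (T + 2) + 1).
Proof.
move=> h1 h2 h3.
suff H k i : i + k = n -> runs w (While b c) (S i) (S n) (k * (T + 2) + 1).
  exact: H.
elim: k i => [|k IH] i e.
  by rewrite mul0n add0n -e addn0 in h2 *; apply: runs_while_end.
have lt : i < n by lia.
apply: runs_le (runs_while_step (h1 _ lt) (h3 _ lt) (IH i.+1 _)); lia.
Qed.

Definition Loop r c := While (CReg r) (Seq (Act (ADec r)) c).

Lemma runs_loop r c n (S : nat -> st) T :
  (forall i, i <= n -> rg (S i) r = n - i) ->
  (forall i, i < n -> runs w c (setr (S i) r (n - i.+1)) (S i.+1) T) ->
  runs w (Loop r c) (S 0) (S n) (n * (T + 3) + 1).
Proof.
move=> h1 h2.
apply: (@runs_le _ _ _ (n * ((1 + T) + 2) + 1)); first by lia.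
apply: runs_while => [i lt||i lt] /=.
- by rewrite h1; lia.
- by rewrite h1 // subnn.
- apply: (@runs_seq _ _ _ (setr (S i) r (n - i.+1))); last exact: h2.
  have -> : n - i.+1 = (rg (S i) r).-1 by rewrite h1; lia.
  exact: (@runs_act (ADec r)).
Qed.

End Rules.

Definition addr s r n := setr s r (rg s r + n).

Lemma addrE s r n x : rg (addr s r n) x = if x == r then rg s r + n else rg s x.
Proof. by []. Qed.

Ltac if_solve := repeat (match goal with
  | |- context [if ?x == ?y then _ else _] =>
      case: (eqVneq x y) => [?|?]; subst end).

Ltac st_solve :=
  apply: st_ext => /=; [move=> ?; if_solve; rewrite ?addrE /=; try if_solve;
    try lia | try done; try lia | try done].

Section Rules2.
Variable w : seq bool.

Lemma runs_clear r s : runs w (Loop r Skip) s (setr s r 0) (rg s r * 3 + 1).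
Proof.
have := @runs_loop w r Skip (rg s r) (fun i => setr s r (rg s r - i)) 0.
rewrite subn0 subnn.
have -> : setr s r (rg s r) = s by st_solve.
apply=> [i le|i lt] /=; first by rewrite eqxx.
have -> : setr (setr s r (rg s r - i)) r (rg s r - i.+1) =
   setr s r (rg s r - i.+1) by st_solve.
exact: runs_skip.
Qed.

Lemma runs_pclear s :
  runs w (While CPtr (Act APDec)) s (St (rg s) 0 (ou s)) (pt s * 3 + 1).
Proof.
have := @runs_while w CPtr (Act APDec) (pt s)
  (fun i => St (rg s) (pt s - i) (ou s)) 1.
rewrite subn0 subnn.
have -> : St (rg s) (pt s) (ou s) = s by case: s.
apply=> [i le||i lt] //=; first by rewrite -lt0n subn_gt0.
have -> : pt s - i.+1 = (pt s - i).-1 by lia.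
exact: (@runs_act w APDec).
Qed.

Fixpoint incs r n := if n is n'.+1 then Seq (incs r n') (Act (AInc r)) else Skip.

Lemma runs_incs r n s : runs w (incs r n) s (addr s r n) n.
Proof.
elim: n => [|n IH] /=.
  have -> : addr s r 0 = s by st_solve.
  exact: runs_skip.
rewrite -[n.+1]addn1; apply: (runs_seq IH).
have -> : addr s r (n + 1) = doact (AInc r) (addr s r n) by st_solve.
exact: runs_act.
Qed.
End Rules2.

Lemma runs_eq w c s s1 s2 T : s1 = s2 -> runs w c s s1 T -> runs w c s s2 T.
Proof. by move=> ->. Qed.

Lemma runs_act_eq w a s s' : doact a s = s' -> runs w (Act a) s s' 1.
Proof. by move=> <-; apply: runs_act. Qed.

(** The base [B + 2] is at least 2 even for [B = 0], so that constants and sums are absorbed by the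
    exponent and the class is closed under composition. *)
Definition pbound (f : nat -> nat) := exists k, forall B, f B <= (B + 2) ^ k.

Lemma pbound_const c : pbound (fun=> c).
Proof.
exists c => B; apply: (@leq_trans (2 ^ c)); first exact/ltnW/ltn_expl.
by case: c => // c; rewrite leq_exp2r //; lia.
Qed.

Lemma pbound_id : pbound id.
Proof. by exists 1 => B; rewrite expn1; lia. Qed.

Lemma pbound_add f g : pbound f -> pbound g -> pbound (fun B => f B + g B).
Proof.
move=> [k hk] [l hl]; exists (k + l).+1 => B.
have h1 : (B + 2) ^ k <= (B + 2) ^ (k + l) by apply: leq_pexp2l; lia.
have h2 : (B + 2) ^ l <= (B + 2) ^ (k + l) by apply: leq_pexp2l; lia.
apply: (@leq_trans (2 * (B + 2) ^ (k + l))).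
  by rewrite mul2n -addnn; apply: leq_add; [apply: leq_trans (hk B) h1|
    apply: leq_trans (hl B) h2].
by rewrite expnS leq_mul2r; lia.
Qed.

Lemma pbound_mul f g : pbound f -> pbound g -> pbound (fun B => f B * g B).
Proof.
move=> [k hk] [l hl]; exists (k + l) => B.
by rewrite expnD; apply: leq_mul.
Qed.

Lemma pbound_comp f g : pbound f -> pbound g -> pbound (fun B => f (g B)).
Proof.
move=> [k hk] [l hl]; exists (l.+2 * k) => B; apply: leq_trans (hk _) _.
have h1 : g B + 2 <= (B + 2) ^ l.+2.
  have := hl B; have : 0 < (B + 2) ^ l by rewrite expn_gt0 addnS.
  rewrite !expnS; move: ((B + 2) ^ l) => z; nia.
by case: k hk => [|k] hk; rewrite ?muln0 // expnM leq_exp2r.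
Qed.

Ltac pb := repeat first [assumption | apply: pbound_add | apply: pbound_mul |
  exact: pbound_id | exact: pbound_const].

(** * Bounded first-order arithmetic over the bits of a word *)

(* [V] lists the variables in scope, each as a function of the environment. *)
Inductive ftm (A : Type) (W : A -> seq bool) (V : seq (A -> nat)) :
    (A -> nat) -> Prop :=
  | ft_var i : i < size V -> ftm W V (nth (fun=> 0) V i)
  | ft_const n : ftm W V (fun=> n)
  | ft_len : ftm W V (fun a => size (W a))
  | ft_add t1 t2 : ftm W V t1 -> ftm W V t2 -> ftm W V (fun a => t1 a + t2 a)
  | ft_mul t1 t2 : ftm W V t1 -> ftm W V t2 -> ftm W V (fun a => t1 a * t2 a)
  | ft_ext t1 t2 : t1 =1 t2 -> ftm W V t1 -> ftm W V t2.

Definition wlift A (W : A -> seq bool) : A * nat -> seq bool := fun x => W x.1.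
Definition vlift A (V : seq (A -> nat)) : seq (A * nat -> nat) :=
  snd :: [seq (fun x => v x.1) | v <- V].

Inductive ffm : forall (A : Type) (W : A -> seq bool) (V : seq (A -> nat)),
    (A -> bool) -> Prop :=
  | ff_lt A (W : A -> seq bool) V t1 t2 : ftm W V t1 -> ftm W V t2 ->
      ffm W V (fun a => t1 a < t2 a)
  | ff_bit A (W : A -> seq bool) V t : ftm W V t ->
      ffm W V (fun a => nth false (W a) (t a))
  | ff_not A (W : A -> seq bool) V P : ffm W V P -> ffm W V (fun a => ~~ P a)
  | ff_and A (W : A -> seq bool) V P Q : ffm W V P -> ffm W V Q ->
      ffm W V (fun a => P a && Q a)
  | ff_ex A (W : A -> seq bool) V t (P : A -> nat -> bool) : ftm W V t ->
      ffm (wlift W) (vlift V) (fun x => P x.1 x.2) ->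
      ffm W V (fun a => has (P a) (iota 0 (t a)))
  | ff_ext A (W : A -> seq bool) V P Q : P =1 Q -> ffm W V P -> ffm W V Q.

(** The calling convention of compiled terms and formulas: the variables in scope live in the
    registers [rs], everything from [base] on is zero and free as scratch space, and [B] bounds all
    quantities on which the running time depends. *)
Record env_ok A (W : A -> seq bool) (V : seq (A -> nat)) a rs base dst s B
    : Prop := EnvOk {
  eo_size : size rs = size V;
  eo_rs : forall i, i < size V -> nth 0 rs i < base;
  eo_dst : dst < base;
  eo_ndst : forall i, i < size V -> nth 0 rs i != dst;
  eo_val : forall i, i < size V -> rg s (nth 0 rs i) = nth (fun=> 0) V i a;
  eo_zero : forall i, base <= i -> rg s i = 0;
  eo_pt : pt s = 0;
  eo_w : size (W a) <= B;
  eo_bnd : forall i, i < size V -> nth (fun=> 0) V i a <= B }.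

Lemma eo_move A (W : A -> seq bool) V a rs base dst s B base' dst' s' :
  env_ok W V a rs base dst s B -> base <= base' -> dst' < base' ->
  (forall i, i < size V -> nth 0 rs i != dst') ->
  (forall x, x < base -> x != dst -> rg s' x = rg s x) ->
  (forall i, base' <= i -> rg s' i = 0) -> pt s' = 0 ->
  env_ok W V a rs base' dst' s' B.
Proof.
case=> h1 h2 h3 h4 h5 h6 h7 h8 h9 lb ld nd hs hz hp; split=> // i lt.
- by apply: leq_trans lb; apply: h2.
- by rewrite hs ?h5 // ?h2 // h4.
Qed.

(** The value is added to [dst] instead of being stored there, so a sum is a sequence and a product
    an iteration. The same [T] bounds time and value, because values become numbers of iterations in
    the enclosing code. *)
Definition tcode A (W : A -> seq bool) V (t : A -> nat)
    (c : seq nat -> nat -> nat -> cmd) (T : nat -> nat) :=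
  forall a rs base dst s B, env_ok W V a rs base dst s B ->
  runs (W a) (c rs base dst) s (addr s dst (t a)) (T B) /\ t a <= T B.

Lemma ftm_code A (W : A -> seq bool) V t : ftm W V t ->
  exists c T, pbound T /\ tcode W V t c T.
Proof.
elim=> {t} [i lt|n||t1 t2 _ [c1 [T1 [p1 h1]]] _ [c2 [T2 [p2 h2]]]
  |t1 t2 _ [c1 [T1 [p1 h1]]] _ [c2 [T2 [p2 h2]]]
  |t1 t2 e _ [c [T [p h]]]].
(* Reading a register in unary destroys it. Its value is moved to [dst] and to the scratch register
   [base], and then moved back. *)
- exists (fun rs base dst => Seq
    (Loop (nth 0 rs i) (Seq (Act (AInc dst)) (Act (AInc base))))
    (Loop base (Act (AInc (nth 0 rs i))))).
  exists (fun B => B * 9 + 2); split; first by pb.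
  move=> a rs base dst s B eo; set r := nth 0 rs i; set v := nth _ V i a.
  have rb : r < base by apply: (eo_rs eo).
  have rd : r != dst by apply: (eo_ndst eo).
  have rv : rg s r = v by apply: (eo_val eo).
  have db := eo_dst eo; have bz := eo_zero eo (leqnn base).
  have vB : v <= B by apply: (eo_bnd eo).
  split; last by lia.
  apply: (@runs_le _ _ _ _ ((v * (2 + 3) + 1) + (v * (1 + 3) + 1))).
    by lia.
  apply: (@runs_seq _ _ _ _ (setr (setr (addr s dst v) base v) r 0)).
    pose S k := setr (setr (addr s dst k) base k) r (v - k).
    have := @runs_loop (W a) r (Seq (Act (AInc dst)) (Act (AInc base))) v S 2.
    have -> : S 0 = s by rewrite /S; st_solve.
    have -> : S v = setr (setr (addr s dst v) base v) r 0.
      by rewrite /S subnn.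
    apply=> [k le|k lk] /=; first by rewrite eqxx.
    rewrite -[2]/(1 + 1); apply: (runs_seq (@runs_act _ _ _)).
    by apply: runs_act_eq; rewrite /S; st_solve.
  pose S k := setr (setr (addr s dst v) base (v - k)) r k.
  have := @runs_loop (W a) base (Act (AInc r)) v S 1.
  have -> : S 0 = setr (setr (addr s dst v) base v) r 0 by rewrite /S subn0.
  have -> : S v = addr s dst v by rewrite /S; st_solve.
  apply=> [k le|k lk] /=; first by rewrite eqxx; case: eqP => // ?; lia.
  by apply: runs_act_eq; rewrite /S; st_solve.
- exists (fun rs base dst => incs dst n), (fun=> n); split; first by pb.
  by move=> a rs base dst s B eo; split=> //; apply: runs_incs.
(* The pointer starts on the left-end marker and leaves the word after [size w + 1] moves; the
   surplus is removed by the decrement. *)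
- exists (fun rs base dst => Seq (While CEnd (Seq (Act APInc) (Act (AInc dst))))
    (Seq (Act (ADec dst)) (While CPtr (Act APDec)))).
  exists (fun B => B * 7 + 10); split; first by pb.
  move=> a rs base dst s B eo; set n := size (W a).
  have nB : n <= B := eo_w eo.
  split; last by lia.
  have hp := eo_pt eo.
  apply: (@runs_le _ _ _ _ ((n.+1 * (2 + 2) + 1) + (1 + (n.+1 * 3 + 1)))).
    by lia.
  apply: (@runs_seq _ _ _ _ (St (rg (addr s dst n.+1)) n.+1 (ou s))).
    pose S k := St (rg (addr s dst k)) k (ou s).
    have := @runs_while (W a) CEnd (Seq (Act APInc) (Act (AInc dst))) n.+1 S 2.
    have -> : S 0 = s by rewrite /S; st_solve.
    apply=> [k le||k lk] /=; [by []|by rewrite -ltnNge|].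
    rewrite -[2]/(1 + 1); apply: (runs_seq (@runs_act _ _ _)).
    by apply: runs_act_eq; rewrite /S; st_solve.
  apply: (runs_seq (@runs_act _ _ _)).
  by apply: runs_eq (@runs_pclear _ _); st_solve.
- exists (fun rs base dst => Seq (c1 rs base dst) (c2 rs base dst)).
  exists (fun B => T1 B + T2 B); split; first by pb.
  move=> a rs base dst s B eo.
  have [r1 b1] := h1 _ _ _ _ _ _ eo.
  have eo2 : env_ok W V a rs base dst (addr s dst (t1 a)) B.
    apply: (eo_move eo) => //=.
    - exact: eo_dst eo.
    - exact: eo_ndst eo.
    - by move=> x _ /negbTE ->.
    - by move=> x bx; rewrite ifN ?(eo_zero eo) //; have := eo_dst eo; lia.
    - exact: eo_pt eo.
  have [r2 b2] := h2 _ _ _ _ _ _ eo2.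
  split; last exact: leq_add.
  by apply: (runs_seq r1); apply: runs_eq r2; st_solve.
- exists (fun rs base dst =>
    Seq (c1 rs base.+1 base) (Loop base (c2 rs base.+1 dst))).
  exists (fun B => T1 B + (T1 B * (T2 B + 3) + 1)); split; first by pb.
  move=> a rs base dst s B eo; have db := eo_dst eo.
  have bz := eo_zero eo (leqnn base).
  have eo1 : env_ok W V a rs base.+1 base s B.
    apply: (eo_move eo) => //=; last exact: eo_pt eo.
    - by move=> i lt; have := eo_rs eo lt; lia.
    - by move=> x bx; apply: (eo_zero eo); lia.
  have [r1 b1] := h1 _ _ _ _ _ _ eo1.
  have eo2 s' : (forall x, x < base -> x != dst -> rg s' x = rg s x) ->
     (forall x, base < x -> rg s' x = 0) -> pt s' = 0 ->
     env_ok W V a rs base.+1 dst s' B.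
    move=> H1 H2 H3; apply: (eo_move eo) => //=; first by lia.
    exact: eo_ndst eo.
  have b2 : t2 a <= T2 B.
    apply: (proj2 (h2 _ _ _ _ s _ (eo2 _ _ _ _))) => //.
      by move=> x bx; apply: (eo_zero eo); lia.
    exact: eo_pt eo.
  split; last by nia.
  apply: (runs_seq r1).
  apply: (@runs_le _ _ _ _ (t1 a * (T2 B + 3) + 1)).
    by rewrite leq_add2r leq_mul2r b1 orbT.
  pose S k := setr (addr s dst (k * t2 a)) base (t1 a - k).
  have := @runs_loop (W a) base (c2 rs base.+1 dst) (t1 a) S (T2 B).
  have -> : S 0 = addr s base (t1 a) by rewrite /S; st_solve.
  have -> : S (t1 a) = addr s dst (t1 a * t2 a) by rewrite /S; st_solve.
  apply=> [k le|k lk] /=; first by rewrite eqxx.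
  have [|||r2 _] := h2 a rs base.+1 dst
    (setr (S k) base (t1 a - k.+1)) B (eo2 _ _ _ _).
  + by move=> x bx xd /=; rewrite (negbTE xd) ifN ?ifN //; lia.
  + move=> x bx /=; rewrite ifN; last by lia.
    rewrite ifN; last by lia.
    rewrite ifN; last by lia.
    by apply: (eo_zero eo); lia.
  + exact: eo_pt eo.
  by apply: runs_eq r2; rewrite /S; st_solve.
- exists c, T; split=> // a rs base dst s B eo; rewrite -e; exact: h.
Qed.

Definition fcode A (W : A -> seq bool) V (P : A -> bool)
    (c : seq nat -> nat -> nat -> cmd) (T : nat -> nat) :=
  forall a rs base dst s B, env_ok W V a rs base dst s B ->
  runs (W a) (c rs base dst) s (addr s dst (P a)) (T B).

Lemma eo_tmp A (W : A -> seq bool) V a rs base dst s B base' dst' s' :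
  env_ok W V a rs base dst s B -> base <= dst' -> dst' < base' ->
  (forall x, x < base -> x != dst -> rg s' x = rg s x) ->
  (forall i, base' <= i -> rg s' i = 0) -> pt s' = 0 ->
  env_ok W V a rs base' dst' s' B.
Proof.
move=> eo le lt h1 h2 h3; apply: (eo_move eo) => //; first by lia.
by move=> i li; have := eo_rs eo li; lia.
Qed.

Lemma runs_pos w r dst s : r != dst ->
  runs w (If (CReg r) (Seq (Loop r Skip) (Act (AInc dst))) Skip) s
    (setr (addr s dst (rg s r != 0)) r 0) (rg s r * 3 + 4).
Proof.
move=> rd.
case e : (rg s r) => [|k].
  apply: (@runs_le _ _ _ _ (0 + 1)) => //; apply: runs_iff; first by rewrite /= e.
  by apply: runs_eq (@runs_skip _ _); st_solve.
apply: (@runs_le _ _ _ _ (((rg s r * 3 + 1) + 1) + 2)); first by rewrite e; lia.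
apply: runs_ift; first by rewrite /= e.
apply: (runs_seq (@runs_clear _ _ _)).
by apply: runs_act_eq; st_solve.
Qed.

Lemma count_iotaS (p : pred nat) i : count p (iota 0 i.+1) = count p (iota 0 i) + p i.
Proof. by rewrite -addn1 iotaD count_cat /= addn0. Qed.

(** A comparison becomes a truncated subtraction. A bounded quantifier counts all its witnesses,
    without early exit, and tests whether the count is positive. *)
Lemma ffm_code A (W : A -> seq bool) V P : ffm W V P ->
  exists c T, pbound T /\ fcode W V P c T.
Proof.
elim=> {A W V P} [A W V t1 t2 f1 f2|A W V t f|A W V P _ [c [T [p h]]]
  |A W V P Q _ [c1 [T1 [p1 h1]]] _ [c2 [T2 [p2 h2]]]
  |A W V t P f _ [c2 [T2 [p2 h2]]]|A W V P Q e _ [c [T [p h]]]].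
- have [c1 [T1 [p1 h1]]] := ftm_code f1; have [c2 [T2 [p2 h2]]] := ftm_code f2.
  exists (fun rs base dst => Seq (c1 rs base.+2 base) (Seq (c2 rs base.+2 base.+1)
    (Seq (Loop base (Act (ADec base.+1)))
    (If (CReg base.+1) (Seq (Loop base.+1 Skip) (Act (AInc dst))) Skip)))).
  exists (fun B => T1 B + (T2 B + ((T1 B * 4 + 1) + (T2 B * 3 + 4)))).
  split; first by pb.
  move=> a rs base dst s B eo; have db := eo_dst eo.
  have z1 := eo_zero eo (leqnn base); have z2 := eo_zero eo (leqnSn base).
  have eo1 : env_ok W V a rs base.+2 base s B.
    apply: (eo_tmp eo) => //=; last exact: eo_pt eo.
    by move=> x bx; apply: (eo_zero eo); lia.
  have [r1 b1] := h1 _ _ _ _ _ _ eo1.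
  have eo2 : env_ok W V a rs base.+2 base.+1 (addr s base (t1 a)) B.
    apply: (eo_tmp eo) => //=; last exact: eo_pt eo.
    - by move=> x bx _; rewrite ifN //; lia.
    - by move=> x bx; rewrite ifN; [apply: (eo_zero eo)|]; lia.
  have [r2 b2] := h2 _ _ _ _ _ _ eo2.
  apply: (runs_seq r1); apply: (runs_seq r2).
  pose S k := setr (setr s base (t1 a - k)) base.+1 (t2 a - k).
  apply: (@runs_seq _ _ _ _ (S (t1 a))).
    apply: (@runs_le _ _ _ _ (t1 a * (1 + 3) + 1)); first by lia.
    have := @runs_loop (W a) base (Act (ADec base.+1)) (t1 a) S 1.
    have -> : S 0 = addr (addr s base (t1 a)) base.+1 (t2 a).
      by rewrite /S; st_solve.
    apply=> [k le|k lk] /=; first by rewrite eqxx ifN //; lia.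
    by apply: runs_act_eq; rewrite /S; st_solve.
  have e1 : rg (S (t1 a)) base.+1 = t2 a - t1 a by rewrite /S /= eqxx.
  have := @runs_pos (W a) base.+1 dst (S (t1 a)).
  rewrite e1 => H.
  apply: (@runs_le _ _ _ _ ((t2 a - t1 a) * 3 + 4)); first by lia.
  apply: runs_eq (H _); last by lia.
  have -> : (t2 a - t1 a != 0) = (t1 a < t2 a) by lia.
  by rewrite /S; st_solve.
- have [c1 [T1 [p1 h1]]] := ftm_code f.
  exists (fun rs base dst => Seq (c1 rs base.+1 base) (Seq (Act APInc)
    (Seq (Loop base (Act APInc)) (Seq (If CBit (Act (AInc dst)) Skip)
    (While CPtr (Act APDec)))))).
  exists (fun B => T1 B + (1 + ((T1 B * 4 + 1) + (3 + (T1 B * 3 + 4))))).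
  split; first by pb.
  move=> a rs base dst s B eo; have db := eo_dst eo.
  have z1 := eo_zero eo (leqnn base); have hp := eo_pt eo.
  have eo1 : env_ok W V a rs base.+1 base s B.
    apply: (eo_tmp eo) => //=.
    by move=> x bx; apply: (eo_zero eo); lia.
  have [r1 b1] := h1 _ _ _ _ _ _ eo1.
  apply: (runs_seq r1); apply: (runs_seq (@runs_act _ _ _)).
  pose S k := St (rg (setr s base (t a - k))) k.+1 (ou s).
  apply: (@runs_seq _ _ _ _ (S (t a))).
    apply: (@runs_le _ _ _ _ (t a * (1 + 3) + 1)); first by lia.
    have := @runs_loop (W a) base (Act APInc) (t a) S 1.
    have -> : S 0 = doact APInc (addr s base (t a)) by rewrite /S; st_solve.
    apply=> [k le|k lk] /=; first by rewrite eqxx.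
    by apply: runs_act_eq; rewrite /S; st_solve.
  apply: (@runs_seq _ _ _ _ (addr (S (t a)) dst (nth false (W a) (t a)))).
    case e : (nth false (W a) (t a)).
      apply: (@runs_ift _ _ _ _ _ _ 1); first by rewrite /= e.
      by apply: runs_act_eq; rewrite /S; st_solve.
    apply: (@runs_le _ _ _ _ (0 + 1)) => //.
    apply: runs_iff; first by rewrite /= e.
    by apply: runs_eq (@runs_skip _ _); rewrite /S; st_solve.
  apply: (@runs_le _ _ _ _ ((t a).+1 * 3 + 1)); first by lia.
  by apply: runs_eq (@runs_pclear _ _); rewrite /S; st_solve.
- exists (fun rs base dst => Seq (c rs base.+1 base)
    (If (CReg base) (Act (ADec base)) (Act (AInc dst)))).
  exists (fun B => T B + 3); split; first by pb.
  move=> a rs base dst s B eo; have db := eo_dst eo.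
  have z1 := eo_zero eo (leqnn base).
  have eo1 : env_ok W V a rs base.+1 base s B.
    apply: (eo_tmp eo) => //=; last exact: eo_pt eo.
    by move=> x bx; apply: (eo_zero eo); lia.
  apply: (runs_seq (h _ _ _ _ _ _ eo1)).
  case: (P a).
    apply: (@runs_ift _ _ _ _ _ _ 1); first by rewrite /= eqxx addn1.
    by apply: runs_act_eq; st_solve.
  apply: (@runs_le _ _ _ _ (1 + 1)) => //.
  apply: runs_iff; first by rewrite /= eqxx z1.
  by apply: runs_act_eq; st_solve.
- exists (fun rs base dst => Seq (c1 rs base.+1 base)
    (If (CReg base) (Seq (Act (ADec base)) (c2 rs base.+1 dst)) Skip)).
  exists (fun B => T1 B + ((1 + T2 B) + 2)); split; first by pb.
  move=> a rs base dst s B eo; have db := eo_dst eo.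
  have z1 := eo_zero eo (leqnn base).
  have eo1 : env_ok W V a rs base.+1 base s B.
    apply: (eo_tmp eo) => //=; last exact: eo_pt eo.
    by move=> x bx; apply: (eo_zero eo); lia.
  apply: (runs_seq (h1 _ _ _ _ _ _ eo1)).
  have eo2 : env_ok W V a rs base.+1 dst s B.
    apply: (eo_move eo) => //=; last exact: eo_pt eo.
    - lia.
    - exact: eo_ndst eo.
    - by move=> x bx; apply: (eo_zero eo); lia.
  have r2 := h2 _ _ _ _ _ _ eo2.
  case: (P a) => /=.
    apply: runs_ift; first by rewrite /= eqxx addn1.
    apply: (@runs_seq _ _ _ _ s) => //.
    by apply: runs_act_eq; st_solve.
  apply: (@runs_le _ _ _ _ (0 + 1)); first by lia.
  apply: runs_iff; first by rewrite /= eqxx z1.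
  by apply: runs_eq (@runs_skip _ _); st_solve.
- have [c1 [T1 [p1 h1]]] := ftm_code f.
  exists (fun rs base dst => Seq (c1 rs (base + 3) base.+1)
    (Seq (Loop base.+1 (Seq (c2 (base :: rs) (base + 3) (base + 2))
                            (Act (AInc base))))
    (Seq (Loop base Skip)
    (If (CReg (base + 2)) (Seq (Loop (base + 2) Skip) (Act (AInc dst))) Skip)))).
  (* The quantified variable can be as large as the value of its bounding term, at most [T1 B]; the
     body is therefore charged at size [B + T1 B]. *)
  exists (fun B => T1 B + ((T1 B * (T2 (B + T1 B) + 4) + 1) +
                    ((T1 B * 3 + 1) + (T1 B * 3 + 4)))).
  split.
    by pb; apply: (@pbound_comp T2 (fun B => B + T1 B)) => //; pb.
  move=> a rs base dst s B eo; have db := eo_dst eo.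
  have z0 i : base <= i -> rg s i = 0 by apply: (eo_zero eo).
  have za : rg s base = 0 by apply: z0.
  have zb : rg s base.+1 = 0 by apply: z0; lia.
  have zc : rg s (base + 2) = 0 by apply: z0; lia.
  have hp := eo_pt eo.
  have eo1 : env_ok W V a rs (base + 3) base.+1 s B.
    apply: (eo_tmp eo) => //=; first by lia.
    by move=> x bx; apply: z0; lia.
  have [r1 b1] := h1 _ _ _ _ _ _ eo1.
  apply: (runs_seq r1).
  set n := t a in b1 *.
  pose S k := setr (setr (setr s base k) base.+1 (n - k)) (base + 2)
                (count (P a) (iota 0 k)).
  apply: (@runs_seq _ _ _ _ (S n)).
    apply: (@runs_le _ _ _ _ (n * ((T2 (B + T1 B) + 1) + 3) + 1)).
      by rewrite leq_add2r; apply: leq_mul => //; lia.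
    have := @runs_loop (W a) base.+1 (Seq (c2 (base :: rs) (base + 3) (base + 2))
             (Act (AInc base))) n S (T2 (B + T1 B) + 1).
    have -> : S 0 = addr s base.+1 n.
      by rewrite /S; st_solve.
    apply=> [k le|k lk] /=; first by rewrite eqxx ifN //; lia.
    have /= r2 := h2 (a, k) (base :: rs) (base + 3) (base + 2)
      (setr (S k) base.+1 (n - k.+1)) (B + T1 B) _.
    apply: (runs_seq (r2 _)).
      split=> /=.
      + by rewrite size_map (eo_size eo).
      + case=> [|i] /=; first by lia.
        by rewrite size_map => li; have := eo_rs eo (_ : i < size V); lia.
      + lia.
      + case=> [|i] /=; first by lia.
        by rewrite size_map => li; have := eo_rs eo (_ : i < size V); lia.
      + case=> [|i] /=.
          by rewrite eqxx !ifN //; lia.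
        rewrite size_map ltnS => li; rewrite (nth_map (fun=> 0)) //=.
        have lr := eo_rs eo li.
        by rewrite !ifN ?(eo_val eo) //; lia.
      + by move=> i li; rewrite !ifN ?z0 //; lia.
      + by [].
      + by apply: leq_trans (leq_addr _ _); apply: eo_w eo.
      + case=> [|i] /=; first by lia.
        rewrite size_map ltnS => li; rewrite (nth_map (fun=> 0)) //=.
        by apply: leq_trans (leq_addr _ _); apply: eo_bnd eo _ li.
    apply: runs_act_eq; rewrite /S count_iotaS; st_solve.
  apply: (@runs_seq _ _ _ _ (setr (S n) base 0)).
    apply: (@runs_le _ _ _ _ (rg (S n) base * 3 + 1)); last exact: runs_clear.
    by rewrite /S /= eqxx !ifN //; lia.
  have cn : count (P a) (iota 0 n) <= n.
    by apply: leq_trans (count_size _ _) _; rewrite size_iota.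
  have := @runs_pos (W a) (base + 2) dst (setr (S n) base 0).
  rewrite {2}/S /= eqxx ifN; last by lia.
  move=> H; apply: (@runs_le _ _ _ _ (count (P a) (iota 0 n) * 3 + 4)).
    by lia.
  apply: runs_eq (H _); last by lia.
  by rewrite -lt0n -has_count /S; st_solve.
- by exists c, T; split=> // a rs base dst s B eo; rewrite -e; apply: h.
Qed.

(** * Simulation of counter programs by Turing machines *)

Section Simulation.
Variables (prog : seq instr) (nr : nat).

Definition act_ok (a : act) :=
  match a with AInc r | ADec r => r < nr | _ => true end.
Definition cond_ok (b : cond) := if b is CReg r then r < nr else true.
Definition instr_ok L (i : instr) :=
  match i with
  | IAct a => act_ok a
  | IJf b l => cond_ok b && (l <= L)
  | IJmp l => l <= L
  end.

Let L := size prog.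
Let sym := option (bool + unit).
Let mark : sym := Some (inr tt).
Let reads := {ffun 'I_nr.+2 -> sym}.

(** A register is the head position on a tape of its own, with a marker on cell 0. The marker is
    what makes a zero test possible, since moving left from cell 0 is a silent no-op. *)
Definition tape_reg r : 'I_nr.+2 := inord r.+2.
Definition tape_in : 'I_nr.+2 := inord 1.

Definition cond_sym (b : cond) (rd : reads) : bool :=
  match b with
  | CReg r => rd (tape_reg r) != mark
  | CPtr => rd tape_in != mark
  | CBit => rd tape_in == Some (inl true)
  | CEnd => rd tape_in != None
  end.

Definition act_dir (a : act) (k : 'I_nr.+2) : direction :=
  match a with
  | AInc r => if k == tape_reg r then GoRight else Stay
  | ADec r => if k == tape_reg r then GoLeft else Stay
  | APInc => if k == tape_in then GoRight else Stay
  | APDec => if k == tape_in then GoLeft else Stay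
  | APut _ => if k == ord0 then GoRight else Stay
  end.

Definition act_write (a : act) (rd : reads) (k : 'I_nr.+2) : sym :=
  if a is APut b then if k == ord0 then Some (inl b) else rd k else rd k.

(* States 0, 1, 2 set the markers, move the input from tape 0 to tape 1 and
   rewind; state 3 + pc executes instruction pc. *)
Definition sim_trans (q : 'I_(L + 4)) (rd : reads) :
    'I_(L + 4) * ('I_nr.+2 -> sym * direction) :=
  let goto n : 'I_(L + 4) := insubd q n in
  match val q with
  | 0 => (goto 1, fun k => if k == ord0 then (rd k, Stay)
             else (mark, if k == tape_in then GoRight else Stay))
  | 1 => if rd ord0 is Some (inl b) then
           (goto 1, fun k => if k == ord0 then (None, GoRight)
              else if k == tape_in then (Some (inl b), GoRight)
              else (rd k, Stay))
         else (goto 2, fun k => (rd k, Stay))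
  | 2 => if rd tape_in == mark then (goto 3, fun k => (rd k, Stay))
         else (goto 2, fun k => (rd k,
           if (k == ord0) || (k == tape_in) then GoLeft else Stay))
  | pc.+3 =>
      match nth (IJmp 0) prog pc with
      | IAct a => (goto pc.+4, fun k => (act_write a rd k, act_dir a k))
      | IJf b l => (goto (if cond_sym b rd then pc.+4 else l.+3),
                    fun k => (rd k, Stay))
      | IJmp l => (goto l.+3, fun k => (rd k, Stay))
      end
  end.

Lemma sim_start_lt : 0 < L + 4. Proof. by rewrite addnS. Qed.

Definition sim : turing_machine :=
  @TuringMachine nr.+1 unit 'I_(L + 4) (Ordinal sim_start_lt)
    (fun q => val q == L + 3) sim_trans.

Variable w : seq bool.

Let in_tape i : sym := if i is j.+1 then word_tape sim w j else mark.
Let reg_tape i : sym := if i is 0 then mark else None.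

Record represents (c : tm_config sim) (pc : nat) (s : st) : Prop := Represents {
  rep_state : val (cfg_state c) = pc + 3;
  rep_h0 : cfg_head c ord0 = size (ou s);
  rep_t0 : forall i, cfg_tape c ord0 i = word_tape sim (ou s) i;
  rep_h1 : cfg_head c tape_in = pt s;
  rep_t1 : forall i, cfg_tape c tape_in i = in_tape i;
  rep_hr : forall r, r < nr -> cfg_head c (tape_reg r) = rg s r;
  rep_tr : forall r, r < nr -> forall i, cfg_tape c (tape_reg r) i = reg_tape i }.

Lemma tape_in_neq0 : (tape_in == ord0) = false.
Proof. by rewrite -val_eqE /= inordK. Qed.
Lemma tape_reg_neq0 r : r < nr -> (tape_reg r == ord0) = false.
Proof. by move=> lt; rewrite -val_eqE /= inordK // !ltnS. Qed.
Lemma tape_reg_neq1 r : r < nr -> (tape_reg r == tape_in) = false.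
Proof. by move=> lt; rewrite -val_eqE /= !inordK // !ltnS. Qed.
Lemma tape_reg_eq r r' : r < nr -> r' < nr -> (tape_reg r == tape_reg r') = (r == r').
Proof. by move=> lt lt'; rewrite -val_eqE /= !inordK ?ltnS. Qed.

Lemma word_tapeE (y : seq bool) i : word_tape sim y i =
  if i < size y then Some (inl (nth false y i)) else None.
Proof.
rewrite /word_tape; case: ltnP => h; first by rewrite (nth_map false).
by rewrite nth_default ?size_map.
Qed.

Hypothesis prog_ok : all (instr_ok L) prog.

Lemma cond_symE c pc s b : represents c pc s -> cond_ok b ->
  cond_sym b [ffun k => cfg_tape c k (cfg_head c k)] = holds w b s.
Proof.
case=> _ _ _ h1 t1 hr tr; case: b => [r|||] //= hb; rewrite ffunE.
- by rewrite hr // tr //; case: (rg s r).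
- by rewrite h1 t1; case: (pt s) => //= n; rewrite word_tapeE; case: ifP.
- rewrite h1 t1; case: (pt s) => //= n; rewrite word_tapeE.
  case: ltnP => h; last by rewrite nth_default.
  by case: (nth _ _ _).
- rewrite h1 t1; case: (pt s) => //= n; rewrite word_tapeE.
  by case: ltnP.
Qed.

Lemma sim_step c pc s : represents c pc s -> pc < L ->
  represents (tm_step c) (istep w prog (pc, s)).1 (istep w prog (pc, s)).2 /\
  (istep w prog (pc, s)).1 <= L.
Proof.
move=> R lt; have [hs h0 t0 h1 t1 hr tr] := R.
rewrite /istep /= lt /tm_step.
have -> : tm_halt (cfg_state c) = false by rewrite /= hs; apply/eqP; lia.
rewrite /= /sim_trans hs addn3.
have iok : instr_ok L (nth (IJmp 0) prog pc) by apply: (all_nthP (IJmp 0) prog_ok).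
have same k i : (if i == cfg_head c k
    then [ffun k0 => cfg_tape c k0 (cfg_head c k0)] k
    else cfg_tape c k i) = cfg_tape c k i.
  by rewrite ffunE; case: eqP => // ->.
case: (nth _ _ _) iok => [a|b l|l] /= iok.
- split=> //; split=> /=.
  + by rewrite insubdK /in_mem /= ?addn3 // !addnS !ltnS addn0.
  + by case: a iok => [r|r|||b] /= iok; rewrite ?tape_in_neq0 ?eqxx //=
      ?h0 ?size_rcons // eq_sym ?tape_reg_neq0 // ?tape_in_neq0.
  + move=> i; case: a iok => [r|r|||b] /= iok; rewrite ?same ?t0 //.
    rewrite h0 !word_tapeE size_rcons nth_rcons.
    by case: (ltngtP i (size (ou s))) => h; rewrite ?ltnS; [rewrite ltnW|
      rewrite leqNgt h|rewrite h leqnn].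
  + case: a iok => [r|r|||b] /= iok; rewrite ?eqxx ?tape_in_neq0 //= ?h1 //.
    * by rewrite eq_sym tape_reg_neq1.
    * by rewrite eq_sym tape_reg_neq1.
  + by move=> i; case: a iok => [r|r|||b] /= iok; rewrite ?tape_in_neq0 ?same ?t1.
  + move=> r lr; case: a iok => [r'|r'|||b] /= iok;
    rewrite ?tape_reg_eq ?tape_reg_neq0 ?tape_reg_neq1 ?hr //=.
    * by case: eqP => [->|].
    * by case: eqP => [->|].
  + by move=> r lr i; case: a iok => [r'|r'|||b] /= iok;
    rewrite ?tape_reg_neq0 ?same ?tr.
- move/andP: iok => [bo le]; rewrite (cond_symE R bo); split; last by case: ifP.
  split=> //=.
  + rewrite insubdK /in_mem /= ?addn3; first by case: ifP.
    by case: ifP; lia.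
  + by move=> i; rewrite same t0.
  + by move=> i; rewrite same t1.
  + by move=> r lr i; rewrite same tr.
- split=> //; split=> //=.
  + by rewrite insubdK /in_mem /= ?addn3 //; lia.
  + by move=> i; rewrite same t0.
  + by move=> i; rewrite same t1.
  + by move=> r lr i; rewrite same tr.
Qed.

Lemma sim_iter t c pc s : represents c pc s -> pc <= L ->
  represents (iter t (@tm_step sim) c) (iter t (istep w prog) (pc, s)).1
    (iter t (istep w prog) (pc, s)).2 /\ (iter t (istep w prog) (pc, s)).1 <= L.
Proof.
elim: t => //= t IH R le; have [R' le'] := IH R le.
case: (iter t (istep w prog) (pc, s)) R' le' => pc' s' /= R' le'.
case: (ltnP pc' L) => h; first exact: sim_step.
have e : pc' = L by lia.
have -> : istep w prog (pc', s') = (pc', s') by rewrite /istep /= ltnNge h.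
have stay x : tm_halt (cfg_state x) -> @tm_step sim x = x.
  by move=> hx; rewrite /tm_step hx.
by rewrite stay //= (rep_state R') e.
Qed.

(** The invariant of the set-up phase: [j] letters have been moved to tape 1. They are erased from
    tape 0, which later has to hold the output alone. *)
Record copying (c : tm_config sim) (q j h0 h1 : nat) : Prop := Copying {
  cp_state : val (cfg_state c) = q;
  cp_h0 : cfg_head c ord0 = h0;
  cp_t0 : forall i, cfg_tape c ord0 i = if i < j then None else word_tape sim w i;
  cp_h1 : cfg_head c tape_in = h1;
  cp_t1 : forall i, cfg_tape c tape_in i = if i <= j then in_tape i else None;
  cp_hr : forall r, r < nr -> cfg_head c (tape_reg r) = 0;
  cp_tr : forall r, r < nr -> forall i, cfg_tape c (tape_reg r) i = reg_tape i }.

Lemma sim_init : copying (tm_step (tm_init sim w)) 1 0 0 1.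
Proof.
rewrite /tm_step.
have -> : tm_halt (cfg_state (tm_init sim w)) = false.
  by rewrite /= addnS.
split=> //=.
- by rewrite insubdK ?unfold_in /= ?addnS.
- by move=> i; rewrite ffunE eqxx /=; case: eqP => // ->.
- by rewrite tape_in_neq0 eqxx.
- by move=> [|i]; rewrite /= tape_in_neq0.
- by move=> r lr; rewrite tape_reg_neq0 // tape_reg_neq1.
- by move=> r lr [|i]; rewrite /= tape_reg_neq0.
Qed.

Lemma sim_copy c j : copying c 1 j j j.+1 -> j < size w ->
  copying (tm_step c) 1 j.+1 j.+1 j.+2.
Proof.
case=> hs h0 t0 h1 t1 hr tr lt; rewrite /tm_step.
have -> : tm_halt (cfg_state c) = false by rewrite /= hs; apply/eqP; lia.
rewrite /= /sim_trans hs ffunE h0 t0 ltnn word_tapeE lt.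
split=> //=.
- by rewrite insubdK ?unfold_in /= ?addnS.
- by rewrite h0.
- by move=> i; rewrite h0 t0 ltnS; case: (ltngtP i j).
- by rewrite tape_in_neq0 eqxx h1.
- move=> i; rewrite tape_in_neq0 eqxx h1 t1.
  case: eqP => [->|/eqP ne] /=; first by rewrite leqnn word_tapeE lt.
  by rewrite [in RHS]leq_eqVlt (negbTE ne) ltnS.
- by move=> r lr; rewrite tape_reg_neq0 // tape_reg_neq1 //= hr.
- move=> r lr i; rewrite tape_reg_neq0 // tape_reg_neq1 //= ffunE -(tr _ lr).
  by case: eqP => // ->.
Qed.

Lemma sim_turn c : copying c 1 (size w) (size w) (size w).+1 ->
  copying (tm_step c) 2 (size w) (size w) (size w).+1.
Proof.
case=> hs h0 t0 h1 t1 hr tr; rewrite /tm_step.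
have -> : tm_halt (cfg_state c) = false by rewrite /= hs; apply/eqP; lia.
rewrite /= /sim_trans hs ffunE h0 t0 ltnn word_tapeE ltnn.
split=> //=.
- by rewrite insubdK ?unfold_in /= ?addnS.
- by move=> i; rewrite -t0 ffunE; case: eqP => // ->.
- by move=> i; rewrite -t1 ffunE; case: eqP => // ->.
- by move=> r lr i; rewrite ffunE -(tr _ lr); case: eqP => // ->.
Qed.

Lemma sim_rewind c j : copying c 2 (size w) j j.+1 ->
  copying (tm_step c) 2 (size w) j.-1 j.
Proof.
case=> hs h0 t0 h1 t1 hr tr; rewrite /tm_step.
have -> : tm_halt (cfg_state c) = false by rewrite /= hs; apply/eqP; lia.
rewrite /= /sim_trans hs ffunE h1 t1.
have -> : (if j < size w then in_tape j.+1 else None) == mark = false.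
  by rewrite /= word_tapeE; case: ltnP.
split=> //=.
- by rewrite insubdK ?unfold_in /= ?addnS.
- by rewrite h0.
- by move=> i; rewrite -t0 ffunE; case: eqP => // ->.
- by rewrite eqxx orbT /= h1.
- by move=> i; rewrite -t1 ffunE; case: eqP => // ->.
- by move=> r lr; rewrite tape_reg_neq0 // tape_reg_neq1 //= hr.
- by move=> r lr i; rewrite ffunE -(tr _ lr); case: eqP => // ->.
Qed.

Lemma sim_begin c : copying c 2 (size w) 0 0 ->
  represents (tm_step c) 0 (St (fun=> 0) 0 [::]).
Proof.
case=> hs h0 t0 h1 t1 hr tr; rewrite /tm_step.
have -> : tm_halt (cfg_state c) = false by rewrite /= hs; apply/eqP; lia.
rewrite /= /sim_trans hs ffunE h1 t1 /=.
have same k i : (if i == cfg_head c k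
    then [ffun k0 => cfg_tape c k0 (cfg_head c k0)] k
    else cfg_tape c k i) = cfg_tape c k i.
  by rewrite ffunE; case: eqP => // ->.
split=> //=.
- by rewrite insubdK ?unfold_in /= ?addnS.
- by move=> i; rewrite same t0 !word_tapeE; case: ltnP.
- move=> i; rewrite same t1; case: i => //= i; rewrite word_tapeE.
  by case: ltnP.
- by move=> r lr i; rewrite same tr.
Qed.

Lemma sim_prepare :
  represents (iter (2 * size w + 4) (@tm_step sim) (tm_init sim w)) 0
    (St (fun=> 0) 0 [::]).
Proof.
have H1 j : j <= size w ->
    copying (iter j.+1 (@tm_step sim) (tm_init sim w)) 1 j j j.+1.
  elim: j => [|j IH] le; first exact: sim_init.
  by rewrite iterS; apply: sim_copy => //; apply: IH; apply: ltnW.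
have H2 : copying (iter (size w).+2 (@tm_step sim) (tm_init sim w)) 2
    (size w) (size w) (size w).+1.
  by rewrite iterS; apply: sim_turn; apply: H1.
have H3 j : j <= size w ->
    copying (iter (j + (size w).+2) (@tm_step sim) (tm_init sim w)) 2
    (size w) (size w - j) (size w - j).+1.
  elim: j => [|j IH] le; first by rewrite subn0.
  rewrite addSn iterS.
  have -> : size w - j.+1 = (size w - j).-1 by lia.
  have -> : (size w - j).-1.+1 = size w - j by lia.
  by apply: sim_rewind; apply: IH; apply: ltnW.
(* One step writes the markers, [size w] steps copy, one turns, [size w + 1] rewind and one enters
   the program. In the last rewinding step the head of tape 0 is already on cell 0 and stays
   there. *)
have -> : 2 * size w + 4 = (size w + (size w).+2).+2 by lia.
rewrite 2!iterS; apply: sim_begin; apply: (@sim_rewind _ 0).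
by have := H3 _ (leqnn _); rewrite subnn.
Qed.

End Simulation.

(** * Polynomial time from counter programs *)

Fixpoint cmd_regs c := match c with
  | Skip => 0
  | Act (AInc r) | Act (ADec r) => r.+1
  | Act _ => 0
  | Seq c1 c2 => maxn (cmd_regs c1) (cmd_regs c2)
  | If b c1 c2 => maxn (if b is CReg r then r.+1 else 0)
                    (maxn (cmd_regs c1) (cmd_regs c2))
  | While b c => maxn (if b is CReg r then r.+1 else 0) (cmd_regs c)
  end.

Lemma compile_ok nr c pc L : cmd_regs c <= nr -> pc + len c <= L ->
  all (instr_ok nr L) (compile c pc).
Proof.
have bok b : (if b is CReg r then r.+1 else 0) <= nr -> cond_ok nr b by case: b.
elim: c pc => [|a|c1 I1 c2 I2|b c1 I1 c2 I2|b c I] pc //=.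
- by case: a => [r|r|||b] //= ->.
- by rewrite geq_max => /andP[h1 h2] le; rewrite all_cat I1 ?I2 //; lia.
- rewrite !geq_max => /and3P[h h1 h2] le.
  by rewrite all_cat /= bok //= I1 ?I2 //; lia.
- rewrite !geq_max => /andP[h h1] le.
  by rewrite all_cat /= bok //= I //; lia.
Qed.

Lemma polytime_runs (f : seq bool -> seq bool) c T : pbound T ->
  (forall w, exists2 s, runs w c (St (fun=> 0) 0 [::]) s (T (size w)) &
     ou s = f w) ->
  polytime f.
Proof.
move=> [k hk] H; pose prog := compile c 0.
exists (sim prog (cmd_regs c)), ((2%N)%:P * 'X + (4%N)%:P + ('X + (2%N)%:P) ^+ k)%R => w.
have [s Hs e] := H w.
have [|t lt E] := Hs prog 0; first by exists [::], [::]; rewrite cats0.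
have ok : all (instr_ok (cmd_regs c) (size prog)) prog.
  by apply: compile_ok; rewrite ?add0n ?size_compile.
have [R _] := sim_iter ok t (@sim_prepare prog (cmd_regs c) w ok) (leq0n _).
rewrite -iterD E /= add0n in R.
have sz : len c = size prog by rewrite size_compile.
set M := sim _ _ in R *; rewrite /tm_computes_within.
have halts : tm_halt (cfg_state (iter (t + (2 * size w + 4)) (@tm_step M)
    (tm_init M w))) by rewrite /= (rep_state R) sz.
have stay d x : tm_halt (cfg_state x) -> iter d (@tm_step M) x = x.
  by move=> hx; elim: d => //= d ->; rewrite /tm_step hx.
set p := (X in iter X.[_]%R).
have le : t + (2 * size w + 4) <= p.[size w]%R.
  rewrite /p !(hornerD, hornerM, hornerC, hornerX, horner_exp).
  have := hk (size w).
  rewrite !natrDE !natrME natrXE; lia.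
rewrite -(subnK le) iterD stay //; split=> // i le'.
by rewrite (rep_t0 R) e.
Qed.

Lemma polytime_pred (P : seq bool -> bool) :
  ffm (fun w : seq bool => w) [::] P -> polytime (fun w => [:: P w]).
Proof.
move=> /ffm_code[c [T [pT h]]].
apply: (@polytime_runs _ (Seq (c [::] 1 0)
  (If (CReg 0) (Act (APut true)) (Act (APut false)))) (fun B => T B + 3)).
  by pb.
move=> w; have eo : env_ok (fun w : seq bool => w) [::] w [::] 1 0
   (St (fun=> 0) 0 [::]) (size w) by split.
have r := h _ _ _ _ _ _ eo.
exists (St (rg (addr (St (fun=> 0) 0 [::]) 0 (P w))) 0 [:: P w]) => //.
apply: (runs_seq r); case: (P w).
  by apply: (@runs_ift _ _ _ _ _ _ 1) => //; apply: runs_act_eq.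
apply: (@runs_le _ _ _ _ (1 + 1)) => //.
by apply: runs_iff => //; apply: runs_act_eq.
Qed.

(** The state of the double loop that prints a matrix: registers 0 and 2 hold the row and column
    indices, 1 and 3 the numbers of iterations left, and 4 the current entry. *)
Definition gst i ci j cj v (o : seq bool) :=
  St (fun x => match x with 0 => i | 1 => ci | 2 => j | 3 => cj | 4 => v | _ => 0
      end) 0 o.

Ltac gst_solve := apply: st_ext => //=; do 5 (case=> //=); try lia.

Lemma iotaS_rcons i : iota 0 i.+1 = rcons (iota 0 i) i.
Proof. by rewrite -addn1 iotaD /= cats1. Qed.

(** The output has the format of a graph code, so a reduction to a graph problem only needs a
    definable order and a definable adjacency relation. *)
Lemma polytime_matrix (N : seq bool -> nat) (P : seq bool -> nat -> nat -> bool) :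
  ftm (fun w : seq bool => w) [::] N ->
  ffm (wlift (wlift (fun w : seq bool => w))) (vlift (vlift [::]))
    (fun a => P a.1.1 a.1.2 a.2) ->
  polytime (fun w => nseq (N w) true ++ false ::
    [seq P w i j | i <- iota 0 (N w), j <- iota 0 (N w)]).
Proof.
move=> /ftm_code[cN [TN [pN hN]]] /ffm_code[cF [TF [pF hF]]].
pose jbody := Seq (cF [:: 2; 0] 5 4) (Seq (If (CReg 4)
   (Seq (Act (APut true)) (Act (ADec 4))) (Act (APut false))) (Act (AInc 2))).
pose ibody := Seq (cN [::] 5 3) (Seq (Loop 3 jbody)
   (Seq (Loop 2 Skip) (Act (AInc 0)))).
pose code := Seq (cN [::] 5 1) (Seq (Loop 1 (Act (APut true)))
  (Seq (Act (APut false)) (Seq (cN [::] 5 1) (Loop 1 ibody)))).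
pose TJ B := TF (B + TN B) + (4 + 1).
pose TI B := TN B + ((TN B * (TJ B + 3) + 1) + ((TN B * 3 + 1) + 1)).
apply: (@polytime_runs _ code (fun B => TN B + ((TN B * (1 + 3) + 1) +
   (1 + (TN B + (TN B * (TI B + 3) + 1)))))).
  rewrite /TI /TJ; have : pbound (fun B => TF (B + TN B)).
    by apply: (@pbound_comp TF (fun B => B + TN B)) => //; pb.
  by move=> ?; pb.
move=> w; set B := size w; set n := N w.
have hcN dst s : dst < 5 -> (forall i, 5 <= i -> rg s i = 0) -> pt s = 0 ->
    runs w (cN [::] 5 dst) s (addr s dst n) (TN B) /\ n <= TN B.
  move=> d5 hz hp.
  by have := hN w [::] 5 dst s B; apply; split.
have nT : n <= TN B.
  by have := @hcN 0 (St (fun=> 0) 0 [::]) isT (fun _ _ => erefl) erefl; case.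
have rJ i j ci cj o : i < n -> j < n ->
    runs w jbody (gst i ci j cj 0 o) (gst i ci j.+1 cj 0 (rcons o (P w i j)))
      (TJ B).
  move=> li lj.
  have := hF ((w, i), j) [:: 2; 0] 5 4 (gst i ci j cj 0 o) (B + TN B) _.
  move=> /(_ _)/wrap[]; last move=> /= r1.
    split=> //=.
    - by case=> [|[|k]].
    - by case=> [|[|k]].
    - by case=> [|[|k]].
    - by do 5 (case=> //=).
    - by rewrite leq_addr.
    - by case=> [|[|k]] //= _; lia.
  apply: (runs_seq r1).
  apply: (@runs_seq _ _ _ _ (gst i ci j cj 0 (rcons o (P w i j)))).
    case: (P w i j).
      apply: (@runs_ift _ _ _ _ _ _ (1 + 1)) => //.
      apply: (runs_seq (@runs_act _ _ _)); apply: runs_act_eq.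
      by gst_solve.
    apply: (@runs_le _ _ _ _ (1 + 1)) => //.
    apply: runs_iff => //; apply: runs_act_eq; by gst_solve.
  by apply: runs_act_eq; gst_solve.
have rI i ci o : i < n -> runs w ibody (gst i ci 0 0 0 o)
    (gst i.+1 ci 0 0 0 (o ++ [seq P w i j | j <- iota 0 n])) (TI B).
  move=> li.
  have [|//|r1 _] := @hcN 3 (gst i ci 0 0 0 o) isT; first by do 5 (case=> //=).
  apply: (runs_seq r1).
  pose S j := gst i ci j (n - j) 0 (o ++ [seq P w i j | j <- iota 0 j]).
  apply: (@runs_seq _ _ _ _ (S n)).
    apply: (@runs_le _ _ _ _ (n * (TJ B + 3) + 1)).
      by rewrite leq_add2r leq_mul2r nT orbT.
    have := @runs_loop w 3 jbody n S (TJ B).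
    have -> : S 0 = addr (gst i ci 0 0 0 o) 3 n.
      by rewrite /S subn0 cats0; gst_solve.
    apply=> [j le|j lj] //=.
    have -> : setr (S j) 3 (n - j.+1) =
        gst i ci j (n - j.+1) 0 (o ++ [seq P w i j | j <- iota 0 j]).
      by rewrite /S; gst_solve.
    by rewrite /S iotaS_rcons map_rcons -rcons_cat; apply: rJ.
  apply: (@runs_seq _ _ _ _ (setr (S n) 2 0)).
    by apply: runs_le (@runs_clear _ _ _); rewrite /=; lia.
  by apply: runs_act_eq; rewrite /S subnn; gst_solve.
exists (gst n 0 0 0 0 (nseq n true ++ false ::
    [seq P w i j | i <- iota 0 n, j <- iota 0 n])) => //.
have e0 : St (fun=> 0) 0 [::] = gst 0 0 0 0 0 [::] by gst_solve.
rewrite e0.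
have [|//|r1 _] := @hcN 1 (gst 0 0 0 0 0 [::]) isT; first by do 5 (case=> //=).
apply: (runs_seq r1).
apply: (@runs_seq _ _ _ _ (gst 0 0 0 0 0 (nseq n true))).
  apply: (@runs_le _ _ _ _ (n * (1 + 3) + 1)).
    by rewrite leq_add2r leq_mul2r nT orbT.
  pose S j := gst 0 (n - j) 0 0 0 (nseq j true).
  have := @runs_loop w 1 (Act (APut true)) n S 1.
  have -> : S 0 = addr (gst 0 0 0 0 0 [::]) 1 n.
    by rewrite /S subn0; gst_solve.
  have -> : S n = gst 0 0 0 0 0 (nseq n true) by rewrite /S subnn.
  apply=> [j le|j lj] //=.
  have e j' : nseq j'.+1 true = rcons (nseq j' true) true.
    by elim: j' => //= k {1}->.
  by apply: runs_act_eq; rewrite /S e; gst_solve.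
apply: (@runs_seq _ _ _ _ (gst 0 0 0 0 0 (nseq n true ++ [:: false]))).
  by apply: runs_act_eq; rewrite cats1; gst_solve.
have [|//|r2 _] := @hcN 1 (gst 0 0 0 0 0 (nseq n true ++ [:: false])) isT.
  by do 5 (case=> //=).
apply: (runs_seq r2).
apply: (@runs_le _ _ _ _ (n * (TI B + 3) + 1)).
  by rewrite leq_add2r leq_mul2r nT orbT.
pose S k := gst k (n - k) 0 0 0 ((nseq n true ++ [:: false]) ++
    [seq P w i j | i <- iota 0 k, j <- iota 0 n]).
have := @runs_loop w 1 ibody n S (TI B).
have -> : S 0 = addr (gst 0 0 0 0 0 (nseq n true ++ [:: false])) 1 n.
  by rewrite /S subn0 cats0; gst_solve.
have -> : S n = gst n 0 0 0 0 (nseq n true ++ false ::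
    [seq P w i j | i <- iota 0 n, j <- iota 0 n]).
  by rewrite /S subnn -catA.
apply=> [j le|j lj] //=.
have -> : setr (S j) 1 (n - j.+1) = gst j (n - j.+1) 0 0 0
   ((nseq n true ++ [:: false]) ++ [seq P w i j | i <- iota 0 j, j <- iota 0 n]).
  by rewrite /S; gst_solve.
rewrite /S iotaS_rcons -cats1 allpairs_cat /= cats0 catA.
exact: rI.
Qed.

(** * Definability lemmas *)

Section Closure.
Variables (A : Type) (W : A -> seq bool) (V : seq (A -> nat)).

Lemma ft_weak t : ftm W V t -> ftm (wlift W) (vlift V) (fun x => t x.1).
Proof.
elim=> {t} [i lt|n||t1 t2 _ h1 _ h2|t1 t2 _ h1 _ h2|t1 t2 e _ h].
- apply: (@ft_ext _ _ _ (nth (fun=> 0) (vlift V) i.+1)).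
    by move=> x /=; rewrite (nth_map (fun=> 0)).
  by apply: ft_var; rewrite /= size_map ltnS.
- exact: ft_const.
- exact: (ft_len (wlift W)).
- exact: (ft_add h1 h2).
- exact: (ft_mul h1 h2).
- by apply: ft_ext h => x.
Qed.

Lemma ft_top : ftm (wlift W) (vlift V) snd.
Proof. exact: (@ft_var _ _ (vlift V) 0). Qed.

Lemma ft_succ t : ftm W V t -> ftm W V (fun a => (t a).+1).
Proof.
move=> h; apply: ft_ext (ft_add (ft_const _ _ 1) h) => a; exact: add1n.
Qed.

Lemma ff_true : ffm W V (fun=> true).
Proof. exact: (ff_lt (ft_const _ _ 0) (ft_const _ _ 1)). Qed.

Lemma ff_const b : ffm W V (fun=> b).
Proof. case: b; [exact: ff_true|exact: (ff_not ff_true)]. Qed.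

Lemma ff_or P Q : ffm W V P -> ffm W V Q -> ffm W V (fun a => P a || Q a).
Proof.
move=> hP hQ; apply: ff_ext (ff_not (ff_and (ff_not hP) (ff_not hQ))) => a.
by rewrite negb_and !negbK.
Qed.

Lemma ff_imp P Q : ffm W V P -> ffm W V Q -> ffm W V (fun a => P a ==> Q a).
Proof.
by move=> hP hQ; apply: ff_ext (ff_or (ff_not hP) hQ) => a; rewrite implybE.
Qed.

Lemma ff_if B P Q : ffm W V B -> ffm W V P -> ffm W V Q ->
  ffm W V (fun a => if B a then P a else Q a).
Proof.
move=> hB hP hQ.
apply: ff_ext (ff_or (ff_and hB hP) (ff_and (ff_not hB) hQ)) => a.
by case: (B a) => //=; rewrite orbF.
Qed.

Lemma ff_le t1 t2 : ftm W V t1 -> ftm W V t2 -> ffm W V (fun a => t1 a <= t2 a).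
Proof. by move=> h1 h2; apply: ff_ext (ff_lt h1 (ft_succ h2)). Qed.

Lemma ff_eq t1 t2 : ftm W V t1 -> ftm W V t2 -> ffm W V (fun a => t1 a == t2 a).
Proof.
move=> h1 h2; apply: ff_ext (ff_and (ff_le h1 h2) (ff_le h2 h1)) => a.
by rewrite eqn_leq.
Qed.

Lemma ff_all t (P : A -> nat -> bool) : ftm W V t ->
  ffm (wlift W) (vlift V) (fun x => P x.1 x.2) ->
  ffm W V (fun a => all (P a) (iota 0 (t a))).
Proof.
move=> ht hP.
apply: ff_ext (ff_not (ff_ex (P := fun a y => ~~ P a y) ht (ff_not hP))) => a.
by rewrite /= -all_predC; apply: eq_all => y /=; rewrite negbK.
Qed.

Lemma ff_hasl (I : Type) (l : seq I) (P : I -> A -> bool) :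
  (forall i, ffm W V (P i)) -> ffm W V (fun a => has (fun i => P i a) l).
Proof.
by move=> h; elim: l => [|i l IH]; [apply: ff_const|apply: ff_or].
Qed.

Lemma ft_horner (p : {poly nat}) t : ftm W V t -> ftm W V (fun a => p.[t a])%R.
Proof.
move=> ht; rewrite /horner; elim: (polyseq p) => [|c l IH] /=.
  exact: ft_const.
exact: (ft_add (ft_mul IH ht) (ft_const _ _ c)).
Qed.

End Closure.

(* Quotient and remainder by guessing the quotient below the dividend. *)
Lemma ff_divmod A (W : A -> seq bool) V t d (P : A -> nat -> nat -> bool) : ftm W V t -> ftm W V d ->
  ffm (wlift (wlift W)) (vlift (vlift V)) (fun x => P x.1.1 x.1.2 x.2) ->
  ffm W V (fun a => (0 < d a) && P a (t a %/ d a) (t a %% d a)).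
Proof.
move=> ht hd hP.
pose Q a q := has (fun r => (t a == q * d a + r) && P a q r) (iota 0 (d a)).
apply: (@ff_ext _ _ _ (fun a => has (Q a) (iota 0 (t a).+1))).
  move=> a; apply/hasP/andP => [[q _ /hasP[r]]|[d0 h]].
    rewrite mem_iota add0n /= => lr /andP[/eqP e p].
    have d0 : 0 < d a by lia.
    by rewrite e divnMDl // divn_small // addn0 modnMDl modn_small.
  exists (t a %/ d a).
    by rewrite mem_iota /= add0n ltnS leq_div.
  apply/hasP; exists (t a %% d a); first by rewrite mem_iota /= add0n ltn_mod.
  by rewrite -divn_eq eqxx.
apply: ff_ex; first exact: ft_succ.
apply: ff_ex; first exact: ft_weak.
apply: ff_and hP.
apply: ff_eq; first exact: (ft_weak (ft_weak ht)).
apply: (ft_add _ (ft_top _ _)); apply: ft_mul; last exact: (ft_weak (ft_weak hd)).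
exact: ft_weak (ft_top _ _).
Qed.

(** * The tableau of a nondeterministic computation *)

Lemma size_pair_code x w : size (pair_code x w) = 2 * size x + 1 + size w.
Proof. by rewrite /pair_code size_cat /=; elim: x => //= b x IH; lia. Qed.

Lemma nth_pair_code x w i : nth false (pair_code x w) i =
  if i < 2 * size x then (if odd i then nth false x i./2 else true)
  else (2 * size x < i) && nth false w (i - (2 * size x).+1).
Proof.
rewrite /pair_code; elim: x i => [|b x IH] i /=; first by case: i => //= i; rewrite subn1.
have -> : 2 * (size x).+1 = (2 * size x).+2 by lia.
by case: i => [|[|i]] //=; rewrite IH negbK !ltnS subSS.
Qed.

Lemma horner_nat_mono (p : {poly nat}) m n : m <= n -> p.[m]%R <= p.[n]%R.
Proof.
move=> le; rewrite /horner; elim: (polyseq p) => //= c l IH.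
rewrite !natrDE !natrME; apply: leq_add => //; exact: leq_mul.
Qed.

Section Tableau.
Variables (M : turing_machine) (p q : {poly nat}).

Local Notation K := ('I_(tm_tapes M).+1).
Local Notation cel := (option (bool + tm_aux M))%type.
Local Notation state := (tm_state M).

(** The kinds of propositional variables have to form a finite type; [option bool] stands in for
    [direction], which is not one. *)
Definition dcode (d : direction) : option bool :=
  match d with GoLeft => None | Stay => Some false | GoRight => Some true end.
Definition dmove (d : option bool) i :=
  match d with None => i.-1 | Some b => i + b end.

Lemma dmoveE d i : dmove (dcode d) i = move_head d i.
Proof. by case: d => //=; rewrite ?addn0 ?addn1. Qed.

(** The transition made total by standing still in halting states, so that one local rule without
    exception describes [tm_step]. *)
Definition delta (s : state) (rd : {ffun K -> cel}) : state * (K -> cel * direction) :=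
  if tm_halt s then (s, fun k => (rd k, Stay)) else tm_trans s rd.

Definition creads (c : tm_config M) : {ffun K -> cel} :=
  [ffun k => cfg_tape c k (cfg_head c k)].
Definition cout (c : tm_config M) := delta (cfg_state c) (creads c).

Lemma step_state c : cfg_state (tm_step c) = (cout c).1.
Proof. by rewrite /tm_step /cout /delta; case: ifP. Qed.

Lemma step_head c k :
  cfg_head (tm_step c) k = dmove (dcode ((cout c).2 k).2) (cfg_head c k).
Proof. by rewrite dmoveE /tm_step /cout /delta; case: ifP. Qed.

Lemma step_tape c k i : cfg_tape (tm_step c) k i =
  if i == cfg_head c k then ((cout c).2 k).1 else cfg_tape c k i.
Proof.
rewrite /tm_step /cout /delta; case: ifP => //= _.
by case: eqP => // ->; rewrite ffunE.
Qed.

(* Propositional variables of a time and a position: the tag tells state (0),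
   tape content (1), head (2), symbol read (3), symbol written (4) and move
   (5); the components a tag does not use are ignored. *)
Definition vkind : finType := ('I_6 * (K * cel * option bool * state))%type.
Definition vS (s : state) : vkind := (@Ordinal 6 0 isT, (ord0, None, None, s)).
Definition vC k (a : cel) : vkind :=
  (@Ordinal 6 1 isT, (k, a, None, tm_start M)).
Definition vH k : vkind := (@Ordinal 6 2 isT, (k, None, None, tm_start M)).
Definition vR k (a : cel) : vkind :=
  (@Ordinal 6 3 isT, (k, a, None, tm_start M)).
Definition vW k (a : cel) : vkind :=
  (@Ordinal 6 4 isT, (k, a, None, tm_start M)).
Definition vD k d : vkind := (@Ordinal 6 5 isT, (k, None, d, tm_start M)).

Definition cval (c : tm_config M) (i : nat) (v : vkind) : bool :=
  let: (tag, (k, a, d, s)) := v in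
  match val tag with
  | 0 => cfg_state c == s
  | 1 => cfg_tape c k i == a
  | 2 => cfg_head c k == i
  | 3 => creads c k == a
  | 4 => ((cout c).2 k).1 == a
  | _ => dcode ((cout c).2 k).2 == d
  end.

Definition target := (state + (K * cel + K * option bool))%type.
(** The tag selects a family of clauses and the other components are parameters. A single finite
    type for all families allows clauses to be numbered by plain arithmetic; a family that ignores a
    parameter merely repeats its clauses. *)
Definition ckind : finType :=
  ('I_15 * (K * cel * cel * option bool * bool * state * {ffun K -> cel} * target))%type.
Definition mkc n (lt : n < 15) k a a' d b s rd tg : ckind :=
  (Ordinal lt, (k, a, a', d, b, s, rd, tg)).
Arguments mkc n {lt}.

(* A literal is (sign, time offset, position selector, variable kind). *)
Definition literal := (bool * bool * nat * vkind)%type.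

Definition conclusion s rd (tg : target) : literal :=
  match tg with
  | inl s' => ((delta s rd).1 == s', true, 0, vS s')
  | inr (inl (k, a)) => (((delta s rd).2 k).1 == a, false, 0, vW k a)
  | inr (inr (k, d)) => (dcode ((delta s rd).2 k).2 == d, false, 0, vD k d)
  end.

(** Tags 0 to 4 express one step: reading, transition, writing, persistence of the cells off the
    head, and motion of the head. Tags 5 to 9 fix the known part of the start, 10 to 12 make the
    unknown cells a word followed by blanks, and 13 and 14 ask for the output. In the families with
    parameter [b], that bit is the truth value being transported; instances for both values together
    give an equivalence. *)
Definition clits (c : ckind) : seq literal :=
  let: (tag, (k, a, a', d, b, s, rd, tg)) := c in
  match val tag with
  | 0 => [:: (false, false, 1, vH k); (~~ b, false, 1, vC k a);
             (b, false, 0, vR k a)]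
  | 1 => conclusion s rd tg :: (false, false, 0, vS s) ::
           [seq (false, false, 0, vR k' (rd k')) | k' <- enum K]
  | 2 => [:: (false, false, 1, vH k); (~~ b, false, 0, vW k a);
             (b, true, 1, vC k a)]
  | 3 => [:: (true, false, 1, vH k); (~~ b, false, 1, vC k a);
             (b, true, 1, vC k a)]
  | 4 => [:: (false, false, 1, vH k); (false, false, 0, vD k d);
             (b, true, 2, vH k)]
  | 5 => [:: (tm_start M == s, false, 0, vS s)]
  | 6 => [:: (b, false, 1, vH k)]
  | 7 => [:: (None == a, false, 1, vC k a)]
  | 8 => [:: (Some (inl b) == a, false, 1, vC ord0 a)]
  | 9 => [:: (None == a, false, 1, vC ord0 a)]
  | 10 => [:: (true, false, 1, vC ord0 None);
              (true, false, 1, vC ord0 (Some (inl true)));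
              (true, false, 1, vC ord0 (Some (inl false)))]
  | 11 => [:: (false, false, 1, vC ord0 a); (false, false, 1, vC ord0 a')]
  | 12 => [:: (false, false, 1, vC ord0 None); (true, false, 2, vC ord0 None)]
  | 13 => [:: (true, false, 1, vC ord0 (Some (inl true)))]
  | _ => [:: (true, false, 1, vC ord0 None)]
  end.

(** In the code of a pair, [iorg] is the position of the separator, and a witness of admissible
    length ends at [imax] at the latest. The code thus has at most [imax + 1] letters, which gives
    [tmax]; [pmax] also leaves room for every head position reached by then. *)
Definition iorg (x : seq bool) := 2 * size x.
Definition imax (x : seq bool) := iorg x + q.[size x]%R.
Definition tmax (x : seq bool) := p.[(imax x).+1]%R.
Definition pmax (x : seq bool) := tmax x + imax x + 3.

Definition region x i := (iorg x < i) && (i <= imax x).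

Definition cguard (c : ckind) (x : seq bool) (t i j : nat) : bool :=
  let: (tag, (k, a, a', d, b, s, rd, tg)) := c in
  match val tag with
  | 0 | 1 | 2 | 3 => true
  | 4 => (match d with
          | None => (i == j.+1) || ((i == 0) && (j == 0))
          | Some e => j == i + e end) == b
  | 5 => t == 0
  | 6 => (t == 0) && ((i == 0) == b)
  | 7 => (t == 0) && (k != ord0)
  | 8 => (t == 0) && (if b then (j < size x) && ((i == 2 * j) ||
                              ((i == (2 * j).+1) && nth false x j))
                      else ((j < size x) && ((i == (2 * j).+1) && ~~ nth false x j))
                           || (i == iorg x))
  | 9 => (t == 0) && (imax x < i)
  | 10 => (t == 0) && region x i
  | 11 => (t == 0) && (region x i && (a != a'))
  | 12 => (t == 0) && (region x i && (j == i.+1))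
  | 13 => (t == tmax x) && (i == 0)
  | _ => (t == tmax x) && (i == 1)
  end.

Definition psel (s i j : nat) := match s with 0 => 0 | 1 => i | _ => j end.

Definition lit_true (A : nat -> nat -> vkind -> bool) t i j (l : literal) :=
  let: (sg, dt, ps, v) := l in A (t + dt) (psel ps i j) v == sg.

Definition tableau_sat x (A : nat -> nat -> vkind -> bool) :=
  forall c t i j, t <= tmax x -> i < pmax x -> j < pmax x -> cguard c x t i j ->
  has (lit_true A t i j) (clits c).

Section Sound.
Variables (x w : seq bool).
Hypothesis w_small : size w <= q.[size x]%R.
Hypothesis accepts : tm_computes_within M (pair_code x w) (tmax x) [:: true].

Let cf t := iter t (@tm_step M) (tm_init M (pair_code x w)).
Let A t i v := cval (cf t) i v.

Lemma init_tape0 i : cfg_tape (cf 0) ord0 i =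
  if i < size (pair_code x w) then Some (inl (nth false (pair_code x w) i))
  else None.
Proof.
rewrite /= /word_tape; case: ltnP => h; first by rewrite (nth_map false).
by rewrite nth_default ?size_map.
Qed.

Lemma tableau_sound : tableau_sat x A.
Proof.
have cS t : cf t.+1 = tm_step (cf t) by [].
move=> c t i j lt li lj.
case: c => -[tag ht] [[[[[[[k a] a'] d] b] s] rd] tg].
rewrite /cguard /clits /=.
do 15?[case: tag ht => [|tag] ht //=] => {ht}.
- move=> _; rewrite /A /= addn0 ffunE eqbF_neg.
  case: (cfg_head _ _ =P i) => [->|]//=; rewrite orbF.
  by case: b; case: (_ == a).
- move=> _; rewrite has_map /A /= !addn0.
  case hs : (cfg_state _ == s) => /=; last by rewrite orbT.
  case hr : (has _ _); first by rewrite orbT.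
  have er : rd = creads (cf t).
    apply/ffunP => k'; move/negbT: hr; rewrite -all_predC => /allP.
    move=> /(_ k'); rewrite mem_enum => /(_ isT) /=; rewrite addn0 eqbF_neg negbK.
    by move/eqP.
  rewrite orbF; move/eqP: hs => hs.
  case: tg => [s'|[[k' a0]|[k' d']]] /=; rewrite ?addn0 ?addn1 /= -?hs er //.
  by rewrite step_state.
- move=> _; rewrite /A /= !addn0 addn1 cS step_tape eqbF_neg [i == _]eq_sym.
  by case: (_ =P i) => //= e; case: b => //=; rewrite ?orbF; case: (_ == a).
- move=> _; rewrite /A /= !addn0 addn1 cS step_tape eqb_id [i == _]eq_sym.
  by case: (_ =P i) => //= e; case: b => //=; rewrite ?orbF; case: (_ == a).
- move=> g; rewrite /A /= !addn0 addn1 cS step_head !eqbF_neg.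
  case: (_ =P i) => //= e; case: (_ =P d) => //= e2; rewrite e2 e orbF.
  rewrite -(eqP g); case: d {g e2} => [e3|] /=; first by rewrite [j == _]eq_sym.
  by apply/eqP; apply/idP/idP; lia.
- by move=> /eqP ->; rewrite /A /= orbF.
- by move=> /andP[/eqP -> /eqP <-]; rewrite /A /= orbF [0 == i]eq_sym.
- by move=> /andP[/eqP -> h]; rewrite /A /= (negbTE h) orbF.
- move=> /andP[/eqP -> h]; rewrite /A /cval /= -[word_tape _ _ _]/(cfg_tape (cf 0) ord0 i).
  rewrite init_tape0 orbF size_pair_code nth_pair_code.
  case: b h => [/andP[ltj /orP[/eqP e|/andP[/eqP e hx]]]
               |/orP[/andP[ltj /andP[/eqP e hx]]|/eqP e]].
  + have -> : i < 2 * size x by lia.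
    have -> : i < 2 * size x + 1 + size w by lia.
    by rewrite e mul2n odd_double.
  + have -> : i < 2 * size x by lia.
    have -> : i < 2 * size x + 1 + size w by lia.
    by rewrite e mul2n /= odd_double /= uphalf_double hx.
  + have -> : i < 2 * size x by lia.
    have -> : i < 2 * size x + 1 + size w by lia.
    by rewrite e mul2n /= odd_double /= uphalf_double (negbTE hx).
  + by rewrite e /iorg ltnn ifT //; lia.
- move=> /andP[/eqP -> h]; rewrite /A /cval /= -[word_tape _ _ _]/(cfg_tape (cf 0) ord0 i).
  rewrite init_tape0 orbF size_pair_code ifF //; move: h; rewrite /imax /iorg; lia.
- move=> /andP[/eqP -> h]; rewrite /A /cval /= -[word_tape _ _ _]/(cfg_tape (cf 0) ord0 i).
  by rewrite init_tape0; case: ifP => //= _; case: (nth _ _ _).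
- move=> /and3P[/eqP -> h ne]; rewrite /A /cval /= -[word_tape _ _ _]/(cfg_tape (cf 0) ord0 i).
  by rewrite orbF !eqbF_neg; case: (_ =P a) => //= ->.
- move=> /and3P[/eqP -> h /eqP ->]; rewrite /A /cval /=.
  rewrite -[word_tape _ _ i]/(cfg_tape (cf 0) ord0 i).
  rewrite -[word_tape _ _ i.+1]/(cfg_tape (cf 0) ord0 i.+1).
  rewrite !init_tape0; case: (ltnP i) => //= l1.
  by rewrite ifF //; lia.
- move=> /andP[/eqP -> /eqP ->]; rewrite /A /= addn0 orbF.
  by have [_ /(_ 0 isT) ->] := accepts.
- move=> /andP[/eqP -> /eqP ->]; rewrite /A /= addn0 orbF.
  by have [_ /(_ 1 isT) ->] := accepts.
Qed.
End Sound.

Section Complete.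
Variables (x : seq bool) (A : nat -> nat -> vkind -> bool).
Hypothesis sat : tableau_sat x A.

Let n0 := iorg x.
Let blank d := A 0 (n0 + 1 + d) (vC ord0 None).
Let wlen := find blank (iota 0 q.[size x]%R).
Definition witness : seq bool :=
  [seq A 0 (n0 + 1 + d) (vC ord0 (Some (inl true))) | d <- iota 0 wlen].

Let cf t := iter t (@tm_step M) (tm_init M (pair_code x witness)).

Let rd0 : {ffun K -> cel} := [ffun=> None].
Let tg0 : target := inl (tm_start M).

Lemma wlen_le : wlen <= q.[size x]%R.
Proof. by rewrite -[X in _ <= X](size_iota 0); apply: find_size. Qed.

Lemma size_witness : size witness = wlen.
Proof. by rewrite size_map size_iota. Qed.

Lemma at_most i a a' : region x i -> A 0 i (vC ord0 a) -> a != a' ->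
  A 0 i (vC ord0 a') = false.
Proof.
move=> rg h ne; have lt : i < pmax x by move: rg; rewrite /region /pmax; lia.
have := @sat (@mkc 11 isT ord0 a a' None true (tm_start M) rd0 tg0) _ _ _ (leq0n _) lt lt.
by rewrite /= rg ne h /= => /(_ isT); rewrite orbF eqbF_neg => /negbTE.
Qed.

Lemma blank_mono d : d.+1 < q.[size x]%R -> blank d -> blank d.+1.
Proof.
move=> lt h.
have lt1 : n0 + 1 + d < pmax x by rewrite /pmax /imax -/n0; lia.
have lt2 : n0 + 1 + d.+1 < pmax x by rewrite /pmax /imax -/n0; lia.
have := @sat (@mkc 12 isT ord0 None None None true (tm_start M) rd0 tg0) _ _ _
  (leq0n _) lt1 lt2.
have rg : region x (n0 + 1 + d) by rewrite /region /imax -/n0; lia.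
rewrite /= rg addnS eqxx /= => /(_ isT); rewrite orbF eqbF_neg eqb_id.
by rewrite /blank in h *; rewrite addn0 h [_ + d.+1]addnS.
Qed.

Lemma blank_after d : wlen <= d -> d < q.[size x]%R -> blank d.
Proof.
elim: d => [|d IH] h lt.
- move: h; rewrite leqn0 => /eqP e.
  have /(nth_find 0) : has blank (iota 0 q.[size x]%R).
    by rewrite has_find -/wlen e size_iota.
  by rewrite -/wlen e nth_iota.
- move: h; rewrite leq_eqVlt => /orP[/eqP e|h]; last first.
    by apply: blank_mono => //; apply: IH => //; lia.
  have /(nth_find 0) : has blank (iota 0 q.[size x]%R).
    by rewrite has_find -/wlen e size_iota.
  by rewrite -/wlen e nth_iota.
Qed.

Lemma init_cells i a : i < pmax x ->
  A 0 i (vC ord0 a) = (cfg_tape (cf 0) ord0 i == a).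
Proof.
move=> lt; rewrite init_tape0 size_pair_code nth_pair_code size_witness.
have wl := wlen_le.
case: (ltnP i (2 * size x)) => c1.
  rewrite ifT; last by lia.
  set b := if odd i then _ else _.
  have lj : i./2 < pmax x by lia.
  have := @sat (@mkc 8 isT ord0 a None None b (tm_start M) rd0 tg0) _ _ _ (leq0n _) lt lj.
  rewrite /= orbF => /(_ _)/wrap[]; last by move/eqP.
  have e := odd_double_half i; rewrite /b.
  case: (boolP (odd i)) e => od /= e.
    have -> : (i == (2 * i./2).+1) by lia.
    case: (nth _ _ _) => /=; rewrite ?orbT ?andbT; lia.
  by rewrite [i == _](_ : _ = true); lia.
case: (ltngtP (2 * size x) i) => c2; try lia; last first.
  rewrite ifT /=; last by lia.
  have := @sat (@mkc 8 isT ord0 a None None false (tm_start M) rd0 tg0) _ _ _ (leq0n _) lt lt.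
  by rewrite /= orbF /iorg -c2 eqxx orbT => /(_ isT)/eqP.
case: (leqP i (imax x)) => c3; last first.
  have := @sat (@mkc 9 isT ord0 a None None false (tm_start M) rd0 tg0) _ _ _ (leq0n _) lt lt.
  rewrite /= orbF c3 => /(_ isT)/eqP ->; rewrite ifF //.
  by move: c3; rewrite /imax /iorg; lia.
have rg : region x i by rewrite /region c3 andbT /iorg.
pose d := i - (2 * size x).+1.
have ed : i = n0 + 1 + d by rewrite /d /n0 /iorg; lia.
have ld : d < q.[size x]%R by move: c3; rewrite /imax ed -/n0; lia.
have H := at_most rg.
case: (ltnP d wlen) => c4.
  have nb : blank d = false.
    by have := before_find 0 c4; rewrite nth_iota // ?add0n.
  rewrite ifT /=; last by rewrite ed /n0 /iorg; lia.
  rewrite -/d (nth_map 0) ?size_iota // nth_iota // add0n -ed.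
  have := @sat (@mkc 10 isT ord0 a None None false (tm_start M) rd0 tg0) _ _ _ (leq0n _) lt lt.
  rewrite /= rg => /(_ isT); rewrite !eqb_id orbF {1}ed -/(blank d) nb /=.
  case h1 : (A 0 i (vC ord0 (Some (inl true)))) => /= h2.
    by case: eqP => [<-|/eqP ne] //; apply: H h1 ne.
  by case: eqP => [<-|/eqP ne] //; apply: H h2 ne.
have hb := blank_after c4 ld; rewrite /blank -ed in hb.
rewrite ifF; last by rewrite ed /n0 /iorg; lia.
by case: eqP => [<-|/eqP ne] //; apply: H hb ne.
Qed.

Record exact t : Prop := Exact {
  ex_S : forall s, A t 0 (vS s) = (cfg_state (cf t) == s);
  ex_H : forall k i, i < pmax x -> A t i (vH k) = (cfg_head (cf t) k == i);
  ex_C : forall k i a, i < pmax x -> A t i (vC k a) = (cfg_tape (cf t) k i == a) }.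

Lemma exact0 : exact 0.
Proof.
have p0 : 0 < pmax x by rewrite /pmax addnS.
split=> [s|k i lt|k i a lt].
- have := @sat (@mkc 5 isT ord0 None None None true s rd0 tg0) _ _ _ (leq0n _) p0 p0.
  by rewrite /= orbF => /(_ isT)/eqP.
- have := @sat (@mkc 6 isT k None None None (i == 0) (tm_start M) rd0 tg0) _ _ _
    (leq0n _) lt p0.
  by rewrite /= orbF eqxx => /(_ isT)/eqP ->; rewrite eq_sym.
- case: (eqVneq k ord0) => [->|ne]; first exact: init_cells.
  have := @sat (@mkc 7 isT k a None None true (tm_start M) rd0 tg0) _ _ _ (leq0n _) lt p0.
  by rewrite /= orbF ne => /(_ isT)/eqP ->; rewrite (negbTE ne).
Qed.

Lemma head_le t k : cfg_head (cf t) k <= t.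
Proof.
elim: t => //= t IH; rewrite step_head -/(cf t).
by case: (dcode _) => [b|] /=; case: (cfg_head _ _) IH => //=; lia.
Qed.

(** Each family is instantiated with the truth values of the actual configuration. Given exactness
    at time [t], all literals but one are then false, and the remaining one fixes a variable. *)
Lemma exactS t : t <= tmax x -> exact t -> exact t.+1.
Proof.
move=> le [eS eH eC].
have p0 : 0 < pmax x by rewrite /pmax addnS.
have hlt k : cfg_head (cf t) k < pmax x.
  by have := head_le t k; rewrite /pmax; lia.
have eR k a : A t 0 (vR k a) = (creads (cf t) k == a).
  have := @sat (@mkc 0 isT k a None None (cfg_tape (cf t) k (cfg_head (cf t) k) == a)
     (tm_start M) rd0 tg0) _ _ _ le (hlt k) p0.
  rewrite /= addn0 orbF eH // eC // eqxx ffunE /= => /(_ isT).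
  by case: (_ == a) => /=; rewrite ?eqb_id ?eqbF_neg; [move=> ->|move/negbTE].
have eT tg : lit_true A t 0 0 (conclusion (cfg_state (cf t)) (creads (cf t)) tg).
  have := @sat (@mkc 1 isT ord0 None None None true (cfg_state (cf t)) (creads (cf t)) tg) _ _ _
    le p0 p0.
  rewrite /= addn0 eS eqxx /= => /(_ isT)/orP[//|].
  rewrite has_map => /hasP[k _] /=.
  by rewrite addn0 eR eqxx.
have eW k a : A t 0 (vW k a) = (((cout (cf t)).2 k).1 == a).
  by have := eT (inr (inl (k, a))); rewrite /= addn0 => /eqP.
have eD k d : A t 0 (vD k d) = (dcode ((cout (cf t)).2 k).2 == d).
  by have := eT (inr (inr (k, d))); rewrite /= addn0 => /eqP.
have cS : cf t.+1 = tm_step (cf t) by [].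
split=> [s|k i lt|k i a lt].
- have := eT (inl s); rewrite /= addn1 => /eqP ->.
  by rewrite /= step_state.
- rewrite cS step_head.
  set d := dcode _; set h := cfg_head _ k.
  have := @sat (@mkc 4 isT k None None d (dmove d h == i) (tm_start M) rd0 tg0) _ _ _
    le (hlt k) lt.
  rewrite /= addn0 addn1 eH // eqxx eD eqxx /= orbF => /(_ _)/wrap[]; last by move/eqP.
  rewrite -/h; case: d => [b|] /=; first by rewrite [i == _]eq_sym.
  by apply/eqP; apply/idP/idP; lia.
- rewrite cS step_tape; case: (i =P _) => [e|/eqP ne].
    have := @sat (@mkc 2 isT k a None None (((cout (cf t)).2 k).1 == a)
      (tm_start M) rd0 tg0) _ _ _ le lt p0.
    rewrite /= addn0 addn1 eH // e eqxx eW /= orbF => /(_ isT).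
    by case: (_ == a) => /=; rewrite ?eqb_id ?eqbF_neg; [move=> ->|move/negbTE].
  have := @sat (@mkc 3 isT k a None None (cfg_tape (cf t) k i == a)
      (tm_start M) rd0 tg0) _ _ _ le lt p0.
  rewrite /= addn0 addn1 eH // [_ == i]eq_sym (negbTE ne) eC //= orbF => /(_ isT).
  by case: (_ == a) => /=; rewrite ?eqb_id ?eqbF_neg; [move=> ->|move/negbTE].
Qed.

Lemma exact_all t : t <= tmax x -> exact t.
Proof.
elim: t => [|t IH] le; first exact: exact0.
by apply: exactS; [|apply: IH]; apply: ltnW.
Qed.

Lemma tableau_final : cfg_tape (cf (tmax x)) ord0 0 = Some (inl true) /\
  cfg_tape (cf (tmax x)) ord0 1 = None.
Proof.
have p0 : 0 < pmax x by rewrite /pmax addnS.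
have p1 : 1 < pmax x by rewrite /pmax !addnS.
have [_ _ eC] := exact_all (leqnn (tmax x)).
have := @sat (@mkc 13 isT ord0 None None None true (tm_start M) rd0 tg0) _ _ _
   (leqnn _) p0 p0.
have := @sat (@mkc 14 isT ord0 None None None true (tm_start M) rd0 tg0) _ _ _
   (leqnn _) p1 p0.
rewrite /= !eqxx !addn0 !orbF !eqb_id !eC // => /(_ isT)/eqP h1 /(_ isT)/eqP h2.
by split.
Qed.
End Complete.

Lemma tm_stay (c : tm_config M) d : tm_halt (cfg_state c) ->
  iter d (@tm_step M) c = c.
Proof. by move=> h; elim: d => //= d ->; rewrite /tm_step h. Qed.

Lemma computes_mono y t t' z : t <= t' -> tm_computes_within M y t z ->
  tm_computes_within M y t' z.
Proof.
move=> le [h1 h2]; rewrite /tm_computes_within -(subnK le) iterD.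
by rewrite tm_stay.
Qed.

Lemma tableauP (V : seq bool -> seq bool) x :
  (forall z, tm_computes_within M z p.[size z]%R (V z)) ->
  (exists w, size w <= q.[size x]%R /\ V (pair_code x w) = [:: true]) <->
  exists A, tableau_sat x A.
Proof.
move=> HV.
have bnd w : size w <= q.[size x]%R -> tm_computes_within M (pair_code x w)
    (tmax x) (V (pair_code x w)).
  move=> sw; apply: computes_mono (HV _); apply: horner_nat_mono.
  by rewrite size_pair_code /imax /iorg; lia.
split=> [[w [sw e]]|[A sat]].
  by eexists; apply: (@tableau_sound x w) => //; rewrite -e; apply: bnd.
exists (witness x A); split; first by rewrite size_witness; apply: wlen_le.
have [h0 h1] := tableau_final sat.
have [|_ ho] := bnd (witness x A); first by rewrite size_witness; apply: wlen_le.
case: (V _) ho => [|b [|b' y]] ho.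
- by have := ho 0 isT; rewrite h0.
- by have := ho 0 isT; rewrite h0 => -[<-].
- by have := ho 1 isT; rewrite h1.
Qed.
End Tableau.

Section Closure2.
Variables (A : Type) (W : A -> seq bool) (V : seq (A -> nat)).

Lemma ff_eqb P Q : ffm W V P -> ffm W V Q -> ffm W V (fun a => P a == Q a).
Proof.
move=> hP hQ; apply: ff_ext (ff_if hP hQ (ff_not hQ)) => a.
by case: (P a); case: (Q a).
Qed.
End Closure2.

Ltac ftw h := first [exact: h | exact: (ft_weak h) | exact: (ft_weak (ft_weak h))
  | exact: (ft_weak (ft_weak (ft_weak h)))
  | exact: (ft_weak (ft_weak (ft_weak (ft_weak h))))
  | exact: (ft_weak (ft_weak (ft_weak (ft_weak (ft_weak h)))))
  | exact: (ft_weak (ft_weak (ft_weak (ft_weak (ft_weak (ft_weak h)))))) ].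

Ltac ft_one := first [assumption | exact: ft_const | apply: ft_add | apply: ft_mul
  | apply: ft_succ | apply: ft_horner | exact: ft_len].
Ltac ff_one := first [exact: ff_const | apply: ff_and | apply: ff_or | apply: ff_not
  | apply: ff_imp | apply: ff_lt | apply: ff_le | apply: ff_eq | apply: ff_eqb
  | apply: ff_bit | apply: ff_if].
Ltac fo := repeat first [ft_one | ff_one].

(** * The tableau as a numbered CNF *)

Section CNF.
Variables (M : turing_machine) (p q : {poly nat}).
Local Notation vkind := (vkind M).
Local Notation ckind := (ckind M).
Local Notation pmax := (pmax p q).
Local Notation tmax := (tmax p q).

Definition NK := #|vkind|.
Definition NC := #|ckind|.

(** Numbering starts at 1: variable 0 is kept as a constant that may be set to true, so that its
    positive literal, numbered 1, fills the clauses whose guard fails. *)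
Definition vcode x t i (v : vkind) := 1 + ((t * pmax x + i) * NK + enum_rank v).

Definition lit_core x (u r t i j : nat) :=
  has (fun c : ckind => (r == enum_rank c :> nat) &&
    (if cguard p q c x t i j then
       has (fun l : literal M => let: (sg, dt, ps, v) := l in
         u == 2 * vcode x (t + dt) (psel ps i j) v + sg) (clits c)
     else u == 1)) (enum ckind).

(** A clause number is a mixed-radix numeral for scheme, two positions and time. The positivity
    tests are those with which [ff_divmod] expresses quotient and remainder. *)
Definition clause_lit x c u :=
  (0 < NC) && ((0 < pmax x) && ((0 < pmax x) &&
    lit_core x u (c %% NC) (c %/ NC %/ pmax x %/ pmax x)
      (c %/ NC %/ pmax x %% pmax x) (c %/ NC %% pmax x))).

Definition nclauses x := (tmax x).+1 * pmax x * pmax x * NC.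
Definition nlits x := 2 * (1 + (tmax x + 2) * pmax x * NK).

Definition lit_val (B : nat -> bool) u := B u./2 == odd u.

Lemma NC_gt0 : 0 < NC.
Proof.
rewrite /NC; apply/card_gt0P.
by exists (@mkc M 0 isT ord0 None None None true (tm_start M) [ffun=> None] (inl (tm_start M))).
Qed.

Lemma pmax_gt0 x : 0 < pmax x. Proof. by rewrite /pmax addnS. Qed.

Lemma nlits_gt0 x : 0 < nlits x. Proof. by []. Qed.

Lemma nclauses_gt0 x : 0 < nclauses x.
Proof. by rewrite /nclauses !muln_gt0 pmax_gt0 NC_gt0. Qed.

Lemma half_bit n (b : bool) : (2 * n + b)./2 = n.
Proof. by rewrite mul2n addnC half_bit_double. Qed.
Lemma odd_bit n (b : bool) : odd (2 * n + b) = b.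
Proof. by rewrite oddD mul2n odd_double; case: b. Qed.

Lemma code_divmod n a b : b < n -> ((a * n + b) %/ n = a) * ((a * n + b) %% n = b).
Proof.
move=> lt; have n0 : 0 < n by lia.
by rewrite divnMDl // divn_small // addn0 modnMDl modn_small.
Qed.

Lemma psel_lt x ps i j : i < pmax x -> j < pmax x -> psel ps i j < pmax x.
Proof. by move=> li lj; case: ps => [|[]] //=; apply: pmax_gt0. Qed.

Lemma cnf_tableau x : (exists A : _ -> _ -> vkind -> bool, tableau_sat p q x A) <->
  exists B, forall c, c < nclauses x ->
    has (fun u => clause_lit x c u && lit_val B u) (iota 0 (nlits x)).
Proof.
have P0 := pmax_gt0 x; have C0 := NC_gt0.
split=> [[A sat]|[B sat]].
  pose v0 := vS (tm_start M).
  exists (fun k => if k is k'.+1 then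
    A (k' %/ NK %/ pmax x) (k' %/ NK %% pmax x) (nth v0 (enum vkind) (k' %% NK))
    else true) => c lc.
  set r := c %% NC; set j := c %/ NC %% pmax x.
  set i := c %/ NC %/ pmax x %% pmax x; set t := c %/ NC %/ pmax x %/ pmax x.
  have lt : t <= tmax x.
    by rewrite -ltnS /t !ltn_divLR.
  have li : i < pmax x by rewrite ltn_mod.
  have lj : j < pmax x by rewrite ltn_mod.
  have lr : r < #|ckind| by rewrite ltn_mod.
  pose ck := enum_val (Ordinal lr).
  have er : r = enum_rank ck by rewrite enum_valK.
  have Q u : u < nlits x -> (if cguard p q ck x t i j then
       has (fun l : literal M => let: (sg, dt, ps, v) := l in
         u == 2 * vcode x (t + dt) (psel ps i j) v + sg) (clits ck)
     else u == 1) -> lit_val (fun k => if k is k'.+1 then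
    A (k' %/ NK %/ pmax x) (k' %/ NK %% pmax x) (nth v0 (enum vkind) (k' %% NK))
    else true) u ->
    has (fun u => clause_lit x c u && lit_val (fun k => if k is k'.+1 then
    A (k' %/ NK %/ pmax x) (k' %/ NK %% pmax x) (nth v0 (enum vkind) (k' %% NK))
    else true) u) (iota 0 (nlits x)).
    move=> lu h1 h2; apply/hasP; exists u; first by rewrite mem_iota add0n.
    rewrite h2 andbT /clause_lit C0 P0 /=; apply/hasP; exists ck.
      by rewrite mem_enum.
    by rewrite -/r -/t -/i -/j -er eqxx.
  case g : (cguard p q ck x t i j); last first.
    by apply: (Q 1); [rewrite /nlits; lia|rewrite g|].
  have /hasP[[[[sg dt] ps] v] hl /=] := @sat ck t i j lt li lj g.
  move=> /eqP hA; apply: (Q (2 * vcode x (t + dt) (psel ps i j) v + sg)).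
  - have := ltn_ord (enum_rank v); rewrite -/NK; have := psel_lt ps li lj.
    rewrite /nlits /vcode; move: (psel _ _ _) (nat_of_ord (enum_rank v)) => a b la lb.
    have h3 : (t + dt) * pmax x + a < (tmax x + 2) * pmax x.
      have : (t + dt).+1 * pmax x <= (tmax x + 2) * pmax x.
        by rewrite leq_mul2r; case: dt {hA hl}; lia.
      by rewrite mulSn; lia.
    have : ((t + dt) * pmax x + a).+1 * NK <= (tmax x + 2) * pmax x * NK.
      by rewrite leq_mul2r h3 orbT.
    by rewrite mulSn; case: sg {hA hl}; lia.
  - rewrite g; apply/hasP; exists (sg, dt, ps, v) => //.
  - rewrite /lit_val half_bit odd_bit /vcode add1n.
    have lv : enum_rank v < NK by apply: ltn_ord.
    rewrite !(code_divmod _ lv) !(code_divmod _ (psel_lt ps li lj)).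
    by rewrite nth_enum_rank hA.
exists (fun t i v => B (vcode x t i v)) => ck t i j lt li lj g.
pose c := ((t * pmax x + i) * pmax x + j) * NC + enum_rank ck.
have lk : enum_rank ck < NC by apply: ltn_ord.
have lc : c < nclauses x.
  rewrite /nclauses /c.
  have h1 : t * pmax x + i < (tmax x).+1 * pmax x.
    have : t.+1 * pmax x <= (tmax x).+1 * pmax x by rewrite leq_mul2r; lia.
    by rewrite mulSn; lia.
  have h2 : (t * pmax x + i) * pmax x + j < (tmax x).+1 * pmax x * pmax x.
    have : (t * pmax x + i).+1 * pmax x <= (tmax x).+1 * pmax x * pmax x.
      by rewrite leq_mul2r h1 orbT.
    by rewrite mulSn; lia.
  have : ((t * pmax x + i) * pmax x + j).+1 * NC <=
     (tmax x).+1 * pmax x * pmax x * NC by rewrite leq_mul2r h2 orbT.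
  by rewrite mulSn; lia.
have /hasP[u _ /andP[]] := sat c lc.
rewrite /clause_lit !(code_divmod _ lk) !(code_divmod _ lj) !(code_divmod _ li).
rewrite C0 P0 /= => /hasP[ck' _ /andP[/eqP/val_inj/enum_rank_inj <-]].
rewrite g => /hasP[[[[sg dt] ps] v] hl /eqP ->]; rewrite /lit_val half_bit odd_bit.
by move=> h; apply/hasP; exists (sg, dt, ps, v).
Qed.

Section Definable.
Variables (A : Type) (W : A -> seq bool) (V : seq (A -> nat)).

Lemma ft_imax : ftm W V (fun a => imax q (W a)).
Proof. by rewrite /imax /iorg; fo. Qed.
Lemma ft_tmax : ftm W V (fun a => tmax (W a)).
Proof. by rewrite /tmax; apply: ft_horner; apply: ft_succ ft_imax. Qed.
Lemma ft_pmax : ftm W V (fun a => pmax (W a)).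
Proof.
by apply: ft_add; [apply: ft_add; [apply: ft_tmax|apply: ft_imax]|fo].
Qed.

Lemma ft_nclauses : ftm W V (fun a => nclauses (W a)).
Proof. by have h1 := ft_pmax; have h2 := ft_tmax; rewrite /nclauses; fo. Qed.
Lemma ft_nlits : ftm W V (fun a => nlits (W a)).
Proof. by have h1 := ft_pmax; have h2 := ft_tmax; rewrite /nlits; fo. Qed.

Lemma ff_cguard (ck : ckind) t i j : ftm W V t -> ftm W V i -> ftm W V j ->
  ffm W V (fun a => cguard p q ck (W a) (t a) (i a) (j a)).
Proof.
move=> ht hi hj; have h1 := ft_imax; have h2 := ft_tmax.
case: ck => -[tag htag] [[[[[[[k a] a'] d] b] s] rd] tg].
rewrite /cguard /= /region /iorg.
do 15?[case: tag htag => [|tag] htag //=]; try by fo.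
by case: d => [e|]; fo.
Qed.

Lemma ff_lit_core u r t i j : ftm W V u -> ftm W V r -> ftm W V t -> ftm W V i ->
  ftm W V j -> ffm W V (fun a => lit_core (W a) (u a) (r a) (t a) (i a) (j a)).
Proof.
move=> hu hr ht hi hj; have hp := ft_pmax.
apply: ff_hasl => ck; apply: ff_and; first by fo.
apply: ff_if; [exact: ff_cguard| |by fo].
apply: ff_hasl => -[[[sg dt] ps] v]; rewrite /vcode.
by case: ps => [|[|ps]] /=; fo.
Qed.
End Definable.

Lemma ff_clause_lit A (W : A -> seq bool) V c u : ftm W V c -> ftm W V u ->
  ffm W V (fun a => clause_lit (W a) (c a) (u a)).
Proof.
move=> hc hu.
apply: (@ff_divmod _ _ _ c (fun=> NC) (fun a c1 r => (0 < pmax (W a)) &&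
  ((0 < pmax (W a)) && lit_core (W a) (u a) r (c1 %/ pmax (W a) %/ pmax (W a))
      (c1 %/ pmax (W a) %% pmax (W a)) (c1 %% pmax (W a))))) => //.
  exact: ft_const.
apply: (@ff_divmod _ _ _ (fun x => x.1.2) (fun x => pmax (W x.1.1))
  (fun x c2 j => (0 < pmax (W x.1.1)) && lit_core (W x.1.1) (u x.1.1) x.2
     (c2 %/ pmax (W x.1.1)) (c2 %% pmax (W x.1.1)) j)).
- exact: (ft_weak (ft_top _ _)).
- exact: (ft_pmax (wlift (wlift W))).
apply: (@ff_divmod _ _ _ (fun x => x.1.2) (fun x => pmax (W x.1.1.1.1))
  (fun x t i => lit_core (W x.1.1.1.1) (u x.1.1.1.1) x.1.1.2 t i x.2)).
- exact: (ft_weak (ft_top _ _)).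
- exact: (ft_pmax (wlift (wlift (wlift (wlift W))))).
apply: (@ff_lit_core _ (wlift (wlift (wlift (wlift (wlift (wlift W)))))) _
  (fun x => u x.1.1.1.1.1.1) (fun x => x.1.1.1.1.2) (fun x => x.1.2) snd
  (fun x => x.1.1.2)).
- ftw hu.
- exact: (ft_weak (ft_weak (ft_weak (ft_weak (ft_top _ _))))).
- exact: (ft_weak (ft_top _ _)).
- exact: ft_top.
- exact: (ft_weak (ft_weak (ft_top _ _))).
Qed.

End CNF.

(** * Circulations modulo r *)

Local Open Scope ring_scope.

(** The first vertex of a longest simple path has a second neighbour, which lies on the path by
    maximality and closes a cycle of length at least 3. *)
Lemma uniq_cycle_exists (T : finType) (e : rel T) (x0 y0 : T) :
  symmetric e -> irreflexive e -> e x0 y0 ->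
  (forall x y, e x y -> exists2 z, z != y & e x z) ->
  exists x y z s, uniq (x :: y :: z :: s) /\ cycle e (x :: y :: z :: s).
Proof.
move=> sym irr e0 deg.
pose P n := [exists t : n.-tuple T, uniq t && sorted e t].
have P2 : P 2%N.
  apply/existsP; exists [tuple x0; y0]; rewrite /= inE andbT andbT e0 andbT.
  by apply/eqP => E; rewrite E irr in e0.
have Pmax n : P n -> (n <= #|T|)%N.
  by case/existsP => t /andP[u _]; rewrite -(size_tuple t) -(card_uniqP u) max_card.
case: (ex_maxnP (ex_intro (fun n => is_true (P n)) _ P2) Pmax) => n /existsP[t /andP[ut st]] max.
have n2 : (2 <= n)%N by apply: max.
case: t ut st => -[|x [|y s]] /= szt; rewrite -1?(eqP szt) in n2 => //.
move=> ut st; have [z zy xz] : exists2 z, z != y & e x z.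
  by case/andP: st => exy _; apply: deg exy.
have zin : z \in x :: y :: s.
  case: (boolP (z \in x :: y :: s)) => // zn; suff /max : P n.+1 by rewrite ltnn.
  apply/existsP; have szt' : size (z :: x :: y :: s) == n.+1 by rewrite /= eqSS.
  by exists (Tuple szt') => /=; rewrite zn sym xz ut.
have zs : z \in s.
  move: zin; rewrite !inE (negbTE zy) /=; case: eqP => // E.
  by rewrite E irr in xz.
case/splitPr: zs ut st => s1 s2 ut st.
have [w [s' E]] : exists w s', rcons s1 z = w :: s' by case: (s1) => [|w s']; eexists _, _.
have U : uniq (x :: y :: rcons s1 z).
  have : uniq ((x :: y :: rcons s1 z) ++ s2) by rewrite /= cat_rcons.
  by rewrite cat_uniq => /andP[].
have C : cycle e (x :: y :: rcons s1 z).
  rewrite /= rcons_path last_rcons (sym z x) xz andbT.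
  by move: st; rewrite -cat_rcons cat_path => /andP[-> /andP[-> _]].
by rewrite E in U C; exists x, y, w, s'.
Qed.

Section Rounding.
Variables (R : realType) (G : graph).
Local Notation V := 'I_(nverts G).
Implicit Types f : V -> V -> R.

Definition vsum f x := \sum_(y | adj x y) f x y.
Definition nonint f : rel V := fun x y => adj x y && (f x y \isn't a Num.int).

Section Push.
Variables (f : V -> V -> R) (c lo : int) (a b : V).
Hypothesis fc : forall x y, adj x y -> f x y + f y x = c%:~R.
Hypothesis fs : forall x, vsum f x \is a Num.int.
Hypothesis flo : forall x y, adj x y -> lo%:~R <= f x y.

Lemma nonint_sym : symmetric (nonint f).
Proof.
have H x y : nonint f x y -> nonint f y x.
  rewrite /nonint adj_sym => /andP[h ni]; rewrite h /=; apply: contra ni => i.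
  have -> : f x y = c%:~R - f y x by rewrite -(fc h); ring.
  by apply: rpredB => //; apply: intr_int.
by move=> x y; apply/idP/idP; apply: H.
Qed.

Lemma nonint_deg x y : nonint f x y -> exists2 z, z != y & nonint f x z.
Proof.
move=> /andP[h ni]; apply/exists_inP; apply: contraR ni.
rewrite negb_exists_in => /forall_inP H.
have -> : f x y = vsum f x - \sum_(z | adj x z && (z != y)) f x z.
  by rewrite /vsum (bigD1 y) //=; ring.
apply: rpredB => //; apply: rpred_sum => z /andP[xz zy].
by have := H _ zy; rewrite /nonint xz /= negbK.
Qed.

(** Integral vertex sums prevent a vertex from meeting exactly one non-integral edge, so these edges
    contain a cycle. Flow is shifted around it, in the direction that does not lower the arc
    [(a, b)], until some arc becomes integral. *)
Lemma push x0 y0 : nonint f x0 y0 ->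
  exists f', [/\ forall x y, adj x y -> f' x y + f' y x = c%:~R,
    forall x, vsum f' x = vsum f x,
    forall x y, adj x y -> lo%:~R <= f' x y, f a b <= f' a b &
    (#|[pred p | nonint f' p.1 p.2]| < #|[pred p | nonint f p.1 p.2]|)%N].
Proof.
move=> n0.
have irr : irreflexive (nonint f) by move=> x; rewrite /nonint adj_irr.
have [x [y [z [s [uc cc]]]]] := uniq_cycle_exists nonint_sym irr n0 nonint_deg.
set cy := x :: y :: z :: s in uc cc.
pose nx u v : bool := (u \in cy) && (next cy u == v).
pose sg u v : R := (nx u v)%:R - (nx v u)%:R.
have nxe u v : nx u v -> nonint f u v.
  by case/andP => hu /eqP <-; apply: next_cycle cc hu.
have sgN u v : sg v u = - sg u v by rewrite /sg opprB.
have nxx : nx x y by rewrite /nx /cy mem_head /= eqxx eqxx.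
have nyx : nx y x = false.
  move: uc; rewrite /= !inE !negb_or => /andP[/and3P[xy xz _] _].
  have yx : (y == x) = false by rewrite eq_sym (negbTE xy).
  have zx : (z == x) = false by rewrite eq_sym (negbTE xz).
  by rewrite /nx /cy /= yx eqxx zx andbF.
have sgsum u : \sum_(v | adj u v) sg u v = 0.
  have E1 : \sum_(v | adj u v) (nx u v)%:R = (u \in cy)%:R :> R.
    case hu : (u \in cy); last first.
      by rewrite big1 // => v _; rewrite /nx hu.
    rewrite (bigD1 (next cy u)); last first.
      by have /andP[] : nonint f u (next cy u) by apply: nxe; rewrite /nx hu eqxx.
    rewrite {1}/nx hu eqxx big1 => [|v /andP[_ ne]]; first by rewrite /= addr0.
    by rewrite /nx eq_sym (negbTE ne) andbF.
  have E2 : \sum_(v | adj u v) (nx v u)%:R = (u \in cy)%:R :> R.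
    case hu : (u \in cy); last first.
      rewrite big1 // => v _; rewrite /nx; case hv : (v \in cy); rewrite ?andTb //.
      by case: eqP => // E; have := mem_next cy v; rewrite E hu hv.
    have np : nx (prev cy u) u by rewrite /nx mem_prev hu next_prev // eqxx.
    rewrite (bigD1 (prev cy u)); last first.
      by rewrite adj_sym; have /andP[] := nxe _ _ np.
    rewrite {1}np big1 => [|v /andP[_ ne]]; first by rewrite /= addr0.
    rewrite /nx; case hv : (v \in cy); rewrite ?andTb //; case: eqP => // E.
    by move: ne; rewrite -E prev_next ?eqxx.
  by rewrite sumrB E1 E2 subrr.
have [t ts tab] : exists2 t : R, t ^+ 2 = 1 & 0 <= t * sg a b.
  case: (lerP 0 (sg a b)) => h; first by exists 1; rewrite ?expr1n ?mul1r.
  by exists (-1); rewrite ?sqrrN ?expr1n // mulN1r oppr_ge0 ltW.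
pose ta u v := t * sg u v.
have t1 : (t == 1) || (t == -1) by rewrite -sqrf_eq1 ts.
have ta3 u v : [|| ta u v == -1, ta u v == 0 | ta u v == 1].
  rewrite /ta /sg; case/orP: t1 => /eqP ->;
  by case: (nx u v); case: (nx v u);
    rewrite ?subrr ?subr0 ?sub0r ?mulr0 ?mulr1 ?mulrN1 ?mul1r ?opprK ?eqxx ?orbT.
have tae u v : ta u v != 0 -> nonint f u v.
  rewrite /ta /sg; case h1 : (nx u v); first by move=> _; apply: nxe.
  case h2 : (nx v u); first by move=> _; rewrite nonint_sym; apply: nxe.
  by rewrite subrr mulr0 eqxx.
have taN u v : ta v u = - ta u v by rewrite /ta sgN mulrN.
have [p0 P0] : exists p : V * V, ta p.1 p.2 == -1.
  have h : ta x y = t by rewrite /ta /sg nxx nyx subr0 mulr1.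
  case/orP: t1 => /eqP E; last by exists (x, y) => /=; rewrite h E.
  by exists (y, x); rewrite /= taN h E.
(* The shift is the least fractional part among the arcs that lose flow. Losing arcs stay above
   their floor, hence above the integer [lo], and the minimal one becomes integral. *)
pose gap (p : V * V) : R := f p.1 p.2 - (Num.floor (f p.1 p.2))%:~R.
case: (@arg_minP _ _ _ p0 (fun p => ta p.1 p.2 == -1) gap P0) => -[u0 v0] /= m0 minp.
set ep := gap (u0, v0) in minp.
have ep0 : 0 <= ep by rewrite /ep /gap subr_ge0 floor_le.
pose f' u v := f u v + ep * ta u v.
have fl u v : ta u v == -1 -> (Num.floor (f u v))%:~R <= f' u v.
  move=> h; have := minp (u, v) h; rewrite /f' (eqP h) /gap /=; lra.
have f'lo u v : adj u v -> lo%:~R <= f' u v.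
  move=> h; case/or3P: (ta3 u v) => h3.
  - by apply: le_trans (fl _ _ h3); rewrite ler_int floor_ge_int flo.
  - by rewrite /f' (eqP h3) mulr0 addr0 flo.
  - by rewrite /f' (eqP h3) mulr1; apply: le_trans (flo h) _; rewrite lerDl.
exists f'; split=> //.
- by move=> u v h; rewrite /f' taN -(fc h); ring.
- move=> u; rewrite /vsum /f' big_split /= -mulr_sumr -mulr_sumr sgsum.
  by rewrite !mulr0 addr0.
- by rewrite /f' lerDl mulr_ge0.
- apply: proper_card; apply/properP; split.
    apply/fintype.subsetP => -[u v]; rewrite !inE /= {1}/nonint => /andP[h ni].
    case: (eqVneq (ta u v) 0) => [E|]; last exact: tae.
    by move: ni; rewrite /f' E mulr0 addr0 /nonint h.
  exists (u0, v0); rewrite !inE /=; first by apply: tae; rewrite (eqP m0) oppr_eq0 oner_eq0.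
  rewrite /nonint negb_and negbK; apply/orP; right.
  rewrite /f' (eqP m0) mulrN1 /ep /gap /= opprB addrC subrK.
  exact: intr_int.
Qed.
End Push.

(** Integrality of circulations, by cycle cancelling on the number of non-integral arcs. Only a
    lower bound is carried along: on the reverse arc it is an upper bound [c - lo]. The last
    conclusion, for one chosen arc, is what later restores strict inequalities. *)
Lemma rounding f (c lo : int) a b :
  (forall x y, adj x y -> f x y + f y x = c%:~R) ->
  (forall x, vsum f x \is a Num.int) ->
  (forall x y, adj x y -> lo%:~R <= f x y) -> adj a b ->
  exists g : V -> V -> int, [/\ forall x y, adj x y -> g x y + g y x = c,
    forall x, (\sum_(y | adj x y) g x y)%:~R = vsum f x,
    forall x y, adj x y -> lo <= g x y & f a b <= (g a b)%:~R].
Proof.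
move=> h1 h2 h3 ab.
have [n] := ubnP #|[pred p | nonint f p.1 p.2]|.
elim: n f h1 h2 h3 => // n IH f h1 h2 h3 lt.
case: (pickP [pred p | nonint f p.1 p.2]) => [[x0 y0] /= n0|all_int].
  have [f' [e1 e2 e3 e4 e5]] := push a b h1 h2 h3 n0.
  have [||||g [g1 g2 g3 g4]] := IH f'; try done.
  - by move=> x; rewrite e2.
  - by apply: leq_trans e5 _.
  - by exists g; split=> // [x|]; [rewrite g2 e2|apply: le_trans g4].
have fi x y : adj x y -> (Num.floor (f x y))%:~R = f x y.
  move=> h; apply/eqP; rewrite -intrEfloor.
  by have := all_int (x, y); rewrite /= /nonint h /= => /negbFE.
exists (fun x y => Num.floor (f x y)); split.
- by move=> x y h; apply: (@intr_inj R); rewrite intrD !fi ?h1 // adj_sym.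
- by move=> x; rewrite rmorph_sum; apply: eq_bigr => y h; rewrite /= fi.
- by move=> x y h; rewrite floor_ge_int h3.
- by rewrite fi.
Qed.
End Rounding.

(** * The flow number in terms of flows modulo r *)

Section FlowNumber.
Variables (R : realType) (G : graph).
Local Notation V := 'I_(nverts G).
Implicit Types f : V -> V -> R.

Definition modflow (r : R) f :=
  [/\ forall x y, adj x y -> f x y + f y x = r,
      forall x y, adj x y -> 1 < f x y &
      forall x, exists k : nat, vsum f x = r * k%:R].

(** An arc against the orientation receives [r] minus the flow, so the sum at a vertex is [r] times
    its in-degree. Scaling by [r' / r > 1] turns the closed lower bound into a strict one. *)
Lemma circular_modflow (r r' : R) : circular_flow G r -> r < r' -> 0 < r' ->
  exists f, modflow r' f.
Proof.
move=> [D [f [[Da Do] fl bd]]] lt r'0.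
pose F x y := if D x y then f x y else r - f y x.
have Dx x y : adj x y -> D x y = ~~ D y x by move=> /Do; case: (D x y); case: (D y x).
have F2 x y : adj x y -> F x y + F y x = r.
  by move=> h; rewrite /F (Dx _ _ h); case: (D y x) => /=; ring.
have F1 x y : adj x y -> 1 <= F x y.
  move=> h; rewrite /F; case h1 : (D x y); first by have /andP[] := bd _ _ h1.
  have h2 : D y x by move: (Dx _ _ h); rewrite h1 => /esym/negbFE.
  by have /andP[_] := bd _ _ h2; lra.
have FS x : exists k : nat, vsum F x = r * k%:R.
  exists #|[pred y | D y x]|.
  rewrite /vsum (bigID (D x)) /=.
  rewrite (eq_bigl (D x)) => [|y]; last first.
    by apply/andP/idP => [[]//|h]; rewrite h (Da _ _ h).
  rewrite (eq_bigr (f x)) => [|y h]; last by rewrite /F h.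
  rewrite (fl x) [X in _ + X](eq_bigl (fun y => D y x)) => [|y]; last first.
    apply/andP/idP => [[h]|h]; first by rewrite (Dx _ _ h) negbK.
    by rewrite adj_sym (Da _ _ h) -(Dx _ _ (Da _ _ h)).
  rewrite [X in _ + X](eq_bigr (fun y => r - f y x)) => [|y h]; last first.
    by rewrite /F; have := Dx _ _ (Da _ _ h); rewrite h => /esym/negbTE ->.
  by rewrite sumrB sumr_const mulr_natr addrCA subrr addr0.
(* For [r <= 0] there is no edge at all, since its two directions would carry at least 1 each and
   add up to [r]. *)
case: (lerP r 0) => r0.
  have noadj (x y : V) : adj x y = false.
    apply/negP => h; have h' := h; rewrite adj_sym in h'.
    by have := F2 _ _ h; have := F1 _ _ h; have := F1 _ _ h'; lra.
  exists (fun _ _ => 0); split=> [x y|x y|x]; rewrite ?noadj //.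
  by exists 0%N; rewrite mulr0 /vsum big1.
have rn : r != 0 by rewrite gt_eqF.
exists (fun x y => F x y * (r' / r)); split=> [x y h|x y h|x].
- by rewrite -mulrDl F2 //; field.
- have c1 : 1 < r' / r by rewrite ltr_pdivlMr // mul1r.
  by have := F1 _ _ h; nra.
- have [k e] := FS x; exists k; rewrite /vsum -mulr_suml -/(vsum F x) e.
  by field.
Qed.

Lemma modflow_int_deg (r : R) f : modflow r f -> r != 0 ->
  forall x, vsum (fun x y => f x y / r) x \is a Num.int.
Proof.
move=> [_ _ h] rn x; have [k e] := h x.
rewrite /vsum -mulr_suml -/(vsum f x) e mulrC mulKf //; exact: natr_int.
Qed.

(** Rounding [f / r] between 0 and 1 selects one direction of every edge, that is, an orientation in
    which the in-degree of a vertex is the multiple of [r] in its vertex sum. With this orientation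
    [f] itself is conserved, and by finiteness its maximum stays below [r - 1]. *)
Lemma modflow_circular (r : R) f : modflow r f ->
  exists2 r', circular_flow G r' & r' < r.
Proof.
move=> mf; have [f2 f1 fs] := mf.
case: (pickP [pred p : V * V | adj p.1 p.2]) => [[a b] /= ab|noadj]; last first.
  exists (r - 1); last by lra.
  have na (x y : V) : adj x y = false := noadj (x, y).
  exists (fun _ _ => false), (fun _ _ => 0); split=> //.
  by split=> // x y; rewrite na.
have ba : adj b a by rewrite adj_sym.
have r0 : 0 < r by have := f2 _ _ ab; have := f1 _ _ ab; have := f1 _ _ ba; lra.
have rn : r != 0 by rewrite gt_eqF.
have [||||g [g1 g2 g3 _]] := @rounding R G (fun x y => f x y / r) 1 0 a b; try done.
- by move=> x y h; rewrite -mulrDl f2 // divff.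
- exact: modflow_int_deg.
- by move=> x y h; apply: divr_ge0; [have := f1 _ _ h; lra|exact: ltW].
have g01 x y : adj x y -> (g x y == 0) || (g x y == 1).
  move=> h; have h' := h; rewrite adj_sym in h'.
  have := g1 _ _ h; have := g3 _ _ h; have := g3 _ _ h'.
  by move: (g x y) (g y x) => u v; lia.
pose D x y := adj x y && (g y x == 1).
have Dx x y : adj x y -> D x y = ~~ D y x.
  move=> h; have h' : adj y x by rewrite adj_sym.
  rewrite /D h h' /=; have := g1 _ _ h; case/orP: (g01 _ _ h) => /eqP ->.
    by rewrite add0r => ->.
  by move=> e; have -> : g y x = 0 by lia.
pose M := \big[Num.max/1]_(p : V * V | adj p.1 p.2) f p.1 p.2.
have Mr : M < r - 1.
  apply: bigmax_lt => [|[x y] /= h].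
    by have := f2 _ _ ab; have := f1 _ _ ab; have := f1 _ _ ba; lra.
  have h' := h; rewrite adj_sym in h'.
  by have := f2 _ _ h; have := f1 _ _ h'; lra.
exists (M + 1); last by lra.
exists D, f; split.
- split=> [x y /andP[]//|x y h]; rewrite (Dx _ _ h); by case: (D y x).
- move=> x; have [k e] := fs x.
  have ek : \sum_(y | adj x y) g x y = k%:Z.
    apply: (@intr_inj R); rewrite g2 /vsum -mulr_suml -/(vsum f x) e mulrC mulKf //.
  have e2 : \sum_(y | D y x) (1 : R) = k%:R.
    rewrite -[k%:R]/((k%:Z)%:~R) -ek rmorph_sum /= [RHS](bigID (fun y => D y x)) /=.
    rewrite [X in _ + X]big1 ?addr0 => [|y /andP[h nd]]; last first.
      move: nd; rewrite /D adj_sym h /=; case/orP: (g01 _ _ h) => /eqP -> //.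
    apply: eq_big => [y|y /andP[_ /eqP ->]//].
    by apply/idP/andP => [h|[]//]; split=> //; have /andP[] := h; rewrite adj_sym.
  have : vsum f x = \sum_(y | D x y) f x y + \sum_(y | D y x) (r - f y x).
    rewrite /vsum (bigID (D x)) /=; congr (_ + _).
      by apply: eq_bigl => y; apply/andP/idP => [[]//|h]; have /andP[-> _] := h.
    apply: eq_big => [y|y /andP[h _]]; last by rewrite -(f2 _ _ h); ring.
    apply/andP/idP => [[h]|h]; first by rewrite (Dx _ _ h) negbK.
    have h' : adj y x by case/andP: h.
    by rewrite adj_sym h' -(Dx _ _ h').
  have e3 : \sum_(y | D y x) r = r * k%:R.
    by rewrite -e2 mulr_sumr; apply: eq_bigr => y _; rewrite mulr1.
  by rewrite e sumrB e3; lra.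
- move=> x y h; have /andP[h1 _] := h.
  apply/andP; split; first by rewrite ltW // f1.
  rewrite addrK; exact: (@le_bigmax_cond _ _ _ _ (x, y) _ (fun p => f p.1 p.2)).
Qed.

Lemma flow_number_lt (r : R) : 0 < r ->
  (circular_flow_number R G < r%:E)%E <-> exists f, modflow r f.
Proof.
move=> r0; split=> [/ereal_inf_lt[_ [r' h <-]]|[f /modflow_circular[r' h lt]]].
  by rewrite lte_fin => lt; apply: circular_modflow h lt r0.
apply: (@le_lt_trans _ _ (r'%:E)); last by rewrite lte_fin.
by apply: ereal_inf_lbound; exists r'.
Qed.
End FlowNumber.

Local Open Scope nat_scope.

(** * The cell *)

Definition K := 136.

(* A block is the Petersen graph minus two adjacent vertices u and v: its
   vertices 0, 3 lost the neighbour u and its vertices 5, 6 lost v. *)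
Definition block_edges : seq (nat * nat) :=
  [:: (0, 1); (1, 2); (2, 3); (0, 4); (1, 5); (2, 6); (3, 7); (5, 7); (4, 7); (4, 6)].

(* A slot has blocks at 0, 8 and 16 and two three-vertex paths, centred at 24
   and 27; the first two blocks hang on the first path, and the u side of the
   third together with the v side of the first on the second path. *)
Definition slot_edges : seq (nat * nat) :=
  block_edges ++ [seq (8 + e.1, 8 + e.2) | e <- block_edges] ++
  [seq (16 + e.1, 16 + e.2) | e <- block_edges] ++
  [:: (24, 25); (24, 26); (25, 0); (25, 8); (26, 3); (26, 11);
      (27, 28); (27, 29); (28, 5); (28, 16); (29, 6); (29, 19)].

Definition tree_edges : seq (nat * nat) := [::
  (120, 121); (121, 122); (122, 123); (123, 124); (124, 125); (120, 13);
  (120, 43); (121, 73); (122, 103); (123, 14); (124, 44); (125, 74);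
  (125, 104); (126, 127); (127, 128); (128, 129); (129, 130); (130, 131);
  (131, 132); (132, 133); (133, 134); (134, 135); (126, 21); (126, 51);
  (128, 81); (130, 111); (131, 22); (133, 52); (135, 82); (135, 112)].

(** An order of the vertices for the exhaustive search over cuts. Nothing about it is assumed:
    [cell_order_perm] and [order_edges_perm] check it against the cell. *)
Definition cell_order : seq nat := [::
  105; 101; 102; 103; 100; 104; 99; 98; 116; 122; 125; 115; 114; 93; 121;
  123; 124; 74; 90; 92; 91; 97; 94; 96; 95; 73; 120; 14; 44; 70; 69; 72; 75;
  71; 68; 119; 118; 117; 13; 43; 10; 9; 12; 15; 11; 8; 40; 39; 42; 45; 41;
  38; 86; 85; 84; 109; 106; 26; 25; 24; 56; 55; 54; 63; 60; 108; 107; 113;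
  110; 112; 111; 3; 0; 33; 30; 62; 61; 67; 64; 66; 65; 135; 130; 2; 1; 7; 4;
  6; 5; 32; 31; 37; 34; 36; 35; 89; 88; 87; 82; 134; 129; 131; 29; 28; 27;
  59; 58; 57; 79; 78; 76; 80; 83; 77; 81; 128; 133; 132; 22; 19; 18; 16; 20;
  23; 17; 21; 49; 46; 127; 126; 52; 48; 47; 50; 53; 51].

(** Entry [i] encodes the earlier neighbours of the [i]-th vertex of the order; the offset [o]
    denotes position [i - 1 - o]. These are indices into the mask of the search, whose head is the
    most recent choice. *)
Definition cell_back : seq (seq nat) := [::
  [::]; [:: 0]; [:: 1]; [:: 2]; [:: 2]; [:: 0; 2]; [:: 1; 2]; [:: 0; 4];
  [:: 6]; [:: 5]; [:: 4]; [:: 3]; [:: 0; 3]; [:: 4]; [:: 4]; [:: 5];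
  [:: 0; 5]; [:: 6]; [:: 6]; [:: 5]; [:: 1; 0]; [:: 7]; [:: 3; 0]; [:: 3; 0];
  [:: 3; 2]; [:: 10]; [:: 11]; [:: 11]; [:: 11]; [:: 11]; [:: 0; 4]; [:: 13];
  [:: 6; 0]; [:: 3; 0]; [:: 3; 2]; [:: 11]; [:: 11]; [:: 0; 1]; [:: 11];
  [:: 12]; [:: 12]; [:: 0; 2]; [:: 14]; [:: 4; 0]; [:: 3; 0]; [:: 3; 2];
  [:: 17]; [:: 0; 7]; [:: 19]; [:: 9; 0]; [:: 3; 0]; [:: 3; 2]; [:: 18];
  [:: 18]; [:: 0; 1]; [:: 19]; [:: 19]; [:: 12]; [:: 12]; [:: 0; 1]; [:: 9];
  [:: 9]; [:: 0; 1]; [:: 10]; [:: 10]; [:: 9]; [:: 9; 0]; [:: 11];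
  [:: 11; 0]; [:: 3; 0]; [:: 3; 2]; [:: 13]; [:: 13]; [:: 12]; [:: 12];
  [:: 11]; [:: 11; 0]; [:: 13]; [:: 13; 0]; [:: 3; 0]; [:: 3; 2]; [:: 11];
  [:: 11]; [:: 11]; [:: 11; 0]; [:: 13]; [:: 13; 0]; [:: 3; 0]; [:: 3; 2];
  [:: 15]; [:: 15; 0]; [:: 17]; [:: 17; 0]; [:: 3; 0]; [:: 3; 2]; [:: 15];
  [:: 15]; [:: 0; 1]; [:: 16]; [:: 17]; [:: 17]; [:: 18]; [:: 14]; [:: 14];
  [:: 0; 1]; [:: 11]; [:: 11]; [:: 0; 1]; [:: 12]; [:: 0; 10]; [:: 13];
  [:: 0; 12]; [:: 3; 0]; [:: 2; 3]; [:: 0; 1]; [:: 14; 0]; [:: 16];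
  [:: 15; 0]; [:: 16]; [:: 16]; [:: 0; 1]; [:: 17]; [:: 0; 3]; [:: 3; 0];
  [:: 2; 3]; [:: 0; 1]; [:: 20]; [:: 20]; [:: 12]; [:: 0; 3]; [:: 13];
  [:: 4; 0]; [:: 4; 0]; [:: 5; 2]; [:: 7; 0]; [:: 2; 0; 5]].

(** Values are in units of 1/30: 150 stands for 5, and the open interval (1, 4) becomes (30, 120). A
    row lists them in the order of [cell_edges], from the first end to the second. Seven patterns
    are enough, because replacing every value by its difference to 150 complements the pattern. *)
Definition flow_table : seq (seq bool * seq nat) := [::
  ([:: true; true; true; false], [::
    31; 119; 57; 42; 62; 62; 110; 117; 73; 119; 71; 37; 71; 40; 34; 116; 102;
    82; 116; 74; 112; 41; 99; 77; 71; 92; 68; 118; 114; 113; 34; 84; 73; 111;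
    53; 31; 94; 88; 55; 39; 119; 119; 95; 42; 119; 88; 53; 73; 62; 119; 119;
    119; 93; 54; 93; 111; 39; 111; 31; 80; 39; 72; 84; 115; 84; 105; 119; 31;
    53; 31; 66; 39; 87; 31; 33; 54; 93; 88; 105; 77; 66; 39; 108; 119; 113;
    31; 119; 92; 82; 62; 40; 49; 61; 31; 73; 108; 73; 109; 115; 35; 33; 80;
    37; 72; 41; 80; 119; 55; 111; 111; 31; 33; 86; 119; 87; 31; 55; 32; 71;
    110; 63; 119; 117; 96; 57; 62; 117; 47; 101; 80; 70; 96; 62; 119; 119;
    111; 119; 73; 106; 86; 46; 117; 75; 107; 118; 118; 89; 57; 93; 99; 32;
    114; 31; 87; 32; 67; 102; 80; 47; 55; 111; 119; 87; 31; 49; 38; 93; 88;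
    61; 96; 35; 75; 108; 48; 41; 115; 61; 110; 117; 43; 65; 41; 116; 44; 119;
    64; 119; 44; 114; 39; 47; 62; 72; 55; 95; 80; 70; 119]);
  ([:: true; true; false; true], [::
    31; 118; 52; 49; 63; 66; 98; 118; 84; 115; 42; 92; 52; 69; 100; 40; 83;
    33; 34; 35; 114; 54; 114; 75; 60; 90; 83; 105; 112; 113; 41; 77; 80; 111;
    46; 31; 94; 88; 55; 39; 119; 119; 91; 60; 94; 97; 31; 116; 32; 87; 31;
    66; 111; 31; 119; 88; 80; 62; 62; 31; 57; 31; 83; 117; 83; 106; 116; 34;
    52; 39; 59; 47; 87; 31; 38; 49; 88; 93; 95; 87; 56; 39; 118; 119; 62; 31;
    62; 44; 31; 119; 114; 87; 99; 95; 85; 31; 62; 32; 54; 119; 119; 89; 92;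
    90; 106; 55; 117; 75; 51; 88; 62; 119; 119; 106; 73; 109; 106; 117; 52;
    57; 87; 31; 56; 31; 86; 95; 109; 48; 119; 72; 61; 79; 64; 119; 117; 105;
    107; 68; 99; 99; 39; 119; 35; 81; 34; 65; 114; 77; 118; 75; 37; 109; 87;
    96; 117; 108; 87; 31; 31; 56; 95; 86; 97; 85; 58; 39; 116; 119; 116; 81;
    39; 114; 57; 83; 101; 35; 42; 75; 57; 91; 116; 32; 107; 39; 114; 55; 108;
    33; 114; 39; 45; 73; 68; 59; 97; 69; 106; 83]);
  ([:: true; true; false; false], [::
    63; 31; 69; 36; 32; 112; 104; 80; 116; 70; 37; 119; 50; 66; 68; 69; 81;
    119; 100; 116; 112; 49; 112; 85; 63; 87; 81; 103; 116; 119; 52; 66; 99;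
    103; 35; 31; 95; 87; 48; 47; 118; 119; 67; 34; 76; 33; 33; 108; 110; 94;
    96; 87; 72; 38; 72; 31; 34; 116; 103; 98; 99; 82; 119; 69; 100; 78; 50;
    119; 69; 118; 113; 115; 53; 65; 100; 103; 34; 31; 108; 74; 61; 47; 105;
    119; 71; 106; 59; 38; 115; 47; 116; 67; 117; 71; 65; 96; 57; 39; 119; 39;
    119; 63; 118; 71; 33; 73; 40; 70; 110; 33; 71; 41; 38; 32; 63; 119; 109;
    104; 57; 62; 55; 63; 102; 103; 32; 31; 119; 38; 119; 79; 81; 69; 87; 31;
    32; 47; 115; 61; 101; 82; 54; 110; 70; 114; 116; 116; 67; 32; 83; 36; 35;
    99; 114; 92; 94; 92; 95; 87; 48; 47; 118; 119; 53; 65; 100; 103; 34; 31;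
    35; 91; 31; 66; 114; 51; 64; 94; 60; 115; 102; 40; 74; 42; 117; 36; 111;
    54; 110; 35; 119; 44; 40; 68; 81; 57; 94; 66; 85; 109]);
  ([:: true; false; true; true], [::
    109; 51; 119; 73; 58; 82; 63; 118; 119; 104; 95; 60; 95; 110; 35; 115;
    32; 85; 33; 77; 85; 118; 85; 104; 117; 33; 54; 62; 34; 70; 87; 31; 32;
    55; 94; 87; 99; 83; 60; 39; 114; 119; 95; 58; 89; 119; 37; 119; 33; 85;
    32; 87; 119; 80; 112; 86; 39; 118; 81; 101; 118; 118; 84; 119; 88; 99;
    115; 31; 31; 62; 57; 42; 119; 63; 64; 55; 94; 119; 81; 37; 48; 33; 94;
    93; 115; 56; 119; 66; 59; 87; 64; 119; 117; 99; 105; 68; 33; 101; 37; 35;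
    119; 116; 65; 36; 105; 74; 105; 84; 31; 119; 74; 108; 118; 116; 87; 31;
    31; 56; 95; 86; 99; 83; 60; 39; 114; 119; 32; 119; 39; 38; 63; 80; 95;
    119; 86; 102; 74; 37; 74; 37; 37; 113; 105; 83; 112; 75; 70; 107; 70;
    119; 113; 37; 39; 53; 58; 61; 31; 87; 70; 111; 56; 31; 95; 87; 56; 39;
    118; 119; 38; 109; 63; 105; 41; 50; 62; 79; 46; 108; 64; 79; 112; 108;
    33; 106; 31; 91; 44; 119; 42; 117; 95; 97; 77; 90; 47; 77; 65; 52]);
  ([:: true; false; true; false], [::
    86; 118; 86; 97; 118; 32; 37; 65; 48; 49; 86; 55; 102; 118; 31; 103; 32;
    80; 38; 80; 69; 100; 69; 47; 119; 31; 119; 62; 119; 78; 87; 31; 33; 54;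
    101; 80; 63; 119; 97; 116; 69; 50; 119; 61; 119; 86; 58; 92; 80; 101;
    119; 117; 82; 41; 74; 115; 41; 117; 43; 76; 31; 84; 74; 119; 88; 117;
    105; 31; 31; 48; 71; 46; 102; 80; 55; 47; 111; 119; 84; 34; 43; 41; 91;
    93; 64; 32; 72; 31; 32; 110; 111; 102; 87; 94; 72; 110; 72; 31; 112; 38;
    103; 80; 117; 64; 88; 119; 70; 109; 119; 49; 39; 48; 63; 46; 48; 70; 95;
    103; 39; 31; 117; 65; 70; 47; 96; 119; 38; 85; 35; 81; 103; 50; 82; 35;
    33; 48; 53; 84; 119; 41; 119; 115; 41; 32; 77; 114; 32; 94; 42; 71; 88;
    52; 73; 40; 37; 34; 63; 119; 119; 94; 47; 72; 35; 83; 82; 103; 52; 31;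
    66; 98; 35; 68; 119; 49; 35; 118; 63; 117; 99; 48; 71; 114; 39; 110; 35;
    83; 42; 117; 44; 119; 93; 93; 79; 102; 41; 73; 55; 64]);
  ([:: true; false; false; true], [::
    107; 49; 119; 74; 58; 80; 72; 109; 119; 105; 88; 119; 88; 103; 119; 31;
    31; 66; 53; 50; 79; 119; 75; 118; 110; 44; 44; 50; 56; 62; 72; 46; 31;
    41; 103; 93; 98; 84; 51; 47; 115; 119; 88; 33; 71; 31; 55; 112; 118; 109;
    73; 108; 39; 96; 31; 70; 93; 65; 88; 31; 31; 39; 77; 117; 86; 106; 110;
    31; 37; 51; 62; 44; 78; 104; 119; 109; 47; 57; 87; 31; 54; 33; 80; 101;
    74; 32; 64; 39; 42; 118; 117; 97; 86; 103; 33; 111; 32; 67; 72; 79; 98;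
    104; 98; 119; 64; 115; 83; 118; 99; 32; 35; 36; 79; 39; 63; 119; 113;
    100; 53; 66; 87; 31; 55; 32; 79; 102; 102; 33; 115; 87; 69; 68; 60; 35;
    55; 32; 91; 60; 99; 107; 31; 111; 35; 82; 33; 74; 53; 87; 50; 44; 116;
    37; 119; 62; 119; 75; 87; 31; 39; 48; 95; 86; 63; 119; 116; 97; 50; 69;
    115; 83; 32; 113; 67; 97; 88; 32; 51; 69; 46; 102; 115; 119; 44; 107; 32;
    86; 42; 117; 42; 117; 90; 91; 87; 96; 44; 75; 79; 38]);
  ([:: true; false; false; false], [::
    62; 31; 67; 31; 31; 114; 116; 93; 91; 90; 31; 77; 44; 64; 104; 33; 75;
    43; 32; 32; 119; 42; 104; 86; 77; 88; 73; 110; 117; 119; 38; 80; 93; 95;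
    49; 31; 117; 65; 62; 55; 96; 119; 118; 31; 114; 104; 87; 67; 66; 31; 53;
    51; 79; 110; 63; 110; 119; 47; 32; 61; 57; 53; 68; 36; 68; 43; 32; 118;
    99; 116; 85; 108; 111; 71; 72; 39; 102; 119; 55; 63; 94; 111; 32; 31; 37;
    75; 31; 82; 112; 44; 86; 33; 31; 51; 62; 31; 62; 39; 31; 119; 119; 85;
    96; 93; 33; 65; 33; 78; 118; 32; 64; 43; 43; 35; 70; 112; 119; 101; 55;
    57; 32; 86; 71; 111; 55; 31; 118; 31; 96; 99; 87; 85; 53; 31; 66; 33; 79;
    43; 79; 110; 36; 114; 48; 68; 34; 76; 31; 119; 31; 80; 62; 88; 62; 119;
    119; 111; 106; 76; 67; 39; 107; 119; 55; 63; 94; 111; 32; 31; 119; 65;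
    33; 98; 48; 89; 92; 54; 32; 85; 50; 88; 110; 33; 108; 33; 108; 51; 108;
    33; 109; 34; 33; 84; 75; 57; 93; 74; 83; 101])].

(* Slots start at 0, 30, 60 and 90; the path 120..125 gathers the v sides of
   the second blocks and the path 126..135 those of the third blocks. *)
Definition cell_edges : seq (nat * nat) :=
  flatten [seq [seq (30 * j + e.1, 30 * j + e.2) | e <- slot_edges] | j <- iota 0 4]
  ++ tree_edges.

Definition port (out : bool) j := 30 * j + (if out then 27 else 24).
Definition ext_verts : seq nat :=
  [seq port false j | j <- iota 0 4] ++ [seq port true j | j <- iota 0 4] ++
  [:: 127; 129; 132; 134].
Definition ext l := l \in ext_verts.

Definition nbr l : seq nat :=
  [seq e.2 | e <- cell_edges & e.1 == l] ++ [seq e.1 | e <- cell_edges & e.2 == l].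

Definition nbrs : seq (seq nat) := [seq nbr l | l <- iota 0 K].

Opaque cell_edges cell_order cell_back flow_table ext_verts.

Lemma nbrE l : l < K -> nbr l = nth [::] nbrs l.
Proof. by move=> lt; rewrite /nbrs -/(mkseq nbr K) nth_mkseq. Qed.

Lemma mem_nbr l y :
  (y \in nbr l) = ((l, y) \in cell_edges) || ((y, l) \in cell_edges).
Proof.
rewrite /nbr mem_cat; congr (_ || _); apply/mapP/idP => [[[a b]]|h].
- by rewrite mem_filter /= => /andP[/eqP -> h] ->.
- by exists (l, y); rewrite ?mem_filter /= ?eqxx.
- by rewrite mem_filter /= => /andP[/eqP -> h] ->.
- by exists (y, l); rewrite ?mem_filter /= ?eqxx.
Qed.

Lemma nbr_sym l y : (y \in nbr l) = (l \in nbr y).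
Proof. by rewrite !mem_nbr orbC. Qed.

Lemma all_iotaP n (p : pred nat) : all p (iota 0 n) -> forall i, i < n -> p i.
Proof. by move=> /allP h i lt; apply: h; rewrite mem_iota add0n. Qed.

Opaque nbrs nbr.

Definition nbr_ok l (s : seq nat) :=
  [&& uniq s, size s + ext l == 3, l \notin s & all (fun y => y < K) s].

Lemma nbr_table : all (fun l => nbr_ok l (nth [::] nbrs l)) (iota 0 K).
Proof. by vm_compute. Qed.

Lemma nbr_facts l : l < K -> [/\ uniq (nbr l), size (nbr l) + ext l = 3,
  l \notin nbr l & all (fun y => y < K) (nbr l)].
Proof.
move=> lt; have := all_iotaP nbr_table lt; rewrite -nbrE //.
move: (nbr l) => s; rewrite /nbr_ok => /and4P[h1 /eqP h2 h3 h4].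
by split; assumption.
Qed.

Lemma ext_table : all (fun l => (l < K) &&
  all (fun y => ~~ ext y) (nth [::] nbrs l)) ext_verts.
Proof. by vm_compute. Qed.

Lemma ext_lt l : ext l -> l < K.
Proof. by rewrite /ext => h; have /andP[h1 _] := allP ext_table l h; exact: h1. Qed.

Lemma ext_nonadj l y : ext l -> y \in nbr l -> ext y = false.
Proof.
move=> h; have lt := ext_lt h; move: h; rewrite /ext => h.
have /andP[_] := allP ext_table l h; rewrite -nbrE //.
by move: (nbr l) => s /allP h2 /h2; apply: negbTE.
Qed.

Definition short_cycle_free x y z (sx sz : seq nat) :=
  (z == x) || ((z \notin sx) && all (fun w => (w == y) || (w \notin sx)) sz).

Lemma short_cycle_table : all (fun x => all (fun y => all (fun z =>
    short_cycle_free x y z (nth [::] nbrs x) (nth [::] nbrs z))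
  (nth [::] nbrs y)) (nth [::] nbrs x)) (iota 0 K).
Proof. by vm_compute. Qed.

Lemma nbr_lt l y : l < K -> y \in nbr l -> y < K.
Proof. by move=> /nbr_facts[_ _ _ /allP h] /h. Qed.

Lemma cell_no_short_cycle x y z : x < K -> y \in nbr x -> z \in nbr y -> z != x ->
  z \notin nbr x /\ forall w, w \in nbr z -> w \in nbr x -> w = y.
Proof.
move=> lx yx zy zx.
have ly := nbr_lt lx yx; have lz := nbr_lt ly zy.
have := all_iotaP short_cycle_table lx; rewrite -nbrE // => /allP/(_ _ yx).
rewrite -nbrE // => /allP/(_ _ zy); rewrite -nbrE //.
move: (nbr x) (nbr z) => sx sz; rewrite /short_cycle_free (negbTE zx) /=.
move=> /andP[h1 /allP h2]; split; first exact: h1.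
by move=> w wz wx; have := h2 _ wz; rewrite wx orbF => /eqP.
Qed.

(** * Small edge cuts of the cell *)

(* Backtracking over all vertex sets, listed in [cell_order], whose number of
   cut edges stays below [lim]. *)
Fixpoint cut_search lim (bk : seq (seq nat * bool)) (mask : seq bool) cut
    (P : seq bool -> bool) : bool :=
  if bk is (b, x) :: bk' then
    all (fun bit => let c := cut + count (fun o => nth false mask o != bit) b +
        (x && bit) in if lim < c then true else cut_search lim bk' (bit :: mask) c P)
      [:: true; false]
  else P mask.

Fixpoint cut_total (A : seq bool) (bk : seq (seq nat * bool)) (mask : seq bool) :=
  match A, bk with
  | bit :: A', (b, x) :: bk' => count (fun o => nth false mask o != bit) b +
      (x && bit) + cut_total A' bk' (bit :: mask)
  | _, _ => 0
  end.

Lemma cut_searchP lim bk A mask cut P : cut_search lim bk mask cut P ->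
  size A = size bk -> cut + cut_total A bk mask <= lim -> P (catrev A mask).
Proof.
elim: bk A mask cut => [|[b x] bk IH] [|bit A] mask cut //= h [sz] le.
have {}h : let c := cut + count (fun o => nth false mask o != bit) b + (x && bit) in
    if lim < c then true else cut_search lim bk (bit :: mask) c P.
  by move: h => /and3P[ht hf _]; case: (bit).
move: h => /=; case: ltnP => [|_ h]; first by lia.
by apply: IH h sz _; lia.
Qed.

Definition order_edges : seq (nat * nat) := flatten [seq
  [seq (nth 0 cell_order i, nth 0 cell_order (i - 1 - o)) | o <- nth [::] cell_back i]
  | i <- iota 0 K].

Definition cut_of (a : nat -> bool) := count (fun e : nat * nat => a e.1 != a e.2).

Lemma size_order_back (a f : nat -> bool) : size [seq a l | l <- cell_order] =
  size (zip cell_back [seq f l | l <- cell_order]).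
Proof.
have szo : size cell_order = K by vm_compute.
have szb : size cell_back = K by vm_compute.
by rewrite size_zip !size_map szo szb minnn.
Qed.

Lemma cut_total_order (a : nat -> bool) (x : nat -> bool) n : n <= K ->
  cut_total [seq a l | l <- drop n cell_order]
    (drop n (zip cell_back [seq x l | l <- cell_order]))
    (rev [seq a l | l <- take n cell_order]) =
  \sum_(n <= i < K) (count (fun o => a (nth 0 cell_order (i - 1 - o)) !=
     a (nth 0 cell_order i)) (nth [::] cell_back i) +
     (x (nth 0 cell_order i) && a (nth 0 cell_order i))).
Proof.
have szo : size cell_order = K by vm_compute.
have szb : size cell_back = K by vm_compute.
have bnd : all (fun i => all (fun o => o < i) (nth [::] cell_back i)) (iota 0 K).
  by vm_compute.
move=> le; have [d e] : exists d, n + d = K by exists (K - n); lia.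
elim: d n le e => [|d IH] n le e.
  by have -> : n = K; [lia|rewrite big_geq // drop_oversize ?szo].
have lt : n < K by lia.
rewrite big_ltn // (drop_nth 0) ?szo // (drop_nth ([::], false)); last first.
  by rewrite size_zip size_map szo szb.
rewrite nth_zip ?size_map ?szo ?szb //= (nth_map 0) ?szo //.
congr (_ + _).
  congr (_ + _); apply: eq_in_count => o ho.
  have lo : o < n by apply: (allP (all_iotaP bnd lt)).
  congr (_ != _).
  rewrite nth_rev size_map size_take szo lt // (nth_map 0) ?size_take ?szo ?lt; last by lia.
  by rewrite nth_take; [congr (a (nth _ _ _))|]; lia.
rewrite -IH; [|lia|lia]; congr cut_total.
by rewrite (take_nth 0) ?szo // map_rcons rev_rcons.
Qed.

Lemma count_order_edges (a : nat -> bool) : cut_of a order_edges =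
  \sum_(0 <= i < K) count (fun o => a (nth 0 cell_order (i - 1 - o)) !=
     a (nth 0 cell_order i)) (nth [::] cell_back i).
Proof.
rewrite /cut_of count_flatten -map_comp sumnE big_map /index_iota subn0.
apply: eq_bigr => i _; rewrite /= count_map; apply: eq_count => o /=.
by rewrite eq_sym.
Qed.

Definition norm_edge (e : nat * nat) := (minn e.1 e.2, maxn e.1 e.2).

Lemma order_edges_perm :
  perm_eq (map norm_edge order_edges) (map norm_edge cell_edges).
Proof. by vm_compute. Qed.

Lemma cut_of_norm a s : cut_of a (map norm_edge s) = cut_of a s.
Proof.
rewrite /cut_of count_map; apply: eq_count => -[x y] /=.
by rewrite /minn /maxn; case: ifP => //= _; rewrite eq_sym.
Qed.

Lemma cut_of_cell a : cut_of a cell_edges = cut_of a order_edges.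
Proof.
rewrite -[LHS]cut_of_norm -[RHS]cut_of_norm; apply/permP.
by rewrite perm_sym order_edges_perm.
Qed.

Lemma cell_order_perm : perm_eq cell_order (iota 0 K).
Proof. by vm_compute. Qed.

(** The cell alone is 2-edge-connected: the search with limit 1, and no weight on external vertices,
    leaves only constant masks. *)
Lemma cell_connected a : cut_of a cell_edges <= 1 -> forall l, l < K -> a l = a 0.
Proof.
rewrite cut_of_cell count_order_edges => h.
have H : cut_search 1 (zip cell_back (map (fun=> false) cell_order)) [::] 0
  (fun m => constant m) by vm_compute.
have T := @cut_total_order a (fun=> false) 0 isT; rewrite !drop0 take0 in T.
have := cut_searchP (A := [seq a l | l <- cell_order]) H.
rewrite add0n T (eq_bigr (fun i => count (fun o => a (nth 0 cell_order (i - 1 - o)) !=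
     a (nth 0 cell_order i)) (nth [::] cell_back i))) => [|i _]; last by rewrite addn0.
move=> /(_ (size_order_back _ _) h); rewrite catrevE cats0 => /(constantP true)[b e].
have all_b l : l < K -> a l = b.
  move=> lt; have : a l \in rev [seq a l | l <- cell_order].
    by rewrite mem_rev map_f // (perm_mem cell_order_perm) mem_iota.
  by rewrite e mem_nseq => /andP[_ /eqP].
by move=> l lt; rewrite !all_b.
Qed.

(** A set inside a single cell also cuts the edge that leaves the cell at each of its external
    vertices; these are the extra weights. The search with limit 3 finds no such set with two or
    more vertices. *)
Lemma cell_cut_small a : cut_of a cell_edges +
  count (fun l => ext l && a l) (iota 0 K) <= 3 -> count a (iota 0 K) <= 1.
Proof.
rewrite cut_of_cell count_order_edges -!(permP cell_order_perm) => h.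
have H : cut_search 3 (zip cell_back (map ext cell_order)) [::] 0
  (fun m => count id m <= 1) by vm_compute.
have T := @cut_total_order a ext 0 isT; rewrite !drop0 take0 in T.
have := cut_searchP (A := [seq a l | l <- cell_order]) H.
rewrite add0n T big_split => /(_ (size_order_back _ _)) H2.
have e1 : \sum_(0 <= i < K) (ext (nth 0 cell_order i) && a (nth 0 cell_order i)) =
    count (fun l => ext l && a l) cell_order.
  have szo : size cell_order = K by vm_compute.
  rewrite -sum1_count [RHS]big_mkcond [RHS](big_nth 0) szo; apply: eq_bigr => i _.
  by case: (ext _ && a _).
rewrite e1 in H2; have := H2 h.
by rewrite catrevE cats0 count_rev count_map.
Qed.

(** * Flows that realise the not-all-equal patterns *)

Definition table_row (p : seq bool) : seq nat :=
  let find_row q := nth [::] [seq r.2 | r <- flow_table]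
     (index q [seq r.1 | r <- flow_table]) in
  if nth false p 0 then find_row p else [seq 150 - v | v <- find_row [seq ~~ b | b <- p]].

Definition table_flow (p : seq bool) l y : nat :=
  let i := index (l, y) cell_edges in
  if i < size cell_edges then nth 0 (table_row p) i
  else 150 - nth 0 (table_row p) (index (y, l) cell_edges).

(** In units of 1/30, 32 and 118 are a low and a high port value adding up to 5. The joins of the
    ring carry 75, that is 5/2, the same in both directions. *)
Definition ext_flow (p : seq bool) l : nat :=
  if l \in [seq port false j | j <- iota 0 4] then
    if nth false p (l %/ 30) then 32 else 118
  else if l \in [seq port true j | j <- iota 0 4] then
    if nth false p (l %/ 30) then 118 else 32
  else 75.

Definition nae (p : seq bool) := (true \in p) && (false \in p).

Definition table_ok p := all (fun l => let s := nth [::] nbrs l in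
  let t := sumn [seq table_flow p l y | y <- s] + (if ext l then ext_flow p l else 0) in
  ((t == 150) || (t == 300)) &&
  all (fun y => (30 < table_flow p l y) && (table_flow p l y < 120)) s) (iota 0 K).

Fixpoint words n : seq (seq bool) :=
  if n is n'.+1 then [seq b :: w | b <- [:: true; false], w <- words n'] else [:: [::]].

Lemma mem_words n w : size w = n -> w \in words n.
Proof.
elim: n w => [|n IH] [|b w] //= [sz].
rewrite cats0 mem_cat; apply/orP; case: b; [left|right]; apply: map_f; exact: IH.
Qed.

Lemma all_patternsP (Q : seq bool -> bool) p :
  all (fun p => nae p ==> Q p) (words 4) -> size p = 4 -> nae p -> Q p.
Proof. by move=> /allP H sz n; apply: (implyP (H p _)) n; apply: mem_words. Qed.

Lemma table_ok_table : all (fun p => nae p ==> table_ok p) (words 4).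
Proof. by vm_compute. Qed.

Lemma table_okP p l : size p = 4 -> nae p -> l < K ->
  let t := sumn [seq table_flow p l y | y <- nbr l] +
    (if ext l then ext_flow p l else 0) in
  ((t == 150) || (t == 300)) /\
  forall y, y \in nbr l -> (30 < table_flow p l y) && (table_flow p l y < 120).
Proof.
move=> sz np lt; have := all_iotaP (all_patternsP table_ok_table sz np) lt.
rewrite -nbrE //; move: (nbr l) => s /andP[h1 /allP h2].
by split; [exact: h1|exact: h2].
Qed.

Definition table_anti p := all (fun e : nat * nat =>
  table_flow p e.1 e.2 + table_flow p e.2 e.1 == 150) cell_edges.

Lemma table_anti_table : all (fun p => nae p ==> table_anti p) (words 4).
Proof. by vm_compute. Qed.

Lemma table_flow_rev p l y : y \in nbr l -> size p = 4 -> nae p ->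
  table_flow p l y + table_flow p y l = 150.
Proof.
move=> yl sz np; have := all_patternsP table_anti_table sz np.
move/allP => H; move: yl; rewrite mem_nbr => /orP[] /H/eqP //=.
by rewrite addnC.
Qed.

(** * Membership in NP *)

Lemma nth_allpairs (T : Type) (P : T -> T -> bool) (s t : seq T) x0 i j :
  i < size s -> j < size t ->
  nth false [seq P a b | a <- s, b <- t] (i * size t + j) = P (nth x0 s i) (nth x0 t j).
Proof.
elim: s i => [|a s IH] [|i] //= li lj; rewrite nth_cat size_map.
  by rewrite add0n lj (nth_map x0).
rewrite mulSn -addnA ltnNge leq_addr /= addKn; exact: IH.
Qed.

Lemma size_graph_code G : size (graph_code G) = nverts G + 1 + nverts G * nverts G.
Proof. by rewrite /graph_code size_cat size_nseq /= size_allpairs size_enum_ord; lia. Qed.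

Lemma nth_graph_code G (x y : 'I_(nverts G)) :
  nth false (graph_code G) (nverts G + 1 + (x * nverts G + y)) = adj x y.
Proof.
rewrite /graph_code nth_cat size_nseq ltnNge -addnA leq_addr /= addKn add1n /=.
have := @nth_allpairs _ (@adj G) (enum 'I_(nverts G)) (enum 'I_(nverts G)) x x y.
by rewrite size_enum_ord !nth_ord_enum => ->.
Qed.

Lemma nth_graph_code_size G i : i <= nverts G ->
  nth false (graph_code G) i = (i < nverts G).
Proof.
move=> le; rewrite /graph_code nth_cat size_nseq; case: ltnP => h; first by rewrite nth_nseq h.
by have -> : i - nverts G = 0 by lia.
Qed.

(** The pairing doubles the first word, so its bit [i] stands at position [2 * i + 1]; the matrix
    starts after [n] ones and a zero. *)
Definition edge_bit z n i j := nth false z (2 * (n + 1 + (i * n + j)) + 1).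
(** The certificate is written in one-hot form, [15 * n + 1] bits for each ordered pair of vertices,
    so that a bounded formula reads a value without decoding numerals. [unique_ok] then makes the
    value well defined. *)
Definition flow_bit z n i j v :=
  nth false z (2 * (n + 1 + n * n) + 1 + ((i * n + j) * (15 * n).+1 + v)).

Definition vertex_ok z n x :=
  has (fun y1 => has (fun y2 => has (fun y3 =>
    [&& y1 != y2, y1 != y3, y2 != y3, edge_bit z n x y1, edge_bit z n x y2,
      edge_bit z n x y3 &
    has (fun v1 => has (fun v2 => has (fun v3 =>
      [&& flow_bit z n x y1 v1, flow_bit z n x y2 v2, flow_bit z n x y3 v3 &
        (v1 + v2 + v3 == 15 * n) || (v1 + v2 + v3 == 30 * n)])
    (iota 0 (15 * n).+1)) (iota 0 (15 * n).+1)) (iota 0 (15 * n).+1)])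
  (iota 0 n)) (iota 0 n)) (iota 0 n).

Definition arc_ok z n x y := edge_bit z n x y ==>
  has (fun v => has (fun v' => [&& flow_bit z n x y v, flow_bit z n y x v',
    3 * n < v, 3 * n < v' & v + v' == 15 * n]) (iota 0 (15 * n).+1)) (iota 0 (15 * n).+1).

Definition unique_ok z n x y := all (fun v => all (fun v' =>
  (flow_bit z n x y v && flow_bit z n x y v') ==> (v == v')) (iota 0 (15 * n).+1))
  (iota 0 (15 * n).+1).

(** The order of the graph is quantified and pinned down by the unary prefix of the code. Cubicity
    is part of the promise, so three distinct neighbours are known to be all of them. *)
Definition verify z := has (fun n => [&& ~~ nth false z (2 * n + 1),
  all (fun i => nth false z (2 * i + 1)) (iota 0 n),
  all (fun x => vertex_ok z n x) (iota 0 n) &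
  all (fun x => all (fun y => arc_ok z n x y && unique_ok z n x y) (iota 0 n)) (iota 0 n)])
  (iota 0 (size z)).

Ltac fv := first [exact: (ft_top _ _) | exact: (ft_weak (ft_top _ _))
  | exact: (ft_weak (ft_weak (ft_top _ _)))
  | exact: (ft_weak (ft_weak (ft_weak (ft_top _ _))))
  | exact: (ft_weak (ft_weak (ft_weak (ft_weak (ft_top _ _)))))
  | exact: (ft_weak (ft_weak (ft_weak (ft_weak (ft_weak (ft_top _ _))))))
  | exact: (ft_weak (ft_weak (ft_weak (ft_weak (ft_weak (ft_weak (ft_top _ _)))))))
  | exact: (ft_weak (ft_weak (ft_weak (ft_weak (ft_weak (ft_weak (ft_weak (ft_top _ _))))))))
  | exact: (ft_weak (ft_weak (ft_weak (ft_weak (ft_weak (ft_weak (ft_weak (ft_weak (ft_top _ _))))))))) ].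
Ltac foq := repeat first [fv | ft_one | apply: ff_ex | apply: ff_all | ff_one].

Lemma ffm_verify : ffm (fun w : seq bool => w) [::] verify.
Proof.
rewrite /verify /vertex_ok /arc_ok /unique_ok /edge_bit /flow_bit.
by foq.
Qed.

(** A flow modulo 5 multiplied by [3 * n], the number of arcs of a cubic graph. Three values
    strictly between [3 * n] and [12 * n] leave only two possible multiples of [15 * n] at a
    vertex. *)
Definition certificate G (h : 'I_(nverts G) -> 'I_(nverts G) -> nat) :=
  (forall x y, adj x y -> 3 * nverts G < h x y /\ h x y + h y x = 15 * nverts G) /\
  (forall x, \sum_(y | adj x y) h x y = 15 * nverts G \/
             \sum_(y | adj x y) h x y = 30 * nverts G).

Lemma cubic_sum G (x y1 y2 y3 : 'I_(nverts G)) (h : 'I_(nverts G) -> nat) : cubic G ->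
  y1 != y2 -> y1 != y3 -> y2 != y3 -> adj x y1 -> adj x y2 -> adj x y3 ->
  \sum_(y | adj x y) h y = h y1 + h y2 + h y3.
Proof.
move=> cG n12 n13 n23 a1 a2 a3.
have us : uniq [:: y1; y2; y3] by rewrite /= !inE negb_or n12 n13 n23.
have e : [set y in [:: y1; y2; y3]] = [set y | adj x y].
  apply/eqP; rewrite eqEcard (cG x) cardsE (card_uniqP us) andbT.
  by apply/fintype.subsetP => y; rewrite !inE => /or3P[] /eqP ->.
rewrite (eq_bigl (fun y => y \in [:: y1; y2; y3])).
  by rewrite -big_uniq //= !big_cons big_nil addn0 addnA.
by move=> y; have := congr1 (fun S : {set _} => y \in S) e; rewrite /= !inE => ->.
Qed.

Lemma cubic_nbrs G (x : 'I_(nverts G)) : cubic G -> exists y1 y2 y3,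
  (([/\ y1 != y2, y1 != y3 & y2 != y3]) * ([/\ adj x y1, adj x y2 & adj x y3]))%type.
Proof.
move=> cG; have := cG x; rewrite cardE.
have me y : (y \in enum [set y | adj x y]) = adj x y by rewrite mem_enum inE.
have := enum_uniq [set y | adj x y].
case e : (enum _) me => [|y1 [|y2 [|y3 [|]]]] //= me.
rewrite !inE negb_or andbT => /andP[/andP[n1 n2] n3] _.
by exists y1, y2, y3; split; split=> //; rewrite -me !inE eqxx ?orbT.
Qed.

Section PairBits.
Variables (G : graph) (w : seq bool).
Local Notation n := (nverts G).
Local Notation z := (pair_code (graph_code G) w).

Lemma edge_bitE (x y : 'I_n) : edge_bit z n x y = adj x y.
Proof.
have l : x * n + y < n * n.
  by apply: (@leq_trans (x.+1 * n)); rewrite ?leq_mul2r ?ltn_ord ?orbT // mulSn addnC ltn_add2r.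
rewrite /edge_bit nth_pair_code size_graph_code.
have -> : 2 * (n + 1 + (x * n + y)) + 1 < 2 * (n + 1 + n * n) by lia.
have -> : odd (2 * (n + 1 + (x * n + y)) + 1) by rewrite addn1 oddS mul2n odd_double.
have -> : (2 * (n + 1 + (x * n + y)) + 1)./2 = n + 1 + (x * n + y).
  by rewrite addn1 -uphalfE mul2n uphalf_double.
exact: nth_graph_code.
Qed.

Lemma size_bitE i : i <= n -> nth false z (2 * i + 1) = (i < n).
Proof.
move=> le; rewrite nth_pair_code size_graph_code.
have -> : 2 * i + 1 < 2 * (n + 1 + n * n) by lia.
have -> : odd (2 * i + 1) by rewrite addn1 oddS mul2n odd_double.
have -> : (2 * i + 1)./2 = i by rewrite addn1 -uphalfE mul2n uphalf_double.
exact: nth_graph_code_size.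
Qed.

Lemma flow_bitE i j v : flow_bit z n i j v = nth false w ((i * n + j) * (15 * n).+1 + v).
Proof.
rewrite /flow_bit nth_pair_code size_graph_code.
set k := (_ * _ + v); have -> : 2 * (n + 1 + n * n) + 1 + k < 2 * (n + 1 + n * n) = false by lia.
have -> : 2 * (n + 1 + n * n) < 2 * (n + 1 + n * n) + 1 + k by lia.
by congr (nth _ _ _); lia.
Qed.

Lemma verify_sound : cubic G -> verify z -> exists h, @certificate G h.
Proof.
move=> cG /hasP[n' _ /and4P[b1 b2 b3 b4]].
have en : n' = n.
  case: (ltngtP n' n) => // c.
    by move: b1; rewrite size_bitE ?c // ltnW.
  by have := all_iotaP b2 c; rewrite size_bitE // ltnn.
subst n'.
pose h (x y : 'I_n) := find (flow_bit z n x y) (iota 0 (15 * n).+1).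
have hP (x y : 'I_n) v : v < (15 * n).+1 -> flow_bit z n x y v -> h x y = v.
  move=> lv hv; have has_v : has (flow_bit z n x y) (iota 0 (15 * n).+1).
    by apply/hasP; exists v; rewrite // mem_iota.
  have hl : h x y < (15 * n).+1 by have := has_v; rewrite has_find size_iota.
  have := nth_find 0 has_v; rewrite -/(h x y) nth_iota // add0n => hh.
  have /andP[_ u] := all_iotaP (all_iotaP b4 (ltn_ord x)) (ltn_ord y).
  by have := all_iotaP (all_iotaP u hl) lv; rewrite hh hv => /eqP.
have io i k : i \in iota 0 k -> i < k by rewrite mem_iota.
exists h; split=> [x y a|x].
  have /andP[+ _] := all_iotaP (all_iotaP b4 (ltn_ord x)) (ltn_ord y).
  rewrite /arc_ok edge_bitE a implyTb => /hasP[v /io lv]; cbv beta.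
  move=> /hasP[v' /io lv'] /and5P[f1 f2 g1 g2 /eqP g3].
  by rewrite (hP _ _ _ lv f1) (hP _ _ _ lv' f2).
have := all_iotaP b3 (ltn_ord x); rewrite /vertex_ok.
move=> /hasP[y1 /io l1]; cbv beta; move=> /hasP[y2 /io l2]; cbv beta.
move=> /hasP[y3 /io l3]; cbv beta.
rewrite -[y1]/(val (Ordinal l1)) -[y2]/(val (Ordinal l2)) -[y3]/(val (Ordinal l3)).
move: (Ordinal l1) (Ordinal l2) (Ordinal l3) => o1 o2 o3; rewrite !edge_bitE.
move=> /and5P[n1 n2 n3 a1 /and3P[a2 a3]].
move=> /hasP[v1 /io lv1]; cbv beta; move=> /hasP[v2 /io lv2]; cbv beta.
move=> /hasP[v3 /io lv3] /and4P[f1 f2 f3 s].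
rewrite (cubic_sum (h x) cG n1 n2 n3 a1 a2 a3).
rewrite (hP _ _ _ lv1 f1) (hP _ _ _ lv2 f2) (hP _ _ _ lv3 f3).
by move/orP: s => [/eqP|/eqP]; [left|right].
Qed.
End PairBits.

Section Certificate.
Variables (G : graph) (h : 'I_(nverts G) -> 'I_(nverts G) -> nat).
Local Notation n := (nverts G).

Definition nat_fun i j : nat :=
  match insub i, insub j with Some a, Some b => h a b | _, _ => 0 end.
Lemma nat_funE (x y : 'I_n) : nat_fun x y = h x y.
Proof. by rewrite /nat_fun !(valK x) !(valK y). Qed.

Definition certificate_word : seq bool := mkseq (fun k =>
  nat_fun (k %/ (15 * n).+1 %/ n) (k %/ (15 * n).+1 %% n) == k %% (15 * n).+1)
  (n * n * (15 * n).+1).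

Lemma certificate_bit (x y : 'I_n) v : v < (15 * n).+1 ->
  flow_bit (pair_code (graph_code G) certificate_word) n x y v = (h x y == v).
Proof.
move=> lv; rewrite flow_bitE.
have l : x * n + y < n * n.
  by apply: (@leq_trans (x.+1 * n)); rewrite ?leq_mul2r ?ltn_ord ?orbT // mulSn addnC ltn_add2r.
rewrite nth_mkseq; last first.
  apply: (@leq_trans ((x * n + y).+1 * (15 * n).+1)); last by rewrite leq_mul2r l orbT.
  by rewrite [ltnRHS]mulSnr ltn_add2l.
by rewrite !(code_divmod _ lv) !(code_divmod _ (ltn_ord y)) nat_funE.
Qed.

Lemma verify_complete : cubic G -> certificate h ->
  verify (pair_code (graph_code G) certificate_word).
Proof.
move=> cG [c1 c2].
have io i k : i < k -> i \in iota 0 k by rewrite mem_iota.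
have hl x y : adj x y -> h x y < (15 * n).+1 by move=> /c1 [_ e]; rewrite ltnS -e leq_addr.
apply/hasP; exists n.
  by apply: io; rewrite size_pair_code size_graph_code; lia.
apply/and4P; split.
- by rewrite size_bitE // ltnn.
- by apply/allP => i; rewrite mem_iota add0n /= => li; rewrite size_bitE // ltnW.
- apply/allP => x; rewrite mem_iota add0n /= => lx; rewrite -[x]/(val (Ordinal lx)).
  move: (Ordinal lx) => {lx}x.
  have [y1 [y2 [y3 [[n1 n2 n3] [a1 a2 a3]]]]] := cubic_nbrs x cG.
  rewrite /vertex_ok; apply/hasP; exists (val y1); first exact: io (ltn_ord y1).
  apply/hasP; exists (val y2); first exact: io (ltn_ord y2).
  apply/hasP; exists (val y3); first exact: io (ltn_ord y3).
  rewrite !edge_bitE a1 a2 a3 !val_eqE n1 n2 n3 !andTb.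
  apply/hasP; exists (h x y1); first exact: io (hl _ _ a1).
  apply/hasP; exists (h x y2); first exact: io (hl _ _ a2).
  apply/hasP; exists (h x y3); first exact: io (hl _ _ a3).
  rewrite !certificate_bit ?hl // !eqxx /=.
  by rewrite -(cubic_sum (h x) cG n1 n2 n3 a1 a2 a3); case: (c2 x) => ->; rewrite eqxx ?orbT.
apply/allP => x; rewrite mem_iota add0n /= => lx; apply/allP => y; rewrite mem_iota add0n /= => ly.
rewrite -[x]/(val (Ordinal lx)) -[y]/(val (Ordinal ly)).
move: (Ordinal lx) (Ordinal ly) => {lx ly}x {}y; apply/andP; split.
  rewrite /arc_ok edge_bitE; apply/implyP => a; have a' := a; rewrite adj_sym in a'.
  apply/hasP; exists (h x y); first exact: io (hl _ _ a).
  apply/hasP; exists (h y x); first exact: io (hl _ _ a').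
  rewrite !certificate_bit ?hl // !eqxx /=.
  by have [-> ->] := c1 _ _ a; have [-> _] := c1 _ _ a'; rewrite eqxx.
have io' i k : i \in iota 0 k -> i < k by rewrite mem_iota.
apply/allP => v /io' lv; apply/allP => v' /io' lv'.
by rewrite !certificate_bit //; apply/implyP => /andP[/eqP <- /eqP <-].
Qed.
End Certificate.

Section FlowCertificate.
Variables (R : realType) (G : graph).
Local Notation n := (nverts G).
Hypothesis cG : cubic G.
Local Open Scope ring_scope.

Lemma card_arcs : #|[pred p : 'I_n * 'I_n | adj p.1 p.2]| = (3 * n)%N.
Proof.
rewrite -sum1_card -(pair_big_dep predT (fun x y : 'I_n => adj x y) (fun _ _ => 1%N)) /=.
rewrite (eq_bigr (fun=> 3%N)); last first.
  by move=> x _; rewrite -(cG x) -sum1_card; apply: eq_bigl => y; rewrite inE.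
by rewrite sum_nat_const card_ord mulnC.
Qed.

Lemma certificate_flow (h : 'I_n -> 'I_n -> nat) : certificate h ->
  (circular_flow_number R G < 5%:E)%E.
Proof.
move=> [c1 c2]; apply/flow_number_lt; first by lra.
exists (fun x y => (h x y)%:R / (3 * n)%:R).
have n0 (x : 'I_n) : (0 : R) < (3 * n)%:R.
  by rewrite ltr0n muln_gt0 /=; exact: leq_ltn_trans (leq0n x) (ltn_ord x).
have e5 : (15 * n)%:R = 5 * (3 * n)%:R :> R by rewrite -natrM; congr (_%:R); lia.
have e10 : (30 * n)%:R = 10 * (3 * n)%:R :> R by rewrite -natrM; congr (_%:R); lia.
split=> [x y a|x y a|x].
- have [_ e] := c1 _ _ a.
  by rewrite -mulrDl -natrD e e5 mulfK // lt0r_neq0 // (n0 x).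
- by have := n0 x; have [e _] := c1 _ _ a => p; rewrite ltr_pdivlMr // mul1r ltr_nat.
have p := n0 x; rewrite /vsum -mulr_suml -natr_sum.
case: (c2 x) => ->; [exists 1%N|exists 2%N].
  by rewrite e5 mulfK ?mulr1 // lt0r_neq0.
by rewrite e10 mulfK ?lt0r_neq0 // -natrM.
Qed.

(* Each arc is made strictly larger than 1 by one of the roundings of the flow;
   their sum over all arcs is a flow modulo 15n with values above 3n. *)
Lemma flow_certificate : (circular_flow_number R G < 5%:E)%E -> exists h, @certificate G h.
Proof.
move=> /flow_number_lt [|f [f1 f2 f3]]; first by lra.
have rnd (p : 'I_n * 'I_n) : exists g : 'I_n -> 'I_n -> int, adj p.1 p.2 ->
    [/\ forall x y, adj x y -> g x y + g y x = 5,
    forall x, (\sum_(y | adj x y) g x y)%:~R = vsum f x,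
    forall x y, adj x y -> 1 <= g x y & f p.1 p.2 <= (g p.1 p.2)%:~R].
  case a : (adj p.1 p.2); last by exists (fun _ _ => 0).
  have [|||g hg] := @rounding R G f 5 1 p.1 p.2 _ _ _ a; last by exists g.
  - by move=> x y /f1 ->.
  - by move=> x; have [k ->] := f3 x; apply: rpredM; apply: rpred_nat.
  - by move=> x y /f2 h; apply: ltW.
have [g gP] := boolp.choice rnd.
pose h x y : int := \sum_(p : 'I_n * 'I_n | adj p.1 p.2) g p x y.
have cst (c : int) : \sum_(p : 'I_n * 'I_n | adj p.1 p.2) c = c * (3 * n)%:R.
  by rewrite sumr_const card_arcs mulr_natr.
have h1 x y : adj x y -> h x y + h y x = 5 * (3 * n)%:R.
  move=> a; rewrite -cst -big_split /=; apply: eq_bigr => p ap.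
  by have [e _ _ _] := gP p ap; apply: e.
have h2 x y : adj x y -> (3 * n)%:R + 1 <= h x y.
  move=> a; rewrite -lerBrDl -[(3 * n)%:R]mul1r -cst -sumrB (bigD1 (x, y)) //=.
  have [_ _ _ e] := gP (x, y) a; have e2 := lt_le_trans (f2 _ _ a) e.
  have e3 : 1 < g (x, y) x y by move: e2; rewrite -[1 in X in X -> _]/(1%:~R) ltr_int.
  have : 0 <= \sum_(p | adj p.1 p.2 && (p != (x, y))) (g p x y - 1).
    apply: sumr_ge0 => p /andP[ap _]; have [_ _ l _] := gP p ap.
    by rewrite subr_ge0; apply: l.
  by move: e3; set u := g _ _ _; set t := \sum_(_ | _) _; lia.
have h3 x : exists k : nat, \sum_(y | adj x y) h x y = (3 * n)%:R * (5 * k%:R).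
  have [k e] := f3 x; exists k; rewrite exchange_big /= mulrC -cst; apply: eq_bigr => p ap.
  have [_ s _ _] := gP p ap; apply: (@intr_inj R); rewrite s e.
  by rewrite intrM (natz k) -pmulrn.
exists (fun x y => `|h x y|%N).
have hn x y : adj x y -> (`|h x y|%N)%:Z = h x y.
  by move=> /h2 l; rewrite gez0_abs //; lia.
split=> [x y a|x].
  have a' := a; rewrite adj_sym in a'.
  have := hn _ _ a; have := hn _ _ a'; have := h2 _ _ a; have := h1 _ _ a.
  by move: (h x y) (h y x) => u v; lia.
have [y1 [y2 [y3 [[n1 n2 n3] [a1 a2 a3]]]]] := cubic_nbrs x cG.
rewrite (cubic_sum _ cG n1 n2 n3 a1 a2 a3).
have [k e] := h3 x.
have e' : \sum_(y | adj x y) `|h x y|%N = (3 * n * (5 * k))%N.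
  apply/eqP; rewrite -eqz_nat; apply/eqP.
  rewrite -[LHS]/((\sum_(y | adj x y) `|h x y|%N)%:Z) -natz natr_sum.
  rewrite (eq_bigr (h x)) ?e; first by lia.
  by move=> y a; rewrite natz hn.
rewrite (cubic_sum _ cG n1 n2 n3 a1 a2 a3) in e'; rewrite e'.
have b y : adj x y -> (3 * n < `|h x y| < 12 * n)%N.
  move=> a; have a' := a; rewrite adj_sym in a'.
  have := hn _ _ a; have := h2 _ _ a; have := h2 _ _ a'; have := h1 _ _ a.
  by move: (h x y) (h y x) => u v; lia.
have := b _ a1; have := b _ a2; have := b _ a3; move: e'.
move: `|h x y1|%N `|h x y2|%N `|h x y3|%N => u1 u2 u3 e' b3 b2 b1.
have : (k = 1 \/ k = 2)%N by nia.
by case=> ->; [left|right]; lia.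
Qed.
End FlowCertificate.

Lemma snark_flow_in_NP (R : realType) : in_NP (snark_flow_lt5 R).
Proof.
(* The certificate has [n * n * (15 * n + 1)] bits, against a code of length [s = n * n + n + 1];
   [16 * s ^ 3] is more than enough. *)
pose q : {poly nat} := Poly [:: 0; 0; 0; 16].
have qE s : (q.[s])%R = 16 * s * s * s by rewrite /q horner_Poly /= ?natrDE ?natrME; nia.
exists (fun z => [:: verify z]), q; split.
  exact: polytime_pred ffm_verify.
move=> [G [cG c4 gG fG]] /=; split=> [lt|[w [_ [v]]]]; last first.
  by have [h ch] := verify_sound cG v; apply: certificate_flow ch.
have [h ch] := flow_certificate cG lt.
exists (certificate_word h); split; last by rewrite verify_complete.
rewrite size_mkseq qE size_graph_code; move: (nverts G) => k; set s := k + 1 + k * k.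
have s0 : 0 < s by rewrite /s addn1.
apply: leq_trans (leq_pmulr _ s0); apply: (@leq_trans (s * (16 * s))).
  by apply: leq_mul; rewrite /s; lia.
by rewrite mulnCA mulnA.
Qed.

Local Open Scope ring_scope.

(** * What a block transmits *)

Definition inner_nbr (i : nat) : seq nat := nth [::]
  [:: [:: 1; 4]; [:: 2; 5; 0]; [:: 3; 6; 1]; [:: 7; 2]; [:: 7; 6; 0]; [:: 7; 1];
      [:: 2; 4]; [:: 3; 5; 4]]%N i.
Definition block_end (i : nat) := i \in [:: 0; 3; 5; 6]%N.
Definition outer_nbr o i := last 0%N (nth [::] nbrs (o + i)).
Definition block_bases : seq nat :=
  [seq (30 * j + 8 * q)%N | j <- iota 0 4, q <- iota 0 3].

Lemma block_table : all (fun o => all (fun i => ((o + i) < K)%N && (nth [::] nbrs (o + i) ==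
  [seq (o + y)%N | y <- inner_nbr i] ++
    (if block_end i then [:: outer_nbr o i] else [::]))
  && ~~ ext (o + i)%N) (iota 0 8)) block_bases.
Proof. by vm_compute. Qed.

Definition set_deg (d X : seq bool) :=
  (\sum_(i <- iota 0 8) (if nth false X i then 1 + nth false d i else 0))%N.
Definition set_inner (X : seq bool) :=
  count (fun e => nth false X e.1 && nth false X e.2) block_edges.
Definition set_cut (X : seq bool) :=
  count (fun e => nth false X e.1 (+) nth false X e.2) block_edges.
Definition set_u (X : seq bool) := (nth false X 0 + nth false X 3)%N.
Definition set_v (X : seq bool) := (nth false X 5 + nth false X 6)%N.

(* The arguments are the degree, inner edges, cut edges, u ends and v ends of
   a set of block vertices. *)
Definition viol5 D e c u v := ((0 < c + u + v) &&
  ((5 * D <= 5 * e + (c + u + v)) || (5 * e + 4 * (c + u + v) <= 5 * D)))%N.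
Definition upper5 D e c u v := (5 * D + 4 * (2 - u) <= 6 + 5 * e + (c + v))%N.
Definition lower5 D e c u v := (4 + 5 * e + 4 * (c + v) <= 5 * D + (2 - u))%N.
(** For [r = 4 + ep] the extra unit absorbs all terms in [ep]. The bounds [upper4] and [lower4] have
    no such unit; there the error goes into the interval of [block4]. *)
Definition viol4 D e c u v :=
  ((4 * D + 1 <= 4 * e + (c + u + v)) || (4 * e + 3 * (c + u + v) + 1 <= 4 * D))%N.
Definition upper4 D e c u v := (4 * D + 3 * (2 - u) <= 4 + 4 * e + (c + v))%N.
Definition lower4 D e c u v := (4 + 4 * e + 3 * (c + v) <= 4 * D + (2 - u))%N.

Definition on_set (Q : nat -> nat -> nat -> nat -> nat -> bool) d X :=
  Q (set_deg d X) (set_inner X) (set_cut X) (set_u X) (set_v X).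

(** As in Hoffman's circulation theorem, every vertex set gives a necessary condition on the flow.
    For each of the 256 ways to choose the vertex sums among [r] and [2 r], either one set refutes
    the choice, or two sets bound the total at the [u] ends from above and below. *)
Definition block_check viol upper lower := all (fun d =>
  has (on_set viol d) (words 8) ||
  (has (on_set upper d) (words 8) && has (on_set lower d) (words 8))) (words 8).

Lemma block_check5 : block_check viol5 upper5 lower5.
Proof. by rewrite /block_check /on_set /set_deg unlock; vm_compute. Qed.
Lemma block_check4 : block_check viol4 upper4 lower4.
Proof. by rewrite /block_check /on_set /set_deg unlock; vm_compute. Qed.

Lemma set_small d X : [/\ set_deg d X <= 16, set_inner X <= 10 & set_cut X <= 10]%N.
Proof.
split; [|exact: (count_size _ block_edges)|exact: (count_size _ block_edges)].
apply: (@leq_trans (\sum_(i <- iota 0 8) 2)); last by rewrite unlock.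
by apply: leq_sum => i _; case: ifP => //; case: (nth _ d _).
Qed.

Section CellFlow.
Variables (R : realType) (r dl : R) (F : nat -> nat -> R) (E : nat -> R)
  (d : nat -> nat).
Hypothesis dl0 : 0 < dl.
Hypothesis hF2 : forall l y, (l < K)%N -> y \in nbr l -> F l y + F y l = r.
Hypothesis hF1 : forall l y, (l < K)%N -> y \in nbr l -> 1 + dl <= F l y.
Hypothesis hE : forall l, ext l -> 1 + dl <= E l <= r - 1 - dl.
Hypothesis hv : forall l, (l < K)%N ->
  \sum_(y <- nbr l) F l y + (if ext l then E l else 0) = r * (d l)%:R.

Lemma F_bounds l y : (l < K)%N -> y \in nbr l -> 1 + dl <= F l y <= r - 1 - dl.
Proof.
move=> lt yl; rewrite hF1 //=.
have := hF2 lt yl; have := @hF1 y l (nbr_lt lt yl); rewrite nbr_sym => /(_ yl); lra.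
Qed.

Lemma sum_bounds (s : seq nat) (f : nat -> R) (a b : R) :
  (forall y, y \in s -> a <= f y <= b) ->
  a * (size s)%:R <= \sum_(y <- s) f y <= b * (size s)%:R.
Proof.
elim: s => [|y s IH] h; first by rewrite big_nil !mulr0 lexx.
rewrite big_cons /= -natr1 !mulrDr !mulr1.
have /andP[h1 h2] := IH (fun z zs => h z (mem_behead (s := y :: s) zs)).
by have /andP[h3 h4] := h y (mem_head _ _); lra.
Qed.

(** Three values strictly between 1 and [r - 1] have a sum strictly between 0 and [3 r]. *)
Lemma deg12 l : (l < K)%N -> d l = 1%N \/ d l = 2%N.
Proof.
move=> lt; have [_ sz _ _] := nbr_facts lt.
have B := sum_bounds (fun y h => F_bounds lt h).
have e := hv lt.
have B3 : (1 + dl) * 3 <= r * (d l)%:R <= (r - 1 - dl) * 3.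
  rewrite -e; move: sz B; case x : (ext l).
    by move=> sz B'; rewrite addn1 in sz; case: sz B' => ->; have := hE x; lra.
  by move=> sz B'; rewrite addn0 in sz; rewrite sz in B'; lra.
clear sz B e; case: (d l) B3 => [|[|[|n]]] B3; [|by left|by right|].
  by exfalso; move: B3; rewrite mulr0n mulr0 => /andP[h1 h2]; move: dl0; lra.
exfalso; move: dl0 => dl0'; have h : (0 : R) <= n%:R by apply: ler0n.
by rewrite -!natr1 in B3; nra.
Qed.

Section Block.
Variables (o : nat).
Hypothesis ob : o \in block_bases.

Let u i := F (o + i)%N (outer_nbr o i).
Let G i y := F (o + i)%N (o + y)%N.

Lemma block_nbr i : (i < 8)%N -> [/\ (o + i < K)%N, ext (o + i) = false &
  nbr (o + i) = [seq (o + y)%N | y <- inner_nbr i] ++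
    (if block_end i then [:: outer_nbr o i] else [::])].
Proof.
move=> lt; have := all_iotaP (allP block_table _ ob) lt.
by move=> /andP[/andP[h1 /eqP h2] /negbTE h3]; split; [| |rewrite nbrE].
Qed.

Lemma block_eq i : (i < 8)%N -> \sum_(y <- inner_nbr i) G i y +
  (if block_end i then u i else 0) = r * (d (o + i))%:R.
Proof.
move=> lt; have [lK ex en] := block_nbr lt.
rewrite -(hv lK) ex addr0 en big_cat big_map /=; congr (_ + _).
by case: ifP => _; rewrite ?big_seq1 ?big_nil.
Qed.

Lemma u_bounds i : (i < 8)%N -> block_end i -> 1 + dl <= u i <= r - 1 - dl.
Proof.
move=> lt bi; have [lK _ en] := block_nbr lt; apply: F_bounds => //.
by rewrite en bi mem_cat mem_head orbT.
Qed.

Lemma G_inner i y : (i < 8)%N -> y \in inner_nbr i ->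
  1 + dl <= G i y <= r - 1 - dl /\ G y i = r - G i y.
Proof.
move=> lt yi; have [lK _ en] := block_nbr lt.
have yn : (o + y)%N \in nbr (o + i) by rewrite en mem_cat map_f.
by split; [apply: F_bounds|rewrite -(hF2 lK yn) /G; ring].
Qed.

Definition Su := u 0 + u 3.
Definition Sv := u 5 + u 6.

(** In the sum of the eight vertex equations each of the ten inner edges contributes [r]. *)
Lemma block_total : exists k : nat, Su + Sv = r * k%:R - r * 10.
Proof.
exists (\sum_(i <- iota 0 8) d (o + i))%N; rewrite /Su /Sv unlock /= !natrD.
rewrite !(mulrDr r (d _)%:R) -!block_eq //= !big_cons !big_nil.
rewrite (G_inner (i := 0%N) (y := 1%N) _ _).2 // (G_inner (i := 1%N) (y := 2%N) _ _).2 //.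
rewrite (G_inner (i := 2%N) (y := 3%N) _ _).2 // (G_inner (i := 0%N) (y := 4%N) _ _).2 //.
rewrite (G_inner (i := 1%N) (y := 5%N) _ _).2 // (G_inner (i := 2%N) (y := 6%N) _ _).2 //.
rewrite (G_inner (i := 3%N) (y := 7%N) _ _).2 // (G_inner (i := 5%N) (y := 7%N) _ _).2 //.
rewrite (G_inner (i := 4%N) (y := 7%N) _ _).2 // (G_inner (i := 4%N) (y := 6%N) _ _).2 //.
by rewrite /block_end /=; ring.
Qed.

Definition dbits := [seq d (o + i) == 2 | i <- iota 0 8].

(* Summing the vertex equations over a set: an inner edge contributes r, and a
   cut edge or a dangling end its own value. *)
Lemma block_set X : exists B Bu Bv : R,
  let D := (set_deg dbits X)%:R in let e := (set_inner X)%:R in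
  let c := (set_cut X)%:R in let cu := (set_u X)%:R in let cv := (set_v X)%:R in
  [/\ r * D = r * e + B + Bu + Bv,
    (1 + dl) * c <= B <= (r - 1 - dl) * c,
    (1 + dl) * cv <= Bv <= (r - 1 - dl) * cv,
    (1 + dl) * cu <= Bu <= (r - 1 - dl) * cu &
    (1 + dl) * (2 - cu) <= Su - Bu <= (r - 1 - dl) * (2 - cu)].
Proof.
pose x i : R := (nth false X i)%:R.
pose T (e : nat * nat) := x e.1 * G e.1 e.2 + x e.2 * (r - G e.1 e.2).
pose b2 (e : nat * nat) := nth false X e.1 && nth false X e.2.
pose b1 (e : nat * nat) := nth false X e.1 (+) nth false X e.2.
exists (\sum_(e <- block_edges) (T e - r * (b2 e)%:R)), (x 0 * u 0 + x 3 * u 3),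
  (x 5 * u 5 + x 6 * u 6) => /=.
have ub0 := @u_bounds 0 isT isT; have ub3 := @u_bounds 3 isT isT.
have ub5 := @u_bounds 5 isT isT; have ub6 := @u_bounds 6 isT isT.
have sumc (p : nat * nat -> bool) (s : seq (nat * nat)) :
    \sum_(e <- s) ((p e)%:R : R) = (count p s)%:R.
  by elim: s => [|e s IH]; rewrite ?big_nil // big_cons IH /= natrD.
split.
- rewrite sumrB -mulr_sumr sumc -/(set_inner X).
  have -> : r * (set_deg dbits X)%:R = \sum_(i <- iota 0 8) x i * (r * (d (o + i))%:R).
    rewrite /set_deg natr_sum mulr_sumr big_seq [RHS]big_seq; apply: eq_bigr => i.
    rewrite mem_iota add0n /= => lt; rewrite /x.
    case: (nth false X i); last by rewrite mulr0 mul0r.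
    rewrite mul1r /dbits (nth_map 0%N) ?size_iota // nth_iota // add0n.
    have [lK _ _] := block_nbr lt.
    by case: (deg12 lK) => ->.
  rewrite unlock /= addr0 -!block_eq //= !big_cons !big_nil /T /=.
  rewrite (G_inner (i := 0%N) (y := 1%N) _ _).2 // (G_inner (i := 1%N) (y := 2%N) _ _).2 //.
  rewrite (G_inner (i := 2%N) (y := 3%N) _ _).2 // (G_inner (i := 0%N) (y := 4%N) _ _).2 //.
  rewrite (G_inner (i := 1%N) (y := 5%N) _ _).2 // (G_inner (i := 2%N) (y := 6%N) _ _).2 //.
  rewrite (G_inner (i := 3%N) (y := 7%N) _ _).2 // (G_inner (i := 5%N) (y := 7%N) _ _).2 //.
  rewrite (G_inner (i := 4%N) (y := 7%N) _ _).2 // (G_inner (i := 4%N) (y := 6%N) _ _).2 //.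
  by rewrite /block_end /=; ring.
- rewrite -[(set_cut X)%:R]sumc !mulr_sumr; apply/andP; split;
  rewrite big_seq [X in _ <= X]big_seq; apply: ler_sum => -[i y] he.
  + have [lt yi] : (i < 8)%N /\ y \in inner_nbr i.
      apply/andP; move: he; apply: (allP (_ : all (fun e : nat * nat =>
        (e.1 < 8)%N && (e.2 \in inner_nbr e.1)) block_edges)); by vm_compute.
    have [/andP[g1 g2] _] := G_inner lt yi; rewrite /T /b2 /x /=.
    by case: (nth false X i); case: (nth false X y) => /=; lra.
  + have [lt yi] : (i < 8)%N /\ y \in inner_nbr i.
      apply/andP; move: he; apply: (allP (_ : all (fun e : nat * nat =>
        (e.1 < 8)%N && (e.2 \in inner_nbr e.1)) block_edges)); by vm_compute.
    have [/andP[g1 g2] _] := G_inner lt yi; rewrite /T /b2 /x /=.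
    by case: (nth false X i); case: (nth false X y) => /=; lra.
- by rewrite /set_v /x; case: (nth false X 5); case: (nth false X 6) => /=; lra.
- by rewrite /set_u /x; case: (nth false X 0); case: (nth false X 3) => /=; lra.
- by rewrite /set_u /Su /x; case: (nth false X 0); case: (nth false X 3) => /=; lra.
Qed.

Lemma set_u2 X : (set_u X <= 2)%N.
Proof. by rewrite /set_u; case: (nth _ _ _); case: (nth _ _ _). Qed.
Lemma set_v2 X : (set_v X <= 2)%N.
Proof. by rewrite /set_v; case: (nth _ _ _); case: (nth _ _ _). Qed.

Lemma dbits_word : dbits \in words 8.
Proof. by apply: mem_words; rewrite size_map size_iota. Qed.

Lemma natle (a b : nat) : (a <= b)%N -> (a%:R : R) <= b%:R.
Proof. by rewrite ler_nat. Qed.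

Lemma dlM x : 0 <= x -> 0 <= dl * x.
Proof. by move=> h; rewrite mulr_ge0 // ltW. Qed.

(** The total at the [u] ends is 5 up to an error of 1: modulo 5 a block transmits at most 1 in
    absolute value. The conditions of [viol5] include equality, which the positive margin [dl] turns
    into a contradiction. *)
Lemma block5 : r = 5 -> 4 <= Su <= 6.
Proof.
move=> r5; have := allP block_check5 _ dbits_word.
case/orP => [/hasP[X _ /andP[c0 vi]]|/andP[/hasP[X _ up] /hasP[Y _ lw]]].
  exfalso; have [B [Bu [Bv /= [e1 e2 e3 e4 _]]]] := block_set X.
  move: e1 e2 e3 e4 c0 vi; rewrite r5.
  move: (set_deg _ _) (set_inner _) (set_cut _) (set_u _) (set_v _) => D e c u' v'.
  move=> e1 e2 e3 e4 /natle; rewrite !natrD => c0.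
  have h : 0 < dl * (c%:R + u'%:R + v'%:R) by apply: mulr_gt0 => //; lra.
  by case/orP => /natle; rewrite !(natrD, natrM); lra.
apply/andP; split.
  have [B [Bu [Bv /= [e1 e2 e3 _ e5]]]] := block_set Y.
  move: lw e1 e2 e3 e5 (set_u2 Y); rewrite /on_set /lower5 r5.
  move: (set_deg _ _) (set_inner _) (set_cut _) (set_u _) (set_v _) => D e c u' v'.
  move=> /natle + e1 e2 e3 e5 u2; rewrite !(natrD, natrM) (natrB _ u2).
  have h1 := dlM (ler0n R c); have h2 := dlM (ler0n R v').
  have h3 : 0 <= dl * (2 - u'%:R) by apply: dlM; rewrite subr_ge0 ler_nat.
  by lra.
have [B [Bu [Bv /= [e1 e2 e3 _ e5]]]] := block_set X.
move: up e1 e2 e3 e5 (set_u2 X); rewrite /on_set /upper5 r5.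
move: (set_deg _ _) (set_inner _) (set_cut _) (set_u _) (set_v _) => D e c u' v'.
move=> /natle + e1 e2 e3 e5 u2; rewrite !(natrD, natrM) (natrB _ u2).
have h1 := dlM (ler0n R c); have h2 := dlM (ler0n R v').
have h3 : 0 <= dl * (2 - u'%:R) by apply: dlM; rewrite subr_ge0 ler_nat.
by lra.
Qed.

(** With [ep = 0] the sets would force the total 4. The coefficients of [ep] are controlled by
    [set_small], and 1/1000 is small enough to keep the accumulated error below 1/10. *)
Lemma block4 ep : 1000 * ep = 1 -> r = 4 + ep -> 39 <= 10 * Su <= 41.
Proof.
move=> epE r4; have := allP block_check4 _ dbits_word.
have ep0 : 0 < ep by lra.
have epM (x : R) : 0 <= x -> 0 <= ep * x by move=> h; rewrite mulr_ge0 // ltW.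
have epB (n k : nat) : (n <= k)%N -> 0 <= ep * n%:R <= ep * k%:R.
  by move=> le; rewrite epM ?ler0n //= ler_pM2l // ler_nat.
case/orP => [/hasP[X _ vi]|/andP[/hasP[X _ up] /hasP[Y _ lw]]].
  exfalso; have [B [Bu [Bv /= [e1 e2 e3 e4 _]]]] := block_set X.
  have [/epB s1 /epB s2 /epB s3] := set_small dbits X.
  have s4 := epB _ _ (set_u2 X); have s5 := epB _ _ (set_v2 X).
  move: e1 e2 e3 e4 vi s1 s2 s3 s4 s5; rewrite /on_set /viol4 r4.
  move: (set_deg _ _) (set_inner _) (set_cut _) (set_u _) (set_v _) => D e c u' v'.
  move=> e1 e2 e3 e4 vi s1 s2 s3 s4 s5.
  have h1 := dlM (ler0n R c); have h2 := dlM (ler0n R v').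
  have h3 := dlM (ler0n R u').
  by move/orP: vi => [] /natle; rewrite !(natrD, natrM); lra.
apply/andP; split.
  have [B [Bu [Bv /= [e1 e2 e3 _ e5]]]] := block_set Y.
  have [/epB s1 /epB s2 /epB s3] := set_small dbits Y.
  have s4 := epB _ _ (set_u2 Y); have s5 := epB _ _ (set_v2 Y).
  move: lw e1 e2 e3 e5 s1 s2 s3 s4 s5 (set_u2 Y); rewrite /on_set /lower4 r4.
  move: (set_deg _ _) (set_inner _) (set_cut _) (set_u _) (set_v _) => D e c u' v'.
  move=> /natle + e1 e2 e3 e5 s1 s2 s3 s4 s5 u2.
  rewrite !(natrD, natrM) (natrB _ u2).
  have h1 := dlM (ler0n R c); have h2 := dlM (ler0n R v').
  have h3 : 0 <= dl * (2 - u'%:R) by apply: dlM; rewrite subr_ge0 ler_nat.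
  by lra.
have [B [Bu [Bv /= [e1 e2 e3 _ e5]]]] := block_set X.
have [/epB s1 /epB s2 /epB s3] := set_small dbits X.
have s4 := epB _ _ (set_u2 X); have s5 := epB _ _ (set_v2 X).
move: up e1 e2 e3 e5 s1 s2 s3 s4 s5 (set_u2 X); rewrite /on_set /upper4 r4.
move: (set_deg _ _) (set_inner _) (set_cut _) (set_u _) (set_v _) => D e c u' v'.
move=> /natle + e1 e2 e3 e5 s1 s2 s3 s4 s5 u2.
rewrite !(natrD, natrM) (natrB _ u2).
have h1 := dlM (ler0n R c); have h2 := dlM (ler0n R v').
have h3 : 0 <= dl * (2 - u'%:R) by apply: dlM; rewrite subr_ge0 ler_nat.
by lra.
Qed.
End Block.

(** * The logic of a cell *)

Definition path_nbrs : seq (nat * seq nat) := [:: (24, [:: 25; 26]); (25, [:: 0; 8; 24]);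
  (26, [:: 3; 11; 24]); (27, [:: 28; 29]); (28, [:: 5; 16; 27]); (29, [:: 6; 19; 27])]%N.

Lemma path_table : all (fun j => all (fun p : nat * seq nat =>
    ((30 * j + p.1) < K)%N && (nth [::] nbrs (30 * j + p.1) == [seq (30 * j + y)%N | y <- p.2])
    && (ext (30 * j + p.1) == (p.1 == 24) || (p.1 == 27))%N)
  path_nbrs && [&& outer_nbr (30 * j) 0 == 30 * j + 25, outer_nbr (30 * j) 3 == 30 * j + 26,
    outer_nbr (30 * j) 5 == 30 * j + 28, outer_nbr (30 * j) 6 == 30 * j + 29,
    outer_nbr (30 * j + 8) 0 == 30 * j + 25, outer_nbr (30 * j + 8) 3 == 30 * j + 26,
    outer_nbr (30 * j + 16) 0 == 30 * j + 28 & outer_nbr (30 * j + 16) 3 == 30 * j + 29]%N)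
  (iota 0 4).
Proof. by vm_compute. Qed.

Lemma gather_table : ([seq nth [::] nbrs l | l <- iota 120 6] == [:: [:: 121; 13; 43];
  [:: 122; 73; 120]; [:: 123; 103; 121]; [:: 124; 14; 122]; [:: 125; 44; 123];
  [:: 74; 104; 124]]) && [&& outer_nbr 8 5 == 120, outer_nbr 8 6 == 123,
  outer_nbr 38 5 == 120, outer_nbr 38 6 == 124, outer_nbr 68 5 == 121,
  outer_nbr 68 6 == 125, outer_nbr 98 5 == 122 & outer_nbr 98 6 == 125]
  && all (fun l => ~~ ext l) (iota 120 6).
Proof. by vm_compute. Qed.

Lemma path_eq j l s : (j < 4)%N -> (l, s) \in path_nbrs ->
  \sum_(y <- s) F (30 * j + l)%N (30 * j + y)%N +
    (if (l == 24) || (l == 27) then E (30 * j + l)%N else 0) = r * (d (30 * j + l))%:R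
  /\ forall y, y \in s -> F (30 * j + l)%N (30 * j + y)%N = r - F (30 * j + y)%N (30 * j + l)%N.
Proof.
move=> lj ls; have /andP[/allP h _] := all_iotaP path_table lj.
have /= /andP[/andP[lK /eqP en] ex] := h _ ls.
have en' : nbr (30 * j + l) = [seq (30 * j + y)%N | y <- s] by rewrite nbrE.
split; first by rewrite -(hv lK) en' big_map (eqP ex).
by move=> y ys; rewrite -(@hF2 (30 * j + l)%N (30 * j + y)%N) ?en' ?map_f //; ring.
Qed.

(** Modulo [r] the input port carries the sum of what two blocks receive at their [u] ends. The
    number 6 counts the two path edges and the four edges to the blocks. *)
Lemma path_in j : (j < 4)%N -> exists k : nat,
  E (30 * j + 24)%N = r * k%:R - 6 * r + Su (30 * j) + Su (30 * j + 8).
Proof.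
move=> lj; exists (d (30 * j + 24) + d (30 * j + 25) + d (30 * j + 26))%N.
have [e1 _] := @path_eq j 24%N [:: 25; 26]%N lj isT.
have [e2 f2] := @path_eq j 25%N [:: 0; 8; 24]%N lj isT.
have [e3 f3] := @path_eq j 26%N [:: 3; 11; 24]%N lj isT.
have /andP[_] := all_iotaP path_table lj.
move=> /and5P[/eqP o1 /eqP o2 _ _ /and4P[/eqP o3 /eqP o4 _ _]].
rewrite !big_cons !big_nil /= in e1 e2 e3.
have g1 := f2 0%N isT; have g2 := f2 8%N isT; have g3 := f2 24%N isT.
have g4 := f3 3%N isT; have g5 := f3 11%N isT; have g6 := f3 24%N isT.
have a1 : (30 * j + 8 + 3 = 30 * j + 11)%N by rewrite -addnA.
have a2 : (30 * j + 8 + 0 = 30 * j + 8)%N by rewrite addn0.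
rewrite /Su o1 o2 o3 o4 a1 a2 !natrD; lra.
Qed.

(** The output port sees the first block from its [v] side, which modulo 5 is the negative of the
    [u] side. This is why it carries the opposite bit. *)
Lemma path_out j : (j < 4)%N -> exists k : nat,
  E (30 * j + 27)%N = r * k%:R - 6 * r + Sv (30 * j) + Su (30 * j + 16).
Proof.
move=> lj; exists (d (30 * j + 27) + d (30 * j + 28) + d (30 * j + 29))%N.
have [e1 _] := @path_eq j 27%N [:: 28; 29]%N lj isT.
have [e2 f2] := @path_eq j 28%N [:: 5; 16; 27]%N lj isT.
have [e3 f3] := @path_eq j 29%N [:: 6; 19; 27]%N lj isT.
have /andP[_] := all_iotaP path_table lj.
move=> /and5P[_ _ /eqP o1 /eqP o2 /and4P[_ _ /eqP o3 /eqP o4]].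
rewrite !big_cons !big_nil /= in e1 e2 e3.
have g1 := f2 5%N isT; have g2 := f2 16%N isT; have g3 := f2 27%N isT.
have g4 := f3 6%N isT; have g5 := f3 19%N isT; have g6 := f3 27%N isT.
have a1 : (30 * j + 16 + 3 = 30 * j + 19)%N by rewrite -addnA.
have a2 : (30 * j + 16 + 0 = 30 * j + 16)%N by rewrite addn0.
rewrite /Su /Sv o1 o2 o3 o4 a1 a2 !natrD; lra.
Qed.

(** The five path edges and the eight edges to the second blocks contribute [r] each, hence 13. *)
Lemma gather : exists k : nat, Sv 8 + Sv 38 + Sv 68 + Sv 98 = 13 * r - r * k%:R.
Proof.
exists (d 120 + d 121 + d 122 + d 123 + d 124 + d 125)%N.
have /andP[/andP[/eqP T o] X] := gather_table.
have N i : (i < 6)%N -> nbr (120 + i) = nth [::] [:: [:: 121; 13; 43];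
  [:: 122; 73; 120]; [:: 123; 103; 121]; [:: 124; 14; 122]; [:: 125; 44; 123];
  [:: 74; 104; 124]]%N i.
  move=> li; rewrite -T (nth_map 0%N) ?size_iota // nth_iota // nbrE //.
  by rewrite /K; lia.
have Q i : (i < 6)%N -> \sum_(y <- nbr (120 + i)) F (120 + i)%N y = r * (d (120 + i))%:R.
  move=> li; rewrite -hv; last by rewrite /K; lia.
  have /negbTE -> : ~~ ext (120 + i) by apply: (allP X); rewrite mem_iota; lia.
  by rewrite addr0.
have S i y : (i < 6)%N -> y \in nbr (120 + i) -> F (120 + i)%N y = r - F y (120 + i)%N.
  by move=> li yi; rewrite -(hF2 _ yi); [ring|rewrite /K; lia].
have q0 := Q 0%N isT; have q1 := Q 1%N isT; have q2 := Q 2%N isT.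
have q3 := Q 3%N isT; have q4 := Q 4%N isT; have q5 := Q 5%N isT.
rewrite !N //= !big_cons !big_nil in q0 q1 q2 q3 q4 q5.
have s0 := S 0%N; have s1 := S 1%N; have s2 := S 2%N; have s3 := S 3%N.
have s4 := S 4%N; have s5 := S 5%N; rewrite !N //= in s0 s1 s2 s3 s4 s5.
have a1 := s0 13%N isT isT; have a2 := s0 43%N isT isT; have a3 := s1 73%N isT isT.
have a4 := s2 103%N isT isT; have a5 := s3 14%N isT isT; have a6 := s4 44%N isT isT.
have a7 := s5 74%N isT isT; have a8 := s5 104%N isT isT.
have b1 := s0 121%N isT isT; have b2 := s1 122%N isT isT; have b3 := s2 123%N isT isT.
have b4 := s3 124%N isT isT; have b5 := s4 125%N isT isT.
move: o => /and5P[/eqP o1 /eqP o2 /eqP o3 /eqP o4 /and4P[/eqP o5 /eqP o6 /eqP o7 /eqP o8]].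
rewrite /Sv o1 o2 o3 o4 o5 o6 o7 o8.
rewrite -[(8 + 5)%N]/13%N -[(8 + 6)%N]/14%N -[(38 + 5)%N]/43%N -[(38 + 6)%N]/44%N.
rewrite -[(68 + 5)%N]/73%N -[(68 + 6)%N]/74%N -[(98 + 5)%N]/103%N -[(98 + 6)%N]/104%N.
rewrite !natrD.
rewrite -[(120 + 0)%N]/120%N -[(120 + 1)%N]/121%N -[(120 + 2)%N]/122%N
  -[(120 + 3)%N]/123%N -[(120 + 4)%N]/124%N -[(120 + 5)%N]/125%N in q0 q1 q2 q3 q4 q5 a1 a2 a3 a4 a5 a6 a7 a8 b1 b2 b3 b4 b5.
by lra.
Qed.

Lemma base_mem j q : (j < 4)%N -> (q < 3)%N -> (30 * j + 8 * q)%N \in block_bases.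
Proof. by case: j => [|[|[|[|j]]]] //; case: q => [|[|[|q]]]. Qed.

Lemma port_ext out j : (j < 4)%N -> ext (port out j).
Proof.
move=> lj; have T : all (fun j => ext (port true j) && ext (port false j)) (iota 0 4).
  by vm_compute.
by have /andP[h1 h2] := all_iotaP T lj; case: out.
Qed.

Definition low j := E (port false j) < 5 / 2.

Lemma sv5 o : r = 5 -> o \in block_bases -> Sv o = 10 - Su o.
Proof.
move=> r5 ob; have dl0' := dl0; have := block5 ob r5; have [k] := block_total ob; rewrite r5.
have := @u_bounds o ob 5%N isT isT; have := @u_bounds o ob 6%N isT isT.
rewrite r5 => h1 h2 e h3; have h4 : 2 < Sv o < 8 by rewrite /Sv; lra.
clear h1 h2; move: h3 h4 => /andP[a1 a2] /andP[a3 a4].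
have k1 : (11 : R) < k%:R.
  by move: e; move: (k%:R : R) (Su o) (Sv o) a1 a2 a3 a4 => q u v a1 a2 a3 a4 e; lra.
have k2 : (k%:R : R) < 13.
  by move: e; move: (k%:R : R) (Su o) (Sv o) a1 a2 a3 a4 => q u v a1 a2 a3 a4 e; lra.
have ek : k = 12%N by move: k1 k2; rewrite !ltr_nat; lia.
by rewrite ek in e; lra.
Qed.

(** Relative to 5, both totals have absolute value at most 1, while modulo 5 their sum must stay
    more than 1 away from 0. Neither can vanish and they have the same sign, so the port value
    avoids the neighbourhood of 5/2. *)
Lemma port_cases (E0 s1 s2 : R) (k : nat) : r = 5 -> 1 + dl <= E0 <= r - 1 - dl ->
  4 <= s1 <= 6 -> 4 <= s2 <= 6 -> E0 = r * k%:R - 6 * r + s1 + s2 ->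
  if E0 < 5 / 2 then (5 < s1) && (5 < s2) else [&& s1 < 5, s2 < 5 & 5 / 2 < E0].
Proof.
move=> r5; rewrite r5 => b h1 h2 e; have dl0' := dl0.
move: b h1 h2 => /andP[b1 b2] /andP[a1 a2] /andP[a3 a4].
have k1 : (3 : R) < k%:R by move: e; move: (k%:R : R) => q e; lra.
have k2 : (k%:R : R) < 6 by move: e; move: (k%:R : R) => q e; lra.
(* For [k = 4] the port value is [s1 + s2 - 10], the low case; for [k = 5] it is [s1 + s2 - 5], the
   high case. *)
have : k = 4%N \/ k = 5%N by move: k1 k2; rewrite !ltr_nat; lia.
case=> ek; rewrite ek in e; case: ifP => h.
- by apply/andP; split; lra.
- by exfalso; move/negbT: h; rewrite -leNgt => h; lra.
- by exfalso; lra.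
- by move/negbT: h; rewrite -leNgt => h; apply/and3P; split; lra.
Qed.

Lemma gather_range (q u0 u1 u2 u3 : R) : 4 <= u0 <= 6 -> 4 <= u1 <= 6 -> 4 <= u2 <= 6 ->
  4 <= u3 <= 6 -> 10 - u0 + (10 - u1) + (10 - u2) + (10 - u3) = 13 * 5 - 5 * q ->
  8 < q /\ q < 10.
Proof.
move=> /andP[a0 b0] /andP[a1 b1] /andP[a2 b2] /andP[a3 b3] e.
by split; lra.
Qed.

Lemma gather_total (u0 u1 u2 u3 : R) :
  10 - u0 + (10 - u1) + (10 - u2) + (10 - u3) = 13 * 5 - 5 * 9 -> u0 + u1 + u2 + u3 = 20.
Proof. by move=> e; lra. Qed.

Lemma gather_mixed (u0 u1 u2 u3 : R) : u0 + u1 + u2 + u3 = 20 ->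
  (5 < u0 -> 5 < u1 -> 5 < u2 -> 5 < u3 -> False) /\
  (u0 < 5 -> u1 < 5 -> u2 < 5 -> u3 < 5 -> False).
Proof. by move=> e; split=> h0 h1 h2 h3; lra. Qed.

(** The two blocks at an input port share their sign, so the second one reports the bit to the
    gathering path. There the four totals lie in [4, 6] and sum to a multiple of 5, hence to 20;
    they are neither all above nor all below 5. *)
Lemma cell_logic : r = 5 ->
  (forall j, (j < 4)%N -> E (port false j) != 5 / 2 /\ E (port true j) != 5 / 2 /\
     (E (port true j) < 5 / 2) = ~~ low j) /\
  (exists j j', [/\ (j < 4)%N, (j' < 4)%N, low j & ~~ low j']).
Proof.
move=> r5.
have H j : (j < 4)%N ->
    [/\ if low j then (5 < Su (30 * j)) && (5 < Su (30 * j + 8)) else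
        [&& Su (30 * j) < 5, Su (30 * j + 8) < 5 & 5 / 2 < E (port false j)] &
        if E (port true j) < 5 / 2 then (5 < Sv (30 * j)) && (5 < Su (30 * j + 16)) else
        [&& Sv (30 * j) < 5, Su (30 * j + 16) < 5 & 5 / 2 < E (port true j)]].
  move=> lj; have b0 := base_mem lj (isT : (0 < 3)%N).
  have b1 := base_mem lj (isT : (1 < 3)%N); have b2 := base_mem lj (isT : (2 < 3)%N).
  rewrite muln0 addn0 in b0; rewrite muln1 in b1; rewrite -[(8 * 2)%N]/16%N in b2.
  have c0 := block5 b0 r5; have c1 := block5 b1 r5; have c2 := block5 b2 r5.
  have c3 : 4 <= Sv (30 * j) <= 6 by rewrite sv5 //; lra.
  split.
    by have [k e] := path_in lj; exact: (port_cases r5 (hE (port_ext false lj)) c0 c1 e).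
  by have [k e] := path_out lj; exact: (port_cases r5 (hE (port_ext true lj)) c3 c2 e).
split.
  move=> j lj; have [h1 h2] := H j lj.
  have b0 := base_mem lj (isT : (0 < 3)%N); rewrite muln0 addn0 in b0.
  have e := sv5 r5 b0; rewrite e in h2.
  move: h1 h2; rewrite /low; case: ifP => i1; case: ifP => i2.
  - by move=> /andP[g1 _] /andP[g2 _]; lra.
  - by move=> _ /and3P[_ _ g]; rewrite (lt_eqF i1) (gt_eqF g).
  - by move=> /and3P[_ _ g] _; rewrite (lt_eqF i2) (gt_eqF g).
  - by move=> /and3P[g1 _ _] /and3P[g2 _ _]; lra.
have [k e] := gather.
have H' j : (j < 4)%N -> if low j then 5 < Su (30 * j + 8) else Su (30 * j + 8) < 5.
  by move=> lj; have [h _] := H j lj; move: h; case: ifP => _; [case/andP|case/and3P].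
have S8 j : (j < 4)%N -> Sv (30 * j + 8) = 10 - Su (30 * j + 8) /\ 4 <= Su (30 * j + 8) <= 6.
  move=> lj; have b1 := base_mem lj (isT : (1 < 3)%N); rewrite muln1 in b1.
  by split; [apply: sv5|apply: block5].
have [v0 w0] := S8 0%N isT; have [v1 w1] := S8 1%N isT.
have [v2 w2] := S8 2%N isT; have [v3 w3] := S8 3%N isT.
have h0 := H' 0%N isT; have h1 := H' 1%N isT; have h2 := H' 2%N isT; have h3 := H' 3%N isT.
rewrite -[(30 * 0 + 8)%N]/8%N -[(30 * 1 + 8)%N]/38%N -[(30 * 2 + 8)%N]/68%N
  -[(30 * 3 + 8)%N]/98%N in v0 v1 v2 v3 w0 w1 w2 w3 h0 h1 h2 h3.
rewrite v0 v1 v2 v3 r5 in e.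
have [k1 k2] := gather_range w0 w1 w2 w3 e.
have ek : k = 9%N.
  move: k1 k2; rewrite !ltr_nat => k1 k2.
  by apply/eqP; rewrite eqn_leq k1 andbT -ltnS.
rewrite ek in e; have e2 := gather_total e.
have nall : ~~ [&& low 0, low 1, low 2 & low 3].
  apply/negP => /and4P[i0 i1 i2 i3]; rewrite i0 in h0; rewrite i1 in h1.
  by rewrite i2 in h2; rewrite i3 in h3; have [/(_ h0 h1 h2 h3)] := gather_mixed e2.
have nnone : ~~ [&& ~~ low 0, ~~ low 1, ~~ low 2 & ~~ low 3].
  apply/negP => /and4P[/negbTE i0 /negbTE i1 /negbTE i2 /negbTE i3].
  rewrite i0 in h0; rewrite i1 in h1; rewrite i2 in h2; rewrite i3 in h3.
  by have [_ /(_ h0 h1 h2 h3)] := gather_mixed e2.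
move: nall nnone.
case i0 : (low 0); case i1 : (low 1); case i2 : (low 2); case i3 : (low 3) => // _ _;
  first [by exists 0%N, 1%N; split; rewrite ?i0 ?i1 | by exists 1%N, 0%N; split; rewrite ?i0 ?i1
   | by exists 0%N, 2%N; split; rewrite ?i0 ?i2 | by exists 2%N, 0%N; split; rewrite ?i0 ?i2
   | by exists 0%N, 3%N; split; rewrite ?i0 ?i3 | by exists 3%N, 0%N; split; rewrite ?i0 ?i3].
Qed.

Lemma port_range4 (ep E0 s1 s2 : R) (k : nat) : 1000 * ep = 1 -> 0 < dl ->
  1 + dl <= E0 <= 4 + ep - 1 - dl -> 39 <= 10 * s1 <= 41 -> 39 <= 10 * s2 <= 41 ->
  E0 <> (4 + ep) * k%:R - 6 * (4 + ep) + s1 + s2.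
Proof.
move=> epE d0 /andP[b1 b2] /andP[a1 a2] /andP[a3 a4] e; have ep0 : 0 < ep by lra.
case: (leqP k 4) => lk.
  have q4 : (k%:R : R) <= 4 by rewrite ler_nat.
  have t : ep * k%:R <= ep * 4 by rewrite ler_pM2l.
  by move: e q4 t; move: (k%:R : R) => q e q4 t; lra.
have q5 : (5 : R) <= k%:R by rewrite ler_nat.
have t : ep * 5 <= ep * k%:R by rewrite ler_pM2l.
by move: e q5 t; move: (k%:R : R) => q e q5 t; lra.
Qed.

(** Both totals at one input port are within 1/10 of 4, so that port would have to carry a value
    close to 0 modulo [r], outside the admissible interval. *)
Lemma cell_contra ep : 1000 * ep = 1 -> r <> 4 + ep.
Proof.
move=> epE r4.
have c0 := block4 (base_mem (isT : (0 < 4)%N) (isT : (0 < 3)%N)) epE r4.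
have c1 := block4 (base_mem (isT : (0 < 4)%N) (isT : (1 < 3)%N)) epE r4.
have [k e] := path_in (isT : (0 < 4)%N).
have hb := hE (port_ext false (isT : (0 < 4)%N)).
rewrite r4 in hb e; exact: (port_range4 epE dl0 hb c0 c1 e).
Qed.
End CellFlow.

Local Open Scope nat_scope.

(** * Rings of cells *)

Section Rings.

Lemma big_ord_mem (M : nmodType) n (s : seq nat) (f : nat -> M) : uniq s ->
  all (fun y => y < n) s ->
  (\sum_(y < n | val y \in s) f (val y) = \sum_(y <- s) f y)%R.
Proof.
move=> us /allP ls; rewrite -(big_mkord (fun i => i \in s) f) -big_filter.
apply: perm_big; apply: uniq_perm => //; first by rewrite filter_uniq // iota_uniq.
move=> i; rewrite mem_filter mem_index_iota /=.
by case h : (i \in s) => //=; apply: ls.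
Qed.

Lemma sum_arcs (E : seq (nat * nat)) n (f : nat -> nat -> nat) :
  all (fun e => (e.1 < n) && (e.2 < n)) E ->
  \sum_(l <- iota 0 n) \sum_(y <- [seq e.2 | e <- E & e.1 == l] ++
    [seq e.1 | e <- E & e.2 == l]) f l y = \sum_(e <- E) (f e.1 e.2 + f e.2 e.1).
Proof.
move=> lt; rewrite [RHS]big_split.
rewrite (eq_bigr (fun l => \sum_(e <- E | e.1 == l) f e.1 e.2 +
   \sum_(e <- E | e.2 == l) f e.2 e.1)); last first.
  move=> l _; rewrite big_cat !big_map !big_filter; congr (_ + _).
    by apply: eq_bigr => e /eqP ->.
  by apply: eq_bigr => e /eqP ->.
rewrite big_split; congr (_ + _); rewrite (exchange_big_dep predT) // big_seq [RHS]big_seq;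
  apply: eq_bigr => e he; have /andP[l1 l2] := allP lt _ he.
- rewrite (eq_bigl (pred1 e.1)); last by move=> i; rewrite /= eq_sym.
  by rewrite -big_filter filter_pred1_uniq ?iota_uniq ?mem_iota // big_seq1.
- rewrite (eq_bigl (pred1 e.2)); last by move=> i; rewrite /= eq_sym.
  by rewrite -big_filter filter_pred1_uniq ?iota_uniq ?mem_iota // big_seq1.
Qed.

Lemma cell_edges_lt : all (fun e : nat * nat => (e.1 < K) && (e.2 < K)) cell_edges.
Proof. by vm_compute. Qed.

Transparent nbr.
Lemma sum_nbr (f : nat -> nat -> nat) :
  \sum_(l <- iota 0 K) \sum_(y <- nbr l) f l y =
  \sum_(e <- cell_edges) (f e.1 e.2 + f e.2 e.1).
Proof. exact: (sum_arcs f cell_edges_lt). Qed.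
Opaque nbr.

Local Arguments iota : simpl never.
Local Arguments muln : simpl never.

Lemma succ_modm g m : (g %% m).+1 %% m = g.+1 %% m.
Proof. by rewrite -[in LHS]addn1 modnDml addn1. Qed.

Lemma ring_const (P : nat -> bool) m g0 : 1 < m -> g0 < m ->
  (forall h, h < m -> h != g0 -> h.+1 %% m != g0 -> P (h.+1 %% m) = P h) ->
  forall h, h < m -> h != g0 -> P h = P (g0.+1 %% m).
Proof.
move=> m1 lg0 step h lh ne.
have gi i : 0 < i -> i < m -> (g0 + i) %% m != g0.
  move=> i0 im; apply/negP => /eqP e.
  case: (ltnP (g0 + i) m) => c; first by rewrite modn_small // in e; lia.
  by move: e; rewrite -(subnK c) modnDr modn_small; lia.
have A1 i : i < m.-1 -> P ((g0.+1 + i) %% m) = P (g0.+1 %% m).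
  elim: i => [|i IH] li; first by rewrite addn0.
  rewrite -IH; last by lia.
  rewrite addnS -succ_modm; apply: step.
  - by rewrite ltn_mod; lia.
  - by rewrite addSnnS; apply: gi; lia.
  - by rewrite succ_modm -addnS addSnnS; apply: gi; lia.
case: (ltnP g0 h) => c.
  by rewrite -(A1 (h - g0.+1)); [rewrite subnKC // modn_small|lia].
have e : h = (g0.+1 + (h + m - g0.+1)) %% m.
  rewrite subnKC; last by lia.
  by rewrite modnDr modn_small.
by rewrite {1}e A1 //; move: ne c; rewrite neq_ltn; lia.
Qed.

Lemma ring_switch (P : nat -> bool) m g n b : 0 < m -> P (g %% m) = b ->
  P ((g + n) %% m) = ~~ b -> exists2 k, k < m & P k = b /\ P (k.+1 %% m) = ~~ b.
Proof.
move=> m0; elim: n => [|n IH] e1 e2; first by move: e2; rewrite addn0 e1; case: b {e1}.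
case: (eqVneq (P ((g + n) %% m)) b) => [e3|ne].
  by exists ((g + n) %% m); rewrite ?ltn_mod // succ_modm -addnS.
by apply: IH => //; move: ne; case: (P _); case: (b).
Qed.

Lemma flow_upper (R : realType) (a b r dl : R) :
  (a + b = r -> 1 + dl <= b -> a <= r - 1 - dl)%R.
Proof. by move=> e h; lra. Qed.

Lemma scaled_gt1 (R : realType) (v : nat) : 30 < v -> (1 < v%:R / 30 :> R)%R.
Proof. by rewrite -(ltr_nat R) => h; lra. Qed.

Lemma scaled_total (R : realType) t : (t == 150) || (t == 300) ->
  exists k : nat, (t%:R / 30 = 5 * k%:R :> R)%R.
Proof. by case/orP=> /eqP ->; [exists 1|exists 2]; lra. Qed.

Lemma scaled_sum (R : realType) (a b : nat) : a + b = 150 ->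
  (a%:R / 30 + b%:R / 30 = 5 :> R)%R.
Proof. by move=> e; rewrite -mulrDl -natrD e; lra. Qed.

Local Arguments table_flow : simpl never.
Local Arguments ext_flow : simpl never.

Section Ring.
(** The join of external vertices is kept abstract: an involution that never stays within a cell,
    prescribed only on the ring. Girth and cut properties thus hold for every wiring of the
    ports. *)
Variables (m : nat) (xn : nat -> nat -> nat * nat).
Hypothesis m2 : 1 < m.
Hypothesis xnP : forall g l, g < m -> ext l ->
  [/\ (xn g l).1 < m, (xn g l).1 != g, ext (xn g l).2 & xn (xn g l).1 (xn g l).2 = (g, l)].
Hypothesis xnR1 : forall g, g < m -> xn g 129 = (g.+1 %% m, 127).
Hypothesis xnR2 : forall g, g < m -> xn g 134 = (g.+1 %% m, 132).

Definition nv := m * K.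
Definition gadj i j :=
  ((i %/ K == j %/ K) && (j %% K \in nbr (i %% K))) ||
  (ext (i %% K) && (xn (i %/ K) (i %% K) == (j %/ K, j %% K))).

Lemma K0 : 0 < K. Proof. by []. Qed.
Lemma cell_lt i : i < nv -> i %/ K < m. Proof. by rewrite ltn_divLR. Qed.
Lemma loc_lt i : i %% K < K. Proof. by rewrite ltn_mod. Qed.
Lemma code_lt g l : g < m -> l < K -> g * K + l < nv.
Proof.
move=> lg ll; apply: (@leq_trans (g.+1 * K)); last by rewrite leq_mul2r lg orbT.
by rewrite [ltnRHS]mulSnr ltn_add2l.
Qed.
Lemma codeK i : i %/ K * K + i %% K = i. Proof. by rewrite -divn_eq. Qed.

Lemma gadj_sym i j : i < nv -> j < nv -> gadj i j = gadj j i.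
Proof.
suff H a b : a < nv -> b < nv -> gadj a b -> gadj b a.
  by move=> li lj; apply/idP/idP; apply: H.
move=> la lb /orP[/andP[/eqP e h]|/andP[ex /eqP e]]; apply/orP.
  by left; rewrite e eqxx nbr_sym.
by right; have [_ _] := xnP (cell_lt la) ex; rewrite e /= => -> ->; rewrite eqxx.
Qed.

Lemma gadj_irr i : i < nv -> gadj i i = false.
Proof.
move=> li; apply/negP => /orP[/andP[_ h]|/andP[ex /eqP e]].
  by have [_ _ /negP] := nbr_facts (loc_lt i).
by have [_ /eqP] := xnP (cell_lt li) ex; rewrite e.
Qed.

Definition ring_adj : rel 'I_nv := fun x y => gadj x y.
Lemma ring_adj_sym : symmetric ring_adj.
Proof. by move=> x y; apply: gadj_sym. Qed.
Lemma ring_adj_irr : irreflexive ring_adj.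
Proof. by move=> x; apply: gadj_irr. Qed.
Definition ring : graph := @Graph nv ring_adj ring_adj_sym ring_adj_irr.

Definition nbs i : seq nat := [seq i %/ K * K + y | y <- nbr (i %% K)] ++
  (if ext (i %% K) then [:: (xn (i %/ K) (i %% K)).1 * K + (xn (i %/ K) (i %% K)).2]
   else [::]).

Lemma gadj_nbs i j : i < nv -> j < nv -> gadj i j = (j \in nbs i).
Proof.
move=> li lj; rewrite /gadj /nbs [RHS]mem_cat; congr (_ || _).
  apply/andP/mapP => [[/eqP e h]|[y h ->]].
    by exists (j %% K); rewrite // e codeK.
  have ly := nbr_lt (loc_lt i) h.
  by rewrite !(code_divmod _ ly) eqxx.
case ex : (ext _) => //=; rewrite inE.
have [_ _ /ext_lt l2 _] := xnP (cell_lt li) ex.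
apply/eqP/eqP => [->|->] /=; first by rewrite codeK.
by rewrite !(code_divmod _ l2); case: (xn _ _).
Qed.

Lemma nbs_facts i : i < nv ->
  [/\ uniq (nbs i), size (nbs i) = 3 & all (fun j => j < nv) (nbs i)].
Proof.
move=> li; have [un sz _ al] := nbr_facts (loc_lt i); have lg := cell_lt li.
split.
- rewrite cat_uniq map_inj_uniq ?un /=; last by move=> a b /addnI.
  case ex : (ext _) => //=; rewrite orbF andbT; apply/mapP => -[y h].
  have ly := nbr_lt (loc_lt i) h; have [_ n1 /ext_lt l2 _] := xnP lg ex.
  move=> /(congr1 (divn^~ K)); rewrite !(code_divmod _ ly) !(code_divmod _ l2).
  by move=> e; rewrite e eqxx in n1.
- by rewrite size_cat size_map -sz; case: (ext _).
- rewrite all_cat all_map; apply/andP; split.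
    by apply/allP => y h /=; apply: code_lt => //; apply: nbr_lt h; apply: loc_lt.
  case ex : (ext _) => //=; rewrite andbT.
  by have [l1 _ /ext_lt l2 _] := xnP lg ex; apply: code_lt.
Qed.

Lemma sum_adj (M : nmodType) (x : 'I_nv) (f : nat -> M) :
  (\sum_(y : 'I_nv | ring_adj x y) f (val y) = \sum_(j <- nbs (val x)) f j)%R.
Proof.
have [un _ al] := nbs_facts (ltn_ord x).
rewrite -(big_ord_mem f un al); apply: eq_bigl => y.
by rewrite /ring_adj gadj_nbs.
Qed.

Lemma ring_cubic : cubic ring.
Proof.
move=> x; rewrite -sum1_card.
have [_ sz _] := nbs_facts (ltn_ord x).
have e : \sum_(y : 'I_nv | ring_adj x y) 1 = 3.
  by rewrite -sz -sum1_size; exact: (@sum_adj nat x (fun=> 1)).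
by rewrite (eq_bigl (ring_adj x)) // => y; rewrite inE.
Qed.

(** External vertices are pairwise non-adjacent inside a cell and have one external edge each. A
    walk that enters a cell and does not turn back therefore needs at least two more steps to leave
    it, which excludes triangles and squares through several cells. *)
Lemma ext_step i j k : i < nv -> j < nv -> k < nv -> gadj i j -> gadj j k -> i != k ->
  i %/ K != j %/ K -> k %/ K = j %/ K /\ ext (k %% K) = false.
Proof.
move=> li lj lk; rewrite (gadj_sym li lj) => /orP[/andP[/eqP -> _]|].
  by rewrite eqxx.
move=> /andP[ex /eqP e1] /orP[/andP[/eqP e2 h] _ _|/andP[_ /eqP e2] ne _].
  by split=> //; apply: ext_nonadj ex h.
by move: ne; rewrite -(codeK i) -(codeK k); move: e2; rewrite e1 => -[-> ->]; rewrite eqxx.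
Qed.

Lemma gadj_ext i j : gadj i j -> i %/ K != j %/ K -> ext (i %% K).
Proof. by move=> /orP[/andP[/eqP -> _]|/andP[]//]; rewrite eqxx. Qed.

Lemma gadj_int i j : i < nv -> gadj i j -> i %/ K = j %/ K -> j %% K \in nbr (i %% K).
Proof.
move=> li /orP[/andP[]//|/andP[ex /eqP e]] e2.
by have [_ /eqP] := xnP (cell_lt li) ex; rewrite e /= e2.
Qed.

Lemma no_square i j k l : i < nv -> j < nv -> k < nv -> l < nv ->
  gadj i j -> gadj j k -> gadj k l -> gadj l i -> i != k -> j != l ->
  i %/ K != j %/ K -> False.
Proof.
move=> li lj lk ll a1 a2 a3 a4 n1 n2 ne.
have [e1 x1] := ext_step li lj lk a1 a2 n1 ne.
rewrite gadj_sym // in a1; rewrite gadj_sym // in a4; rewrite eq_sym in ne.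
have [e2 x2] := ext_step lj li ll a1 a4 n2 ne.
have : ext (k %% K) by apply: gadj_ext a3 _; rewrite e1 e2.
by rewrite x1.
Qed.

Lemma ring_girth : girth_at_least ring 5.
Proof.
move=> c [sz3 /andP[cyc un]]; rewrite leqNgt; apply/negP => sz5.
case: c sz3 sz5 cyc un => [|x [|y [|z [|w [|]]]]] //= _ _.
  rewrite andbT !inE !negb_or => /and3P[a1 a2 a3] /and3P[/andP[n1 n2] n3 _].
  have [[lx ly] lz] := (ltn_ord x, ltn_ord y, ltn_ord z).
  rewrite -!val_eqE /= in n1 n2 n3; rewrite /ring_adj in a1 a2 a3.
  case: (eqVneq (x %/ K) (y %/ K)) => [exy|nxy]; last first.
    have [e1 x1] := ext_step lx ly lz a1 a2 n2 nxy.
    have : ext (z %% K) by apply: gadj_ext a3 _; rewrite e1 eq_sym.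
    by rewrite x1.
  case: (eqVneq (y %/ K) (z %/ K)) => [eyz|nyz]; last first.
    have n1' : val y != val x by rewrite eq_sym.
    have [e1 _] := ext_step ly lz lx a2 a3 n1' nyz.
    by rewrite -e1 exy eqxx in nyz.
  have h1 := gadj_int lx a1 exy; have h2 := gadj_int ly a2 eyz.
  have h3 := gadj_int lz a3 (esym (etrans exy eyz)).
  have [|/negP []] := cell_no_short_cycle (loc_lt x) h1 h2; last by rewrite nbr_sym.
  apply: contra n2 => /eqP e; rewrite -(codeK x) -(codeK z) e exy eyz; exact: eqxx.
rewrite andbT !inE !negb_or => /and4P[a1 a2 a3 a4].
move=> /and4P[/and3P[n1 n2 n3] /andP[n4 n5] n6 _].
have [[[lx ly] lz] lw] := (ltn_ord x, ltn_ord y, ltn_ord z, ltn_ord w).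
rewrite -!val_eqE /= in n1 n2 n3 n4 n5 n6; rewrite /ring_adj in a1 a2 a3 a4.
have n2' : val z != val x by rewrite eq_sym.
have n5' : val w != val y by rewrite eq_sym.
case: (eqVneq (x %/ K) (y %/ K)) => [e1|/(no_square lx ly lz lw a1 a2 a3 a4 n2 n5)//].
case: (eqVneq (y %/ K) (z %/ K)) => [e2|/(no_square ly lz lw lx a2 a3 a4 a1 n5 n2')//].
case: (eqVneq (z %/ K) (w %/ K)) => [e3|/(no_square lz lw lx ly a3 a4 a1 a2 n2' n5')//].
have h1 := gadj_int lx a1 e1; have h2 := gadj_int ly a2 e2.
have h3 := gadj_int lz a3 e3; have h4 := gadj_int lw a4 (esym (etrans e1 (etrans e2 e3))).
have [|_ /(_ _ h3)] := cell_no_short_cycle (loc_lt x) h1 h2.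
  apply: contra n2 => /eqP e; rewrite -(codeK x) -(codeK z) e e1 e2; exact: eqxx.
rewrite nbr_sym => /(_ h4) e; move/negP: n5; apply.
by rewrite -(codeK y) -(codeK w) e e2 e3.
Qed.

(** * Edge cuts of a ring *)

Section Cut.
Variable A : {set 'I_nv}.
Definition memN i := [exists y : 'I_nv, (val y == i) && (y \in A)].
Lemma memNE (x : 'I_nv) : memN (val x) = (x \in A).
Proof.
apply/existsP/idP => [[y /andP[/eqP/val_inj -> //]]|h].
by exists x; rewrite eqxx.
Qed.

Definition cellset g l := memN (g * K + l).
Definition ext_cut g := \sum_(l <- ext_verts)
  (cellset g l && ~~ cellset (xn g l).1 (xn g l).2 : nat).

Lemma card_edge_cut : #|@edge_cut ring A| =
  \sum_(g < m) (cut_of (cellset g) cell_edges + ext_cut g).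
Proof.
have exu : uniq ext_verts && all (fun l => l < K) ext_verts by vm_compute.
move/andP: exu => [exu exl].
rewrite -sum1_card (eq_bigl (fun p => [&& p.1 \in A, p.2 \notin A & ring_adj p.1 p.2]));
  last by move=> p; rewrite inE.
rewrite big_mkcond -(pair_bigA _ (fun x y : 'I_nv =>
   if [&& x \in A, y \notin A & ring_adj x y] then 1 else 0)) /=.
rewrite (eq_bigr (fun x : 'I_nv => \sum_(j <- nbs (val x)) (memN (val x) && ~~ memN j : nat)));
  last first.
  move=> x _; rewrite -(sum_adj x (fun j => memN (val x) && ~~ memN j : nat)).
  rewrite [RHS]big_mkcond; apply: eq_bigr => y _; rewrite !memNE.
  by case: (x \in A); case: (y \in A); case: (ring_adj x y).
rewrite -(big_mkord predT (fun i => \sum_(j <- nbs i) (memN i && ~~ memN j : nat))) /nv big_nat_mul.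
rewrite big_mkord; apply: eq_bigr => g _.
have -> : g.+1 * K = K + g * K by rewrite mulSn.
rewrite -{1}[(g * K)%N]add0n big_addn addnK /index_iota subn0.
rewrite (eq_big_seq (fun l => \sum_(y <- nbr l) (cellset g l && ~~ cellset g y : nat) +
   (if ext l then (cellset g l && ~~ cellset (xn g l).1 (xn g l).2 : nat) else 0))).
  rewrite big_split /= sum_nbr; congr (_ + _).
    rewrite /cut_of -sum1_count [RHS]big_mkcond; apply: eq_bigr => e _ /=.
    by case: (cellset g e.1); case: (cellset g e.2).
  rewrite /ext_cut -big_mkcond -big_filter; apply: perm_big; apply: uniq_perm; rewrite ?filter_uniq ?iota_uniq //.
  move=> l; rewrite mem_filter mem_iota add0n /= andbC; case h : (l < K) => //=.
  by apply/esym/negbTE/negP => /(allP exl); rewrite h.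
move=> l; rewrite mem_iota add0n /= => ll; rewrite /nbs /cellset addnC.
rewrite !(code_divmod _ ll) big_cat big_map /=; congr (_ + _).
by case: (ext l); rewrite ?big_nil ?big_seq1.
Qed.

Lemma card_cellset g : g < m -> (forall h l, h < m -> h != g -> l < K -> ~~ cellset h l) ->
  #|A| = count (cellset g) (iota 0 K).
Proof.
move=> lg H; rewrite -sum1_card (eq_bigl (fun y : 'I_nv => val y \in
   [seq g * K + l | l <- [seq l <- iota 0 K | cellset g l]])).
  rewrite (big_ord_mem (fun=> 1)).
  - by rewrite big_map big_filter sum1_count.
  - by rewrite map_inj_uniq ?filter_uniq ?iota_uniq // => a b /addnI.
  - rewrite all_map all_filter; apply/allP => l; rewrite mem_iota /= => ll.
    by apply/implyP => _; apply: code_lt.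
move=> y; rewrite -memNE -{1}(codeK (val y)) -/(cellset _ _).
apply/idP/mapP => [h|[l]].
  have e : val y %/ K = g.
    by apply/eqP/negPn/negP => ne; have /negP := H _ _ (cell_lt (ltn_ord y)) ne (loc_lt (val y)); apply.
  by exists (val y %% K); rewrite ?mem_filter ?mem_iota /= ?loc_lt -e ?codeK ?h.
rewrite mem_filter mem_iota /= => /andP[h ll] ->.
by rewrite !(code_divmod _ ll).
Qed.

Lemma ext_cut_alone g : g < m -> (forall h l, h < m -> h != g -> l < K -> ~~ cellset h l) ->
  ext_cut g = count (fun l => ext l && cellset g l) (iota 0 K).
Proof.
have exu : uniq ext_verts by vm_compute.
move=> lg H; rewrite -sum1_count -big_filter.
rewrite (perm_big [seq l <- ext_verts | cellset g l]); last first.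
  apply: uniq_perm; rewrite ?filter_uniq ?iota_uniq // => l.
  rewrite !mem_filter mem_iota /= -/(ext l); case ex : (ext l); rewrite ?andbF //=.
  by rewrite (ext_lt ex).
rewrite big_filter [RHS]big_mkcond /ext_cut; apply: eq_big_seq => l ex.
have [l1 n1 /ext_lt l2 _] := xnP lg ex.
by rewrite (H _ _ l1 n1 l2) andbT; case: (cellset g l).
Qed.

Lemma alone_small g : g < m -> (forall h l, h < m -> h != g -> l < K -> ~~ cellset h l) ->
  #|@edge_cut ring A| <= 3 -> #|A| <= 1.
Proof.
move=> lg H; rewrite card_edge_cut (bigD1 (Ordinal lg)) //= => le.
rewrite (card_cellset lg H); apply: cell_cut_small; rewrite -(ext_cut_alone lg H).
by apply: leq_trans le; apply: leq_addr.
Qed.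
End Cut.

Lemma cut_compl A : #|@edge_cut ring (~: A)| = #|@edge_cut ring A|.
Proof.
pose sw (p : 'I_nv * 'I_nv) := (p.2, p.1).
have swK : involutive sw by case.
have -> : @edge_cut ring (~: A) = [set sw p | p in @edge_cut ring A]; last first.
  by rewrite card_imset //; apply: inv_inj.
apply/setP => -[u v]; apply/idP/imsetP => [|[[a b] + ->]].
  rewrite !inE /= negbK => /and3P[h1 h2 h3]; exists (v, u) => //.
  rewrite !inE /=; apply/and3P; split=> //.
  by rewrite ring_adj_sym.
rewrite !inE /= negbK => /and3P[h1 h2 h3]; apply/and3P; split=> //.
by rewrite ring_adj_sym.
Qed.

(** The cut is charged cell by cell: internal edges, and external edges at their end in [A]. A cell
    on which [A] is not constant costs at least 2, and so does a change of value between two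
    consecutive constant cells, because of the two ring edges. With three edges at most one such
    event is affordable, whereas changes around a ring come in pairs. *)
Lemma small_cut A : #|@edge_cut ring A| <= 3 -> #|A| <= 1 \/ #|~: A| <= 1.
Proof.
move=> le; have := le; rewrite card_edge_cut => sum3.
pose T g := cut_of (cellset A g) cell_edges + ext_cut A g.
have m0 : 0 < m := ltnW m2.
have T1 g : g < m -> T g <= 3.
  move=> lg; apply: leq_trans sum3; rewrite (bigD1 (Ordinal lg)) //= -/(T g).
  exact: leq_addr.
have T2 g h : g < m -> h < m -> g != h -> T g + T h <= 3.
  move=> lg lh ne; apply: leq_trans sum3.
  rewrite (bigD1 (Ordinal lg)) //= (bigD1 (Ordinal lh)) /=; last first.
    by rewrite -val_eqE /= eq_sym.
  by rewrite addnA leq_addr.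
have T2' g h a b : g < m -> h < m -> g != h -> a <= T g -> b <= T h -> a + b <= 3.
  by move=> lg lh ne ha hb; apply: leq_trans (leq_add ha hb) (T2 _ _ lg lh ne).
pose cst g := cut_of (cellset A g) cell_edges <= 1.
have cstP g : cst g -> forall l, l < K -> cellset A g l = cellset A g 0.
  exact: cell_connected.
have T0 g : ~~ cst g -> 2 <= T g.
  by rewrite /cst -ltnNge => h; apply: leq_trans h (leq_addr _ _).
have R1 : ext 129 by vm_compute. have R2 : ext 134 by vm_compute.
have L1 : ext 127 by vm_compute. have L2 : ext 132 by vm_compute.
have lsucc g : g.+1 %% m < m by rewrite ltn_mod.
have xL g : g < m -> xn (g.+1 %% m) 127 = (g, 129) /\ xn (g.+1 %% m) 132 = (g, 134).
  move=> lg; have [_ _ _] := xnP lg R1; have [_ _ _] := xnP lg R2.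
  by rewrite xnR1 // xnR2 //= => -> ->.
have exl : perm_eq ext_verts ([:: 127; 129; 132; 134] ++ [seq port false j | j <- iota 0 4]
   ++ [seq port true j | j <- iota 0 4]) by vm_compute.
have xc g : (cellset A g 127 && ~~ cellset A (xn g 127).1 (xn g 127).2) +
   (cellset A g 129 && ~~ cellset A (xn g 129).1 (xn g 129).2) +
   (cellset A g 132 && ~~ cellset A (xn g 132).1 (xn g 132).2) +
   (cellset A g 134 && ~~ cellset A (xn g 134).1 (xn g 134).2) <= ext_cut A g.
  rewrite /ext_cut (perm_big _ exl) big_cat /= !big_cons big_nil.
  by rewrite addn0 !addnA -!addnA leq_add2l leq_add2l leq_add2l leq_addr.
have down g : g < m -> cst g -> cst (g.+1 %% m) -> cellset A g 0 ->
    ~~ cellset A (g.+1 %% m) 0 -> 2 <= T g.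
  move=> lg c1 c2 h1 h2; apply: leq_trans (leq_addl _ _); apply: leq_trans (xc g).
  rewrite xnR1 // xnR2 //; cbn [fst snd].
  rewrite (cstP _ c1 129 isT) (cstP _ c1 134 isT) (cstP _ c2 127 isT) (cstP _ c2 132 isT).
  by rewrite h1 h2; case: (cellset A g 127 && _); case: (cellset A g 132 && _).
have up g : g < m -> cst g -> cst (g.+1 %% m) -> ~~ cellset A g 0 ->
    cellset A (g.+1 %% m) 0 -> 2 <= T (g.+1 %% m).
  move=> lg c1 c2 h1 h2; apply: leq_trans (leq_addl _ _); apply: leq_trans (xc _).
  have [-> ->] := xL g lg; cbn [fst snd].
  rewrite (cstP _ c1 129 isT) (cstP _ c1 134 isT) (cstP _ c2 127 isT) (cstP _ c2 132 isT).
  by rewrite h1 h2; case: (cellset A _ 129 && _); case: (cellset A _ 134 && _).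
(* A descent after [g] and an ascent after [h] are charged to different cells, except when [g]
   follows [h]. Then [g] meets all four ring edges, and each of them is cut. *)
have both g h : g < m -> h < m -> cst g -> cst (g.+1 %% m) -> cst h -> cst (h.+1 %% m) ->
    cellset A g 0 -> ~~ cellset A (g.+1 %% m) 0 -> ~~ cellset A h 0 ->
    cellset A (h.+1 %% m) 0 -> False.
  move=> lg lh c1 c2 c3 c4 h1 h2 h3 h4.
  case: (eqVneq g (h.+1 %% m)) => [e|ne]; last first.
    by have := T2' _ _ 2 2 lg (lsucc h) ne (down _ lg c1 c2 h1 h2) (up _ lh c3 c4 h3 h4).
  have tg := T1 _ lg; have xg := xc g.
  have [x1 x2] := xL h lh; rewrite -e in x1 x2.
  rewrite x1 x2 xnR1 // xnR2 // in xg; cbn [fst snd] in xg.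
  rewrite (cstP _ c1 127 isT) (cstP _ c1 129 isT) (cstP _ c1 132 isT) (cstP _ c1 134 isT) in xg.
  rewrite (cstP _ c2 127 isT) (cstP _ c2 132 isT) (cstP _ c3 129 isT) (cstP _ c3 134 isT) in xg.
  rewrite h1 (negbTE h2) (negbTE h3) in xg.
  by have := leq_trans xg (leq_trans (leq_addl _ _) tg).
(* A non-constant cell uses up two of the three edges, so the other cells all agree, and [A] or its
   complement lies inside that cell. *)
case: (pickP (fun g : 'I_m => ~~ cst g)) => [g0 ng0|allc].
  have cs h : h < m -> h != g0 -> cst h.
    move=> lh ne; apply/negPn/negP => nh.
    have ne' : val g0 != h by rewrite eq_sym.
    by have := T2' _ _ 2 2 (ltn_ord g0) lh ne' (T0 _ ng0) (T0 _ nh).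
  have t0 := T0 _ ng0.
  pose b := cellset A (g0.+1 %% m) 0.
  have step h : h < m -> h != g0 -> h.+1 %% m != g0 ->
      cellset A (h.+1 %% m) 0 = cellset A h 0.
    move=> lh n1 n2; have c1 := cs _ lh n1; have c2 := cs _ (lsucc h) n2.
    case e1 : (cellset A h 0); case e2 : (cellset A (h.+1 %% m) 0) => //.
      have n1' : val g0 != h by rewrite eq_sym.
      by have := T2' _ _ 2 2 (ltn_ord g0) lh n1' t0 (down _ lh c1 c2 e1 (negbT e2)).
    have n2' : val g0 != h.+1 %% m by rewrite eq_sym.
    by have := T2' _ _ 2 2 (ltn_ord g0) (lsucc h) n2' t0 (up _ lh c1 c2 (negbT e1) e2).
  have all_b h : h < m -> h != g0 -> cellset A h 0 = b.
    exact: (ring_const (P := fun g => cellset A g 0) m2 (ltn_ord g0) step).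
  case eb : b.
    right; rewrite -cut_compl in le; apply: (alone_small (ltn_ord g0)) le => h l lh ne ll.
    have -> : cellset (~: A) h l = ~~ cellset A h l.
      rewrite /cellset -[h * K + l]/(val (Ordinal (code_lt lh ll))) !memNE.
      by rewrite inE.
    by rewrite (cstP _ (cs _ lh ne)) // all_b // eb.
  left; apply: (alone_small (ltn_ord g0)) le => h l lh ne ll.
  by rewrite (cstP _ (cs _ lh ne)) // all_b // eb.
have c h : h < m -> cst h by move=> lh; have := allc (Ordinal lh) => /negbFE.
have const b : (forall h, h < m -> cellset A h 0 = b) -> #|A| <= 1 \/ #|~: A| <= 1.
  move=> hb; have mb (x : 'I_nv) : (x \in A) = b.
    rewrite -memNE -(codeK (val x)) -/(cellset _ _ _) (cstP _ (c _ (cell_lt (ltn_ord x)))) ?loc_lt //.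
    by apply: hb; apply: cell_lt.
  case: b hb mb => hb mb; [right|left]; rewrite (eq_card (_ : _ =i pred0)) ?card0 // => x;
  by rewrite !inE mb.
have mod0 h : h < m -> h %% m = h by apply: modn_small.
case: (boolP [forall h : 'I_m, cellset A h 0 == cellset A 0 0]) => [/forallP eqA|].
  by apply: (const (cellset A 0 0)) => h lh; have /eqP := eqA (Ordinal lh).
rewrite negb_forall => /existsP[h1 nh1].
set b := cellset A 0 0 in nh1.
have e1 : cellset A h1 0 = ~~ b by move: nh1; case: (cellset _ _ _); case: (b).
have [k1 lk1 [f1 f2]] : exists2 k, k < m & cellset A k 0 = b /\ cellset A (k.+1 %% m) 0 = ~~ b.
  by apply: (@ring_switch (fun g => cellset A g 0) m 0 h1) => //; rewrite ?add0n mod0.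
have [k2 lk2 [f3 f4]] : exists2 k, k < m &
    cellset A k 0 = ~~ b /\ cellset A (k.+1 %% m) 0 = ~~ ~~ b.
  apply: (@ring_switch (fun g => cellset A g 0) m h1 (m - h1)) => //; first by rewrite mod0.
  by rewrite subnKC ?modnn ?negbK // ltnW.
exfalso; rewrite negbK in f4; move: f1 f2 f3 f4; case: (b) => f1 f2 f3 f4.
  by apply: (@both k1 k2); rewrite ?c ?ltn_mod ?f1 ?f2 ?f3 ?f4.
by apply: (@both k2 k1); rewrite ?c ?ltn_mod ?f1 ?f2 ?f3 ?f4.
Qed.

Lemma ring_cyclically_connected : cyclically_edge_connected ring 4.
Proof.
have big A : @contains_cycle ring A -> 3 <= #|A|.
  move=> [c [[sz /andP[_ un]] sub]]; apply: leq_trans sz _.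
  by rewrite -(card_uniqP un); apply: subset_leq_card; apply/fintype.subsetP.
move=> A /big b1 /big b2; rewrite leqNgt; apply/negP; rewrite ltnS => /small_cut.
by case; lia.
Qed.

(** * Flows on a ring and in its cells *)

Definition real_fun (R : realType) (f : 'I_nv -> 'I_nv -> R) i j : R :=
  match insub i, insub j with Some a, Some b => f a b | _, _ => 0%R end.
Lemma real_funE (R : realType) (f : 'I_nv -> 'I_nv -> R) (a b : 'I_nv) :
  real_fun f (val a) (val b) = f a b.
Proof. by rewrite /real_fun (valK a) (valK b). Qed.
Opaque real_fun.

Lemma positive_min (R : realType) (T : eqType) (s : seq T) (u : T -> R) :
  (forall p, p \in s -> (0 < u p)%R) ->
  exists2 dl : R, (0 < dl)%R & forall p, p \in s -> (dl <= u p)%R.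
Proof.
elim: s => [|p s IH] h; first by exists 1%R => //; lra.
have [q qs|dl dl0 hdl] := IH; first by apply: h; rewrite inE qs orbT.
exists (Num.min (u p) dl); first by rewrite lt_min dl0 h // mem_head.
by move=> q; rewrite inE => /orP[/eqP ->|/hdl l]; rewrite ge_min ?lexx // l orbT.
Qed.

Definition partner g l := (xn g l).1 * K + (xn g l).2.

Lemma gadj_cell g l y : g < m -> l < K -> y \in nbr l -> gadj (g * K + l) (g * K + y).
Proof.
move=> lg ll h; have ly := nbr_lt ll h.
by rewrite /gadj !(code_divmod _ ll) !(code_divmod _ ly) eqxx h.
Qed.

Lemma gadj_partner g l : g < m -> ext l -> gadj (g * K + l) (partner g l).
Proof.
move=> lg ex; have ll := ext_lt ex; have [_ _ /ext_lt l2 _] := xnP lg ex.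
by rewrite /gadj /partner !(code_divmod _ ll) !(code_divmod _ l2) ex -surjective_pairing eqxx orbT.
Qed.

Lemma partner_lt g l : g < m -> ext l -> partner g l < nv.
Proof. by move=> lg ex; have [l1 _ /ext_lt l2 _] := xnP lg ex; apply: code_lt. Qed.

Lemma nbs_code g l : l < K -> nbs (g * K + l) =
  [seq g * K + y | y <- nbr l] ++ (if ext l then [:: partner g l] else [::]).
Proof. by move=> ll; rewrite /nbs !(code_divmod _ ll). Qed.

Lemma sum_nbs (M : nmodType) g l (h : nat -> M) : l < K ->
  (\sum_(j <- nbs (g * K + l)) h j =
   \sum_(y <- nbr l) h (g * K + y)%N + (if ext l then h (partner g l) else 0))%R.
Proof.
move=> ll; rewrite (@nbs_code g l ll); move: (partner g l) => q.
rewrite big_cat big_map /=; congr (_ + _)%R.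
by case: (ext l); rewrite ?big_nil ?big_seq1.
Qed.

(** A finite graph has a common positive margin [dl] above 1; this is how the strict bounds reach
    the analysis of one cell. *)
Lemma ring_cell (R : realType) (r : R) f : @modflow R ring r f -> exists2 dl : R, (0 < dl)%R &
  forall g, g < m ->
  let F l y := real_fun f (g * K + l) (g * K + y) in
  let E l := real_fun f (g * K + l) (partner g l) in
  exists d : nat -> nat,
  [/\ forall l y, l < K -> y \in nbr l -> (F l y + F y l = r)%R,
      forall l y, l < K -> y \in nbr l -> (1 + dl <= F l y)%R,
      forall l, ext l -> (1 + dl <= E l <= r - 1 - dl)%R,
      forall l, l < K ->
        (\sum_(y <- nbr l) F l y + (if ext l then E l else 0) = r * (d l)%:R)%R &
      forall l, ext l -> (E l + real_fun f (partner g l) (g * K + l) = r)%R].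
Proof.
move=> [f1 f2 f3].
have [|dl dl0 hdl] := @positive_min R _ (enum [pred p : 'I_nv * 'I_nv | ring_adj p.1 p.2])
  (fun p => f p.1 p.2 - 1)%R.
  by move=> p; rewrite mem_enum inE => /f2; rewrite subr_gt0.
exists dl => // g lg F E.
have A1 i j : i < nv -> j < nv -> gadj i j -> (real_fun f i j + real_fun f j i = r)%R.
  by move=> li lj a; rewrite (real_funE f (Ordinal li) (Ordinal lj))
    (real_funE f (Ordinal lj) (Ordinal li)); apply: f1.
have A2 i j : i < nv -> j < nv -> gadj i j -> (1 + dl <= real_fun f i j)%R.
  move=> li lj a; rewrite (real_funE f (Ordinal li) (Ordinal lj)).
  have := hdl (Ordinal li, Ordinal lj); rewrite mem_enum inE /= => /(_ a).
  by rewrite lerBrDl.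
have A3 l : exists k : nat, l < K ->
    (\sum_(y <- nbr l) F l y + (if ext l then E l else 0) = r * k%:R)%R.
  case: (ltnP l K) => [ll|]; last by exists 0.
  have li := code_lt lg ll; have [k e] := f3 (Ordinal li); exists k => _; rewrite -e.
  have sm : (\sum_(y : 'I_nv | ring_adj (Ordinal li) y) real_fun f (g * K + l) (val y) =
      \sum_(j <- nbs (g * K + l)) real_fun f (g * K + l) j)%R.
    exact: (sum_adj (Ordinal li) (real_fun f (g * K + l))).
  have vs : (\sum_(y : 'I_nv | ring_adj (Ordinal li) y) real_fun f (g * K + l) (val y))%R =
      vsum f (Ordinal li).
    by apply: eq_bigr => y _; exact: (real_funE f (Ordinal li) y).
  have sb := @sum_nbs R g l (real_fun f (g * K + l)) ll.
  exact: (etrans (esym sb) (etrans (esym sm) vs)).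
have [d hd] := boolp.choice A3; exists d.
have A4 l : ext l -> gadj (partner g l) (g * K + l).
  by move=> ex; rewrite gadj_sym ?gadj_partner ?partner_lt ?code_lt // ext_lt.
split=> [l y ll h|l y ll h|l ex|l ll|l ex].
- have ly := nbr_lt ll h; apply: A1; rewrite ?code_lt //; exact: gadj_cell.
- have ly := nbr_lt ll h; apply: A2; rewrite ?code_lt //; exact: gadj_cell.
- have ll := ext_lt ex; have li := code_lt lg ll; have lp := partner_lt lg ex.
  have e1 := A1 _ _ li lp (gadj_partner lg ex); have e2 := A2 _ _ li lp (gadj_partner lg ex).
  have e3 := A2 _ _ lp li (A4 _ ex).
  by apply/andP; split=> //; apply: flow_upper e1 e3.
- exact: hd.
- by apply: A1; rewrite ?gadj_partner ?partner_lt ?code_lt // ext_lt.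
Qed.

Lemma ext_flow_gt p l : 30 < ext_flow p l.
Proof. by rewrite /ext_flow; do 2 case: ifP => _ //; case: ifP. Qed.

Lemma ring_flow (R : realType) (p : nat -> seq bool) :
  (forall g, g < m -> size (p g) = 4 /\ nae (p g)) ->
  (forall g l, g < m -> ext l ->
     ext_flow (p g) l + ext_flow (p (xn g l).1) (xn g l).2 = 150) ->
  exists f, @modflow R ring 5%R f.
Proof.
move=> hp hx.
pose v i j := if i %/ K == j %/ K then table_flow (p (i %/ K)) (i %% K) (j %% K)
  else ext_flow (p (i %/ K)) (i %% K).
exists (fun x y => ((v x y)%:R / 30)%R).
have B1 i j : i < nv -> j < nv -> gadj i j -> v i j + v j i = 150.
  move=> li lj a; have lg := cell_lt li; have [sz na] := hp _ lg; rewrite /v [j %/ K == _]eq_sym.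
  case: eqP => [e|/eqP ne].
    by rewrite -e; apply: table_flow_rev => //; apply: gadj_int li a e.
  have ex := gadj_ext a ne; have := hx _ _ lg ex.
  move: a => /orP[/andP[/eqP e _]|/andP[_ /eqP ->]] //=; by rewrite e eqxx in ne.
have B2 i j : i < nv -> j < nv -> gadj i j -> 30 < v i j.
  move=> li lj a; have lg := cell_lt li; have [sz na] := hp _ lg; rewrite /v.
  case: eqP => [e|_]; last exact: ext_flow_gt.
  by have [_ /(_ _ (gadj_int li a e)) /andP[]] := table_okP sz na (loc_lt i).
split=> [x y a|x y a|x].
- exact: scaled_sum (B1 _ _ (ltn_ord x) (ltn_ord y) a).
- exact: scaled_gt1 (B2 _ _ (ltn_ord x) (ltn_ord y) a).
have e : (vsum (fun x y : 'I_(nverts ring) => (v x y)%:R / 30 : R) x =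
   (\sum_(j <- nbs (val x)) v (val x) j)%:R / 30)%R.
  rewrite /vsum -mulr_suml; congr (_ / _)%R; rewrite natr_sum.
  exact: (sum_adj x (fun j => (v (val x) j)%:R : R)%R).
have li := ltn_ord x; have lg := cell_lt li; have [sz na] := hp _ lg.
have [t _] := table_okP sz na (loc_lt (val x)).
have e2 : \sum_(j <- nbs (val x)) v (val x) j =
    sumn [seq table_flow (p (val x %/ K)) (val x %% K) y | y <- nbr (val x %% K)] +
    (if ext (val x %% K) then ext_flow (p (val x %/ K)) (val x %% K) else 0).
  rewrite /nbs big_cat big_map /= sumnE big_map; congr (_ + _).
    apply: eq_big_seq => y h; have ly := nbr_lt (loc_lt (val x)) h.
    by rewrite /v !(code_divmod _ ly) eqxx.
  case ex : (ext _); rewrite ?big_nil // big_seq1 /v.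
  have [_ n1 /ext_lt l2 _] := xnP lg ex.
  by rewrite !(code_divmod _ l2) eq_sym (negbTE n1).
by rewrite -e2 in t; rewrite e; apply: scaled_total.
Qed.
End Ring.
End Rings.

(** * Not-all-equal rows and occurrence lists *)

Lemma next_sorted (s : seq nat) k : sorted ltn s -> k \in s ->
  (next s k \in s) /\ forall z, z \in s ->
    ~~ (if k < next s k then (k < z) && (z < next s k) else (z < next s k) || (k < z)).
Proof.
move=> ss ks; have us : uniq s by apply: sorted_uniq ss; [apply: ltn_trans|apply: ltnn].
split; first by rewrite mem_next.
case/splitPr: ks ss us => s1 s2; rewrite (sorted_pairwise ltn_trans) => pw us.
have -> : next (s1 ++ k :: s2) k = head k (s2 ++ s1).
  rewrite -(next_rot (size s1) us) rot_size_cat /=.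
  by case: (s2 ++ s1) => [|y t] /=; rewrite eqxx.
move: pw; rewrite pairwise_cat /= => /and3P[/allrelP h12 pw1 /andP[/allP hk pw2]] z.
rewrite mem_cat inE => zin.
have z1 : z \in s1 -> z < k by move=> h; apply: h12 => //; rewrite mem_head.
case: s2 h12 hk pw2 zin us => [|y s2] h12 hk pw2 zin us.
  case: s1 h12 pw1 z1 zin us => [|y s1] h12 pw1 z1 zin us /=.
    by move: zin; rewrite in_nil orbF /= => /eqP ->; rewrite ltnn.
  have yk : y < k by apply: h12; rewrite mem_head.
  rewrite ltnNge (ltnW yk) /= negb_or -!leqNgt.
  move: zin; rewrite in_nil orbF => /orP[zin|/eqP ->]; last by rewrite leqnn (ltnW yk).
  rewrite (ltnW (z1 zin)) andbT.
  move: zin; rewrite inE => /orP[/eqP ->//|zs].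
  by move: pw1 => /= /andP[/allP/(_ _ zs)/ltnW].
have ky : k < y by apply: hk; rewrite mem_head.
rewrite /= ky negb_and -!leqNgt.
move/or3P: zin => [/z1 h|/eqP ->|]; [by rewrite ltnW|by rewrite leqnn|].
rewrite inE => /orP[/eqP ->|zs]; first by rewrite leqnn orbT.
by move: pw2 => /= /andP[/allP/(_ _ zs) h _]; rewrite (ltnW h) orbT.
Qed.

Section Rows.
Variables (Lit : seq bool -> nat -> nat -> bool) (nc nu : seq bool -> nat).
Hypothesis nc0 : forall x, 0 < nc x.
Hypothesis nu0 : forall x, 0 < nu x.

Definition nrow0 x := nc x * nu x.
(** Every row is present twice; this serves [nxtf_row] and makes the ring have at least two
    cells. *)
Definition nrow x := 2 * nrow0 x.

(* Variable 0 stands for falsity, 1 + v for the CNF variable v, and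
   nu + 1 + r for the statement that clause r / nu is satisfied by a literal
   smaller than r mod nu. *)
Definition svar_core x j r0 c u h : nat :=
  match j with
  | 0 => 0
  | 1 => if u.+1 == nu x then 0 else nu x + 1 + r0.+1
  | 2 => if u == 0 then 0 else nu x + 1 + r0
  | _ => if Lit x c u then 1 + h else 0
  end.
Definition ssig_core x j c u b :=
  match j with
  | 1 => u.+1 == nu x
  | 3 => Lit x c u ==> (b == 1)
  | _ => true
  end.

Definition kvar x k :=
  let j := k %/ nrow x in let r0 := k %% nrow x %% nrow0 x in
  svar_core x j r0 (r0 %/ nu x) (r0 %% nu x) (r0 %% nu x %/ 2).
Definition ksig x k :=
  let j := k %/ nrow x in let r0 := k %% nrow x %% nrow0 x in
  ssig_core x j (r0 %/ nu x) (r0 %% nu x) (r0 %% nu x %% 2).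

Definition sval x (B : nat -> bool) k := B (kvar x k) == ksig x k.

Definition nae_sat x (B : nat -> bool) := forall r, r < nrow x ->
  exists j j', [/\ j < 4, j' < 4 &
    sval x B (j * nrow x + r) != sval x B (j' * nrow x + r)].

Lemma nrow0_gt0 x : 0 < nrow0 x. Proof. by rewrite muln_gt0 nc0 nu0. Qed.
Lemma nrow_gt0 x : 0 < nrow x. Proof. by rewrite muln_gt0 nrow0_gt0. Qed.

Lemma svalE x B j r : r < nrow x -> sval x B (j * nrow x + r) =
  let r0 := r %% nrow0 x in
  (B (svar_core x j r0 (r0 %/ nu x) (r0 %% nu x) (r0 %% nu x %/ 2)) ==
    ssig_core x j (r0 %/ nu x) (r0 %% nu x) (r0 %% nu x %% 2)).
Proof. by move=> lt; rewrite /sval /kvar /ksig !(code_divmod _ lt). Qed.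

(** Row [(c, u)] holds falsity F, [~ y_(u+1)], [y_u] and the literal [u] of clause [c], where [y_u]
    says that an earlier literal holds; at the two ends of a clause the [y] entry is replaced by F.
    With F false the row is a disjunction. If no literal held, every [y_u] would be false by
    induction and the last row would fail. *)
Lemma cnf_nae x : (exists B, forall c, c < nc x ->
    has (fun u => Lit x c u && lit_val B u) (iota 0 (nu x))) <->
  exists B, nae_sat x B.
Proof.
have n0 := nrow0_gt0 x; have u0 := nu0 x.
split=> [[A sat]|[B sat]].
  pose pre c u := has (fun u => Lit x c u && lit_val A u) (iota 0 u).
  have preS c u : pre c u.+1 = pre c u || (Lit x c u && lit_val A u).
    by rewrite /pre -addn1 iotaD has_cat /= orbF.
  exists (fun v => if v == 0 then false else if v <= nu x then A v.-1 else
     pre ((v - (nu x).+1) %/ nu x) ((v - (nu x).+1) %% nu x)) => r lr.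
  set B := (X in sval x X).
  have By v : B (nu x + 1 + v) = pre (v %/ nu x) (v %% nu x).
    rewrite /B addn1 /= ltnNge leq_addr /= addKn. by [].
  pose r0 := r %% nrow0 x; pose c := r0 %/ nu x; pose u := r0 %% nu x.
  have lu : u < nu x by rewrite ltn_mod.
  have lc : c < nc x by rewrite ltn_divLR // ltn_mod.
  have er : r0 = c * nu x + u by rewrite -divn_eq.
  have s0 : sval x B (0 * nrow x + r) = false by rewrite svalE.
  suff [j lj sj] : exists2 j, j < 4 & sval x B (j * nrow x + r).
    by exists 0, j; rewrite s0 sj lj.
  have e1 : sval x B (1 * nrow x + r) = (u.+1 != nu x) && ~~ pre c u.+1.
    rewrite svalE //= -/r0 -/u; case: (eqVneq u.+1 (nu x)) => h //.
    rewrite By er -addnS !(code_divmod) ?eqbF_neg //; lia.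
  have e2 : sval x B (2 * nrow x + r) = pre c u.
    rewrite svalE //= -/r0 -/u eqb_id; case: (eqVneq u 0) => h; first by rewrite h.
    by rewrite By.
  have e3 : sval x B (3 * nrow x + r) = Lit x c u && lit_val A u.
    rewrite svalE //= -/r0 -/u -/c; case: (Lit x c u) => //=.
    rewrite /B add1n /= /lit_val divn2 modn2 ifT; last by lia.
    by case: (odd u).
  have := preS c u.
  case: (boolP (pre c u)) => h2; first by exists 2; rewrite ?e2.
  case: (boolP (Lit x c u && lit_val A u)) => h3; first by exists 3; rewrite ?e3.
  move=> /= h; exists 1 => //; rewrite e1 h andbT; apply/eqP => eu.
  by have := sat c lc; rewrite -/(pre c (nu x)) -eu h.
(* Not-all-equal conditions are invariant under complementation; adding the value of variable 0
   normalises falsity to false. *)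
exists (fun v => B v.+1 (+) B 0) => c lc; apply/negPn/negP => /hasPn nolit.
pose y u := B (nu x + 1 + (c * nu x + u)) (+) B 0.
have row u : u < nu x -> [&& (u == 0) || ~~ y u & ~~ (Lit x c u && lit_val (fun v => B v.+1 (+) B 0) u)] ->
    (u.+1 != nu x) && ~~ y u.+1.
  move=> lu /andP[h2 h3].
  have lr0 : c * nu x + u < nrow0 x.
    by have : c.+1 * nu x <= nrow0 x; [rewrite leq_mul2r lc orbT|rewrite mulSn; lia].
  have lr : c * nu x + u < nrow x by rewrite /nrow; lia.
  have sv j : (j < 4) -> (u.+1 != nu x) && ~~ y u.+1 = false ->
      sval x B (j * nrow x + (c * nu x + u)) = B 0.
    move=> lj h1; rewrite svalE //= modn_small // !(code_divmod _ lu).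
    case: j lj => [|[|[|[|j]]]] //= _.
    - move: h1; case: (u.+1 =P nu x) => [_ _|_]; first by case: (B 0).
      rewrite /y -addnS => /negbFE; by case: (B _); case: (B 0).
    - move: h2; case: (u =P 0) => [_ _|_]; first by case: (B 0).
      by rewrite /y /=; case: (B _); case: (B 0).
    - move: h3; case: (Lit x c u) => [|_]; last by case: (B 0).
      rewrite /lit_val divn2 modn2 add1n.
      by case: (B _); case: (B 0); case: (odd u).
  case E : ((u.+1 != nu x) && ~~ y u.+1) => //.
  have [j [j' [lj lj']]] := sat _ lr; by rewrite !sv ?eqxx.
have nl u : u < nu x -> ~~ (Lit x c u && lit_val (fun v => B v.+1 (+) B 0) u).
  by move=> lu; apply: nolit; rewrite mem_iota add0n.
have all_y u : u < nu x -> (u == 0) || ~~ y u.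
  elim: u => // u IH lu.
  by have := row u (ltnW lu); rewrite IH 1?ltnW // nl 1?ltnW // => /(_ isT)/andP[].
have lp : (nu x).-1 < nu x by rewrite prednK.
by have := row _ lp; rewrite all_y // nl // prednK // eqxx => /(_ isT).
Qed.

Definition occ x k := [seq z <- iota 0 (4 * nrow x) | kvar x z == kvar x k].
Definition nxtf x k := next (occ x k) k.
Definition prvf x k := prev (occ x k) k.

(** The successor map [next] is not a term of the formula language. Its graph is definable, by the
    absence of an occurrence strictly between [k] and [k'] in the cyclic order. *)
Definition nrel x k k' := (kvar x k == kvar x k') &&
  ~~ has (fun z => (kvar x z == kvar x k) &&
      (if k < k' then (k < z) && (z < k') else (z < k') || (k < z)))
    (iota 0 (4 * nrow x)).

Section Next.
Variable x : seq bool.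
Local Notation N := (4 * nrow x).

Lemma occ_mem k z : (z \in occ x k) = (z < N) && (kvar x z == kvar x k).
Proof. by rewrite mem_filter mem_iota add0n andbC. Qed.

Lemma occ_uniq k : uniq (occ x k).
Proof. by rewrite filter_uniq // iota_uniq. Qed.

Lemma occ_eq k k' : kvar x k = kvar x k' -> occ x k = occ x k'.
Proof. by rewrite /occ => ->. Qed.

Lemma nxtf_mem k : k < N -> nxtf x k \in occ x k.
Proof. by move=> lk; rewrite mem_next occ_mem lk eqxx. Qed.

Lemma prvf_mem k : k < N -> prvf x k \in occ x k.
Proof. by move=> lk; rewrite mem_prev occ_mem lk eqxx. Qed.

Lemma nxtf_lt k : k < N -> nxtf x k < N.
Proof. by move/nxtf_mem; rewrite occ_mem => /andP[]. Qed.
Lemma prvf_lt k : k < N -> prvf x k < N.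
Proof. by move/prvf_mem; rewrite occ_mem => /andP[]. Qed.

Lemma prvf_nxtf k : k < N -> prvf x (nxtf x k) = k.
Proof.
move=> lk; have := nxtf_mem lk; rewrite occ_mem => /andP[_ /eqP e].
by rewrite /prvf (occ_eq e) prev_next ?occ_uniq.
Qed.

Lemma nxtf_prvf k : k < N -> nxtf x (prvf x k) = k.
Proof.
move=> lk; have := prvf_mem lk; rewrite occ_mem => /andP[_ /eqP e].
by rewrite {1}/nxtf (occ_eq e) next_prev ?occ_uniq.
Qed.

Lemma nrel_nxtf k : k < N -> nrel x k (nxtf x k).
Proof.
move=> lk; have ss : sorted ltn (occ x k).
  by apply: sorted_filter (iota_ltn_sorted _ _); apply: ltn_trans.
have [|h1 h2] := next_sorted ss (_ : k \in occ x k).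
  by rewrite occ_mem lk eqxx.
rewrite /nrel; move: h1; rewrite occ_mem => /andP[_ /eqP e].
rewrite -[nxtf x k]/(next _ _) e eqxx /=; apply/hasPn => z.
rewrite mem_iota add0n /= => lz; rewrite negb_and -implybE; apply/implyP => ez.
by apply: h2; rewrite occ_mem lz.
Qed.

Lemma nrelP k k' : k < N -> k' < N -> nrel x k k' = (k' == nxtf x k).
Proof.
move=> lk lk'; apply/idP/eqP => [h|->]; last exact: nrel_nxtf.
have := nrel_nxtf lk; have := nxtf_lt lk; move: (nxtf x k) => k2 lk2.
move: h => /andP[/eqP e1 /hasPn h1] /andP[/eqP e2 /hasPn h2].
have := h1 k2; have := h2 k'; rewrite !mem_iota /= !add0n lk' lk2 -e1 -e2 eqxx /=.
move=> /(_ isT) g1 /(_ isT) g2; apply/eqP; move: g1 g2.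
by case: (ltnP k k2) => c2; case: (ltnP k k') => c1; lia.
Qed.

Lemma nxtf_const (a : nat -> bool) : (forall k, k < N -> a (nxtf x k) = a k) ->
  forall k k', k < N -> k' < N -> kvar x k = kvar x k' -> a k = a k'.
Proof.
move=> ha.
suff H d k k' : k < k' -> k' < N -> kvar x k = kvar x k' -> k' - k <= d -> a k = a k'.
  move=> k k' lk lk' e; case: (ltngtP k k') => [h|h|->//].
    exact: (H (k' - k)).
  by symmetry; apply: (H (k - k')).
elim: d k k' => [|d IH] k k' lt lk' e le; first by lia.
have lk : k < N by lia.
have := nrel_nxtf lk; have := nxtf_lt lk; have := ha k lk.
move: (nxtf x k) => k1 ek lk1 /andP[/eqP e1 /hasPn h].
have := h k'; rewrite mem_iota /= add0n lk' -e eqxx /= => /(_ isT).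
case: (ltnP k k1) => c1; last by rewrite lt orbT.
rewrite lt /= -leqNgt => c2; rewrite -ek.
case: (ltngtP k1 k') c2 => // [c2 _|->//].
by apply: IH => //; [rewrite -e1|lia].
Qed.

Lemma kvar_half j r : r < nrow0 x -> kvar x (j * nrow x + r) = kvar x (j * nrow x + (r + nrow0 x)).
Proof.
move=> lr; rewrite /kvar !code_divmod ?(modnDr r) //; rewrite /nrow; lia.
Qed.

(** The twin row has the same variable in the same slot, half a period away. One of these copies
    always lies strictly between two occurrences in the same row, and also prevents an occurrence
    from being its own successor. *)
Lemma nxtf_row k : k < N -> nxtf x k %% nrow x != k %% nrow x.
Proof.
move=> lk; have := nrel_nxtf lk; have := nxtf_lt lk; move: (nxtf x k) => k' lk'.
move=> /andP[/eqP e /hasPn h]; apply/negP => /eqP er.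
have n0 := nrow_gt0 x; set m := nrow x in n0 lk lk' er *.
have em : m = 2 * nrow0 x by [].
have ek := divn_eq k m; have ek' := divn_eq k' m.
have lr : k %% m < m by rewrite ltn_mod.
have lj : k %/ m < 4 by rewrite ltn_divLR.
have lj' : k' %/ m < 4 by rewrite ltn_divLR.
rewrite er in ek'; move: (k %% m) (k %/ m) (k' %/ m) ek ek' lr lj lj' => r j j' ek ek' lr lj lj' {er}.
have jm (i i' : nat) : i < i' -> i * m + m <= i' * m by move=> l; rewrite -mulSnr leq_mul2r l orbT.
case: (ltnP r (nrow0 x)) => c1.
  have := h (j * m + (r + nrow0 x)).
  rewrite -kvar_half // -ek eqxx mem_iota /= => /(_ _)/wrap[].
    have : j.+1 * m <= N by rewrite leq_mul2r lj orbT.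
    by rewrite mulSn; lia.
  case: ltnP => c2; last by lia.
  have jj : j < j' by rewrite ltnNge; apply/negP => jj; have : j' * m <= j * m; [rewrite leq_mul2r jj orbT|lia].
  by have := jm _ _ jj; lia.
have := h (j' * m + (r - nrow0 x)).
rewrite kvar_half; last by lia.
rewrite subnK // -ek' -e eqxx mem_iota /= => /(_ _)/wrap[]; first by lia.
case: ltnP => c2; last by lia.
have jj : j < j' by rewrite ltnNge; apply/negP => jj; have : j' * m <= j * m; [rewrite leq_mul2r jj orbT|lia].
by have := jm _ _ jj; lia.
Qed.
End Next.

Hypothesis ff_Lit : forall A (W : A -> seq bool) V c u, ftm W V c -> ftm W V u ->
  ffm W V (fun a => Lit (W a) (c a) (u a)).
Hypothesis ft_nc : forall A (W : A -> seq bool) V, ftm W V (fun a => nc (W a)).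
Hypothesis ft_nu : forall A (W : A -> seq bool) V, ftm W V (fun a => nu (W a)).

Lemma ft_nrow0 A (W : A -> seq bool) V : ftm W V (fun a => nrow0 (W a)).
Proof. exact: (ft_mul (ft_nc W V) (ft_nu W V)). Qed.
Lemma ft_nrow A (W : A -> seq bool) V : ftm W V (fun a => nrow (W a)).
Proof. exact: (ft_mul (ft_const W V 2) (ft_nrow0 W V)). Qed.

(* Decomposes an occurrence index into slot, base row, clause, literal and the
   variable and sign of the literal. *)
Lemma ff_slot A (W : A -> seq bool) V k
    (P : A -> nat -> nat -> nat -> nat -> nat -> nat -> bool) : ftm W V k ->
  (forall A' (p : A' -> A) (W' := fun y => W (p y)) V' j r0 c u h b,
    (forall t, ftm W V t -> ftm W' V' (fun y => t (p y))) ->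
    ftm W' V' j -> ftm W' V' r0 -> ftm W' V' c -> ftm W' V' u -> ftm W' V' h ->
    ftm W' V' b -> ffm W' V' (fun y => P (p y) (j y) (r0 y) (c y) (u y) (h y) (b y))) ->
  ffm W V (fun a => let x := W a in let j := k a %/ nrow x in
    let r0 := k a %% nrow x %% nrow0 x in
    P a j r0 (r0 %/ nu x) (r0 %% nu x) (r0 %% nu x %/ 2) (r0 %% nu x %% 2)).
Proof.
move=> hk hP.
pose Q4 x a j r0 c u h b := (0 < 2) && P a j r0 c u h b && (x == x :> seq bool).
apply: (@ff_ext _ _ _ (fun a => (0 < nrow (W a)) && ((0 < nrow0 (W a)) &&
  ((0 < nu (W a)) && ((0 < 2) && P a (k a %/ nrow (W a))
    (k a %% nrow (W a) %% nrow0 (W a))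
    (k a %% nrow (W a) %% nrow0 (W a) %/ nu (W a))
    (k a %% nrow (W a) %% nrow0 (W a) %% nu (W a))
    (k a %% nrow (W a) %% nrow0 (W a) %% nu (W a) %/ 2)
    (k a %% nrow (W a) %% nrow0 (W a) %% nu (W a) %% 2)))))).
  by move=> a; rewrite nrow_gt0 nrow0_gt0 nu0.
apply: (@ff_divmod _ _ _ k (fun a => nrow (W a)) (fun a j r =>
  (0 < nrow0 (W a)) && ((0 < nu (W a)) && ((0 < 2) && P a j
    (r %% nrow0 (W a)) (r %% nrow0 (W a) %/ nu (W a)) (r %% nrow0 (W a) %% nu (W a))
    (r %% nrow0 (W a) %% nu (W a) %/ 2) (r %% nrow0 (W a) %% nu (W a) %% 2))))) => //.
  exact: ft_nrow.
apply: (@ff_divmod _ _ _ snd (fun y => nrow0 (W y.1.1)) (fun y q0 r0 =>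
  (0 < nu (W y.1.1)) && ((0 < 2) && P y.1.1 y.1.2
    r0 (r0 %/ nu (W y.1.1)) (r0 %% nu (W y.1.1))
    (r0 %% nu (W y.1.1) %/ 2) (r0 %% nu (W y.1.1) %% 2)))).
- exact: ft_top.
- exact: (ft_nrow0 (wlift (wlift W))).
apply: (@ff_divmod _ _ _ snd (fun y => nu (W y.1.1.1.1)) (fun y c u =>
  (0 < 2) && P y.1.1.1.1 y.1.1.1.2 y.2 c u (u %/ 2) (u %% 2))).
- exact: ft_top.
- exact: (ft_nu (wlift (wlift (wlift (wlift W))))).
apply: (@ff_divmod _ _ _ snd (fun=> 2) (fun y h b =>
  P y.1.1.1.1.1.1 y.1.1.1.1.1.2 y.1.1.2 y.1.2 y.2 h b)).
- exact: ft_top.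
- exact: ft_const.
apply: (hP _ (fun y => y.1.1.1.1.1.1.1.1) _ (fun y => y.1.1.1.1.1.1.1.2)
  (fun y => y.1.1.1.1.2) (fun y => y.1.1.1.2) (fun y => y.1.1.2) (fun y => y.1.2) snd).
- move=> t ht.
  exact: (ft_weak (ft_weak (ft_weak (ft_weak (ft_weak (ft_weak (ft_weak (ft_weak ht)))))))).
- by refine (@ft_var _ _ _ 7 _).
- by refine (@ft_var _ _ _ 4 _).
- by refine (@ft_var _ _ _ 3 _).
- by refine (@ft_var _ _ _ 2 _).
- by refine (@ft_var _ _ _ 1 _).
- by refine (@ft_var _ _ _ 0 _).
Qed.

Lemma ff_kvar A (W : A -> seq bool) V k z : ftm W V k -> ftm W V z ->
  ffm W V (fun a => kvar (W a) (k a) == z a).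
Proof.
move=> hk hz.
apply: (@ff_slot _ W V k (fun a j r0 c u h b => svar_core (W a) j r0 c u h == z a)) => //.
move=> A' p W' V' j r0 c u h b wk hj hr hc hu hh hb.
have hz' := wk _ hz; have hn := ft_nu W' V'; have hl := ff_Lit hc hu.
apply: (@ff_ext _ _ _ (fun y => if j y == 0 then z (p y) == 0 else
  if j y == 1 then (if (u y).+1 == nu (W' y) then z (p y) == 0
     else z (p y) == nu (W' y) + 1 + (r0 y).+1)
  else if j y == 2 then (if u y == 0 then z (p y) == 0
     else z (p y) == nu (W' y) + 1 + r0 y)
  else if Lit (W' y) (c y) (u y) then z (p y) == 1 + h y else z (p y) == 0)).
  move=> y; rewrite /svar_core -/(W' y).
  by case: (j y) => [|[|[|n]]] /=; rewrite eq_sym //; case: ifP.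
by do ![apply: ff_if => //]; fo.
Qed.

Lemma ff_ksig A (W : A -> seq bool) V k : ftm W V k ->
  ffm W V (fun a => ksig (W a) (k a)).
Proof.
move=> hk.
apply: (@ff_slot _ W V k (fun a j r0 c u h b => ssig_core (W a) j c u b)) => //.
move=> A' p W' V' j r0 c u h b wk hj hr hc hu hh hb.
have hn := ft_nu W' V'; have hl := ff_Lit hc hu.
apply: (@ff_ext _ _ _ (fun y => if j y == 1 then (u y).+1 == nu (W' y) else
  if j y == 3 then Lit (W' y) (c y) (u y) ==> (b y == 1) else true)).
  by move=> y; case: (j y) => [|[|[|[|n]]]].
by do ![apply: ff_if => //]; fo.
Qed.

Lemma kvar_lt x k : kvar x k < nu x + nrow0 x + 3.
Proof.
rewrite /kvar /=; set r0 := _ %% nrow0 x.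
have lr : r0 < nrow0 x by rewrite ltn_mod nrow0_gt0.
have lu : r0 %% nu x < nu x by rewrite ltn_mod nu0.
have l2 : r0 %% nu x %/ 2 <= r0 %% nu x by apply: leq_div.
by case: (_ %/ _) => [|[|[|j]]] /=; do ?case: ifP; lia.
Qed.

(** Only the graph of [kvar] is definable, so equality of two of its values is expressed by a common
    value below the bound of [kvar_lt]. *)
Lemma ff_samevar A (W : A -> seq bool) V k k' : ftm W V k -> ftm W V k' ->
  ffm W V (fun a => kvar (W a) (k a) == kvar (W a) (k' a)).
Proof.
move=> hk hk'.
apply: (@ff_ext _ _ _ (fun a => has (fun z => (kvar (W a) (k a) == z) &&
   (kvar (W a) (k' a) == z)) (iota 0 (nu (W a) + nrow0 (W a) + 3)))).
  move=> a; apply/hasP/eqP => [[z _ /andP[/eqP -> /eqP ->]]//|e].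
  by exists (kvar (W a) (k a)); rewrite ?mem_iota ?add0n ?kvar_lt // e eqxx.
apply: ff_ex.
  have h1 := ft_nu W V; have h2 := ft_nrow0 W V; by fo.
apply: ff_and; apply: (@ff_kvar _ (wlift W)); try exact: ft_top; by [ftw hk | ftw hk'].
Qed.

Lemma ff_nrel A (W : A -> seq bool) V k k' : ftm W V k -> ftm W V k' ->
  ffm W V (fun a => nrel (W a) (k a) (k' a)).
Proof.
move=> hk hk'; apply: ff_and; first exact: ff_samevar.
apply: ff_not; apply: ff_ex.
  have h2 := ft_nrow W V; by fo.
have ht := ft_top W V; have gk := ft_weak hk; have gk' := ft_weak hk'.
apply: ff_and; first exact: (@ff_samevar _ (wlift W) _ snd (fun y => k y.1)).
by fo.
Qed.
(** * The reduction *)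

Lemma ext_ind (P : nat -> Prop) : P 127 -> P 129 -> P 132 -> P 134 ->
  (forall out j, j < 4 -> P (port out j)) -> forall l, ext l -> P l.
Proof.
move=> h1 h2 h3 h4 h5 l.
have exl : perm_eq ext_verts ([:: 127; 129; 132; 134] ++ [seq port false j | j <- iota 0 4]
   ++ [seq port true j | j <- iota 0 4]) by vm_compute.
rewrite /ext (perm_mem exl) !mem_cat => /orP[|/orP[]].
- by rewrite !inE => /or4P[] /eqP ->.
- by move=> /mapP[j]; rewrite mem_iota => lj ->; apply: h5.
- by move=> /mapP[j]; rewrite mem_iota => lj ->; apply: h5.
Qed.

Lemma ext_port out j : j < 4 -> ext (port out j).
Proof.
have h : all (fun j => ext (port true j) && ext (port false j)) (iota 0 4) by vm_compute.
by move=> lj; have /andP[] := all_iotaP h lj; case: out.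
Qed.

Lemma portK out j : ((port out j %/ 30 = j) * ((port out j %% 30 == 27) = out))%type.
Proof.
have lc : (if out then 27 else 24) < 30 by case: out.
by rewrite /port mulnC !(code_divmod _ lc); case: out {lc}.
Qed.

Lemma port_lt out j : j < 4 -> port out j < 120.
Proof. by rewrite /port; case: out; lia. Qed.

Lemma half_split (R : realType) (u w : R) : (u + w = 5)%R -> w != (5 / 2)%R ->
  (u < 5 / 2)%R = ~~ (w < 5 / 2)%R.
Proof.
move=> e n; rewrite -leNgt le_eqVlt [(5 / 2 == w)%R]eq_sym (negbTE n) /=.
by apply/idP/idP => h; lra.
Qed.

Lemma succ_mod g m : g < m -> g.+1 %% m = if g.+1 < m then g.+1 else 0.
Proof.
move=> lg; case: ltnP => h; first by rewrite modn_small.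
by have -> : g.+1 = m by [lia]; rewrite modnn.
Qed.
Lemma pred_mod g m : g < m -> (g + m).-1 %% m = if 0 < g then g.-1 else m.-1.
Proof.
case: g => [|g] lg /=; first by rewrite add0n modn_small //; lia.
by rewrite modnDr modn_small //; lia.
Qed.

Section Assembly.
Variable x : seq bool.
Local Notation m := (nrow x).

Definition xport g out j : nat * nat :=
  let k := j * m + g in
  let k' := if out == ksig x k then nxtf x k else prvf x k in
  (k' %% m, port (if out == ksig x k then ~~ ksig x k' else ksig x k') (k' %/ m)).

(* The ports of slot [j] of cell [g] belong to occurrence [k = j * m + g]: the
   one selected by the sign of [k] is joined to the next occurrence of the same
   variable, the other one to the previous occurrence. *)
Definition xnf g l : nat * nat :=
  if l == 127 then ((g + m).-1 %% m, 129) else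
  if l == 129 then (g.+1 %% m, 127) else
  if l == 132 then ((g + m).-1 %% m, 134) else
  if l == 134 then (g.+1 %% m, 132) else xport g (l %% 30 == 27) (l %/ 30).

Lemma xnf_port g out j : j < 4 -> xnf g (port out j) = xport g out j.
Proof.
move=> lj; have h c : 120 <= c -> (port out j == c) = false.
  by move=> lc; apply/eqP => e; have := port_lt out lj; rewrite e ltnNge lc.
by rewrite /xnf (h 127) // (h 129) // (h 132) // (h 134) // !portK.
Qed.

Lemma nrow_gt1 : 1 < m.
Proof. by rewrite /nrow; have := nrow0_gt0 x; lia. Qed.

Lemma xnf_ok g l : g < m -> ext l ->
  [/\ (xnf g l).1 < m, (xnf g l).1 != g, ext (xnf g l).2 &
    xnf (xnf g l).1 (xnf g l).2 = (g, l)].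
Proof.
move=> lg; have m1 := nrow_gt1; have m0 : 0 < m by lia.
have e127 : ext 127 by vm_compute. have e129 : ext 129 by vm_compute.
have e132 : ext 132 by vm_compute. have e134 : ext 134 by vm_compute.
have lp : (g + m).-1 %% m < m by rewrite ltn_mod.
have ls : g.+1 %% m < m by rewrite ltn_mod.
have p1 : ((g + m).-1 %% m != g) && (((g + m).-1 %% m).+1 %% m == g).
  by rewrite succ_mod // pred_mod //; case: ifP => h1; case: ifP => h2; lia.
have p2 : (g.+1 %% m != g) && ((g.+1 %% m + m).-1 %% m == g).
  by rewrite (pred_mod ls); have := succ_mod lg; case: ltnP => c -> /=; lia.
move: p1 p2 => /andP[a1 /eqP a2] /andP[b1 /eqP b2].
move: l; apply: ext_ind.
- by rewrite /xnf /= a2.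
- by rewrite /xnf /= b2.
- by rewrite /xnf /= a2.
- by rewrite /xnf /= b2.
move=> out j lj; rewrite xnf_port //.
have lk : j * m + g < 4 * m.
  by apply: (@leq_trans (j.+1 * m)); rewrite ?leq_mul2r ?lj ?orbT // mulSn addnC ltn_add2r.
rewrite /xport; set k := j * m + g in lk *.
have [kd km] : k %/ m = j /\ k %% m = g by rewrite /k !(code_divmod _ lg).
case: (boolP (out == ksig x k)) => [/eqP eo|no] /=.
  have lk' := nxtf_lt lk; have ld : nxtf x k %/ m < 4 by rewrite ltn_divLR.
  split; rewrite ?ltn_mod ?ext_port //; first by rewrite -km nxtf_row.
  rewrite xnf_port // /xport -divn_eq.
  have -> : (~~ ksig x (nxtf x k) == ksig x (nxtf x k)) = false by case: (ksig _ _).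
  by rewrite prvf_nxtf // kd km -eo.
have lk' := prvf_lt lk; have ld : prvf x k %/ m < 4 by rewrite ltn_divLR.
split; rewrite ?ltn_mod ?ext_port //.
  by have := nxtf_row lk'; rewrite nxtf_prvf // km eq_sym.
rewrite xnf_port // /xport -divn_eq eqxx nxtf_prvf // kd km.
by congr (_, port _ _); move: no; case: (out); case: (ksig _ _).
Qed.

Definition sat_graph : graph := ring xnf_ok.

Lemma xnf129 g : g < m -> xnf g 129 = (g.+1 %% m, 127). Proof. by []. Qed.
Lemma xnf134 g : g < m -> xnf g 134 = (g.+1 %% m, 132). Proof. by []. Qed.

Lemma occurrence_lt g j : g < m -> j < 4 -> j * m + g < 4 * m.
Proof.
move=> lg lj; apply: (@leq_trans (j.+1 * m)); last by rewrite leq_mul2r lj orbT.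
by rewrite mulSn addnC ltn_add2r.
Qed.

Lemma sat_graph_snark (R : realType) : snark R sat_graph.
Proof.
split.
- by move=> v; exact (@ring_cubic _ _ xnf_ok v).
- exact: (ring_cyclically_connected nrow_gt1 xnf129 xnf134).
- exact (@ring_girth _ _ xnf_ok).
(* A flow number at most 4 would give a flow modulo 4 + 1/1000, which any one cell refutes; cell 0
   is used. *)
rewrite ltNge; apply/negP => le.
have : (circular_flow_number R sat_graph < (4 + 1000^-1 : R)%:E)%E.
  by apply: le_lt_trans le _; rewrite lte_fin; lra.
move=> /flow_number_lt [|f hf]; first by lra.
have [dl dl0 H] := @ring_cell _ _ xnf_ok R _ f hf.
have [d [p2 p1 pE pv _]] := H 0 (nrow_gt0 x).
by apply: (cell_contra dl0 p2 p1 pE pv (ep := (1000^-1)%R)) => //; lra.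
Qed.

(** The bit [a k] records whether the input port of occurrence [k] is low, and [o k] corrects it by
    the sign of [k]. The two values on a join add up to 5 and avoid 5/2, so exactly one is low;
    hence [o] is constant along the occurrences of a variable. *)
Lemma flow_nae (R : realType) : (circular_flow_number R sat_graph < 5%:E)%E ->
  exists B, nae_sat x B.
Proof.
move=> /flow_number_lt [|f hf]; first by lra.
have [dl dl0 H] := @ring_cell _ _ xnf_ok R _ f hf.
pose E g l : R := real_fun f (g * K + l) (partner xnf g l).
pose a k : bool := (E (k %% m)%N (port false (k %/ m)%N) < 5 / 2)%R.
have C g : g < m -> (forall j, j < 4 -> [/\ E g (port false j) != (5 / 2)%R,
    E g (port true j) != (5 / 2)%R & (E g (port true j) < 5 / 2)%R = ~~ a (j * m + g)]) /\
    exists j j', [/\ j < 4, j' < 4, a (j * m + g) & ~~ a (j' * m + g)].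
  move=> lg; have [d [p2 p1 pE pv _]] := H g lg.
  have ak j : a (j * m + g) = (E g (port false j) < 5 / 2)%R.
    by rewrite /a !(code_divmod _ lg).
  have [c1 [j [j' [l1 l2 h1 h2]]]] := cell_logic dl0 p2 p1 pE pv erefl.
  split; last by exists j, j'; rewrite !ak; split; [exact: l1|exact: l2|exact: h1|exact: h2].
  move=> i li; have [d1 [d2 d3]] := c1 i li; rewrite ak.
  by split; [exact: d1|exact: d2|exact: d3].
have dm k : k < 4 * m -> [/\ k %% m < m, k %/ m < 4 & k %/ m * m + k %% m = k].
  move=> lk; split; [by rewrite ltn_mod nrow_gt0|by rewrite ltn_divLR ?nrow_gt0|].
  by rewrite -divn_eq.
pose o k := a k == ksig x k.
have val_port k b : k < 4 * m -> E (k %% m) (port b (k %/ m)) != (5 / 2)%R /\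
    (E (k %% m)%N (port b (k %/ m)%N) < 5 / 2)%R = (a k (+) b).
  move=> lk; have [lg lj ek] := dm k lk; have [c _] := C _ lg; have [c1 c2 c3] := c _ lj.
  by rewrite ek in c3; case: b; [rewrite addbT|rewrite addbF]; split.
have st k : k < 4 * m -> o (nxtf x k) = o k.
  move=> lk; have lk' := nxtf_lt lk; have [lg lj ek] := dm k lk.
  have [lg' lj' ek'] := dm _ lk'.
  have [d [_ _ _ _ h5]] := H _ lg.
  have xe : xnf (k %% m) (port (ksig x k) (k %/ m)) =
      (nxtf x k %% m, port (~~ ksig x (nxtf x k)) (nxtf x k %/ m)).
    by rewrite xnf_port // /xport ek eqxx.
  have xe' : xnf (nxtf x k %% m) (port (~~ ksig x (nxtf x k)) (nxtf x k %/ m)) =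
      (k %% m, port (ksig x k) (k %/ m)).
    by have [_ _ _] := xnf_ok lg (ext_port (ksig x k) lj); rewrite xe.
  pose i1 := k %% m * K + port (ksig x k) (k %/ m).
  pose i2 := nxtf x k %% m * K + port (~~ ksig x (nxtf x k)) (nxtf x k %/ m).
  have pe1 : partner xnf (k %% m) (port (ksig x k) (k %/ m)) = i2 by rewrite /partner xe.
  have pe2 : partner xnf (nxtf x k %% m)
      (port (~~ ksig x (nxtf x k)) (nxtf x k %/ m)) = i1 by rewrite /partner xe'.
  have E1 : E (k %% m) (port (ksig x k) (k %/ m)) = real_fun f i1 i2 by rewrite /E pe1.
  have E2 : E (nxtf x k %% m) (port (~~ ksig x (nxtf x k)) (nxtf x k %/ m)) =
      real_fun f i2 i1 by rewrite /E pe2.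
  have sm : (real_fun f i1 i2 + real_fun f i2 i1 = 5)%R.
    by have := h5 _ (ext_port (ksig x k) lj); cbv beta; rewrite pe1.
  have := val_port k (ksig x k) lk; rewrite E1 => -[n1 e1].
  have := val_port _ (~~ ksig x (nxtf x k)) lk'; rewrite E2 => -[n2 e2].
  have := half_split sm n2; rewrite e1 e2 /o.
  case: (a k); case: (a (nxtf x k)); case: (ksig x k); by case: (ksig x (nxtf x k)).
have oc := nxtf_const st.
(* The common value at the occurrences of the variable; one without occurrence is set to false. *)
pose B v := has (fun k => (kvar x k == v) && o k) (iota 0 (4 * m)).
have sv k : k < 4 * m -> sval x B k = a k.
  move=> lk; have -> : a k = (o k == ksig x k) by rewrite /o; case: (a k); case: (ksig _ _).
  rewrite /sval; congr (_ == _); apply/hasP/idP => [[k' hk' hb]|ok].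
    cbv beta in hb; move/andP: hb => [/eqP e ok'].
    by rewrite mem_iota add0n in hk'; rewrite -(oc k' k hk' lk e).
  exists k; first by rewrite mem_iota add0n.
  by rewrite eqxx ok.
exists B => r lr; have [_ [j [j' [l1 l2 h1 h2]]]] := C r lr.
by exists j, j'; split=> //; rewrite !sv ?occurrence_lt // h1 (negbTE h2).
Qed.

Lemma ext_flow_port p out j : j < 4 ->
  ext_flow p (port out j) = if nth false p j (+) out then 32 else 118.
Proof.
have h : all (fun j => [&& port false j \in [seq port false j | j <- iota 0 4],
   port true j \notin [seq port false j | j <- iota 0 4] &
   port true j \in [seq port true j | j <- iota 0 4]]) (iota 0 4) by vm_compute.
move=> lj; have /and3P[h1 h2 h3] := all_iotaP h lj; rewrite /ext_flow portK.
by case: out; rewrite ?h1 ?(negbTE h2) ?h3; case: (nth _ _ _).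
Qed.

(** The row values select a tabulated flow in each cell. By the choice of ports in [xport], joined
    ports of one variable always get 32 and 118, whatever the two signs are. *)
Lemma nae_flow (R : realType) B : nae_sat x B ->
  (circular_flow_number R sat_graph < 5%:E)%E.
Proof.
move=> sat; apply/flow_number_lt; first by lra.
pose p g := [seq sval x B (j * m + g) | j <- iota 0 4].
have np g j : j < 4 -> nth false (p g) j = sval x B (j * m + g).
  by move=> lj; rewrite (nth_map 0) ?size_iota // nth_iota.
refine (@ring_flow _ _ xnf_ok R p _ _) => [g lg|g l lg].
  split=> //; have [j [j' [lj lj' ne]]] := sat g lg.
  have m1 i : i < 4 -> sval x B (i * m + g) \in p g.
    by move=> li; apply: (map_f (fun j => sval x B (j * m + g))); rewrite mem_iota.
  have := m1 _ lj; have := m1 _ lj'; rewrite /nae; move: ne.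
  by case: (sval x B (j * m + g)); case: (sval x B (j' * m + g)) => // _ -> ->.
move: l; apply: ext_ind; try by rewrite /xnf /= /ext_flow.
move=> out j lj; have lk := occurrence_lt lg lj.
rewrite xnf_port // /xport; set k := j * m + g in lk *.
set k' := (if _ then _ else _).
have [lk' kv] : k' < 4 * m /\ kvar x k' = kvar x k.
  rewrite /k'; case: ifP => _.
    by have := nxtf_mem lk; rewrite occ_mem => /andP[-> /eqP].
  by have := prvf_mem lk; rewrite occ_mem => /andP[-> /eqP].
have ld : k' %/ m < 4 by rewrite ltn_divLR ?nrow_gt0.
rewrite !ext_flow_port //= !np // -divn_eq -/k /sval kv.
by case: (out); case: (ksig x k); case: (ksig x k'); case: (B _).
Qed.
End Assembly.

(** * The adjacency matrix is computable *)

Definition cell_arc l y := has (fun e : nat * nat =>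
  ((l == e.1) && (y == e.2)) || ((y == e.1) && (l == e.2))) cell_edges.
Definition port_join x k k' b b' :=
  if b == ksig x k then nrel x k k' && (b' == ~~ ksig x k')
  else nrel x k' k && (b' == ksig x k').
Definition slots : seq (bool * nat) := [seq (b, j) | b <- [:: true; false], j <- iota 0 4].

(** The adjacency of [sat_graph] rewritten for the formula language: case distinctions replace the
    cyclic neighbours of a cell, [nrel] replaces both [nxtf] and [prvf], and the finite data are
    unfolded as disjunctions. *)
Definition sat_adj x g l h y :=
  [|| (g == h) && cell_arc l y,
    has (fun t : nat * nat => [&& l == t.1, y == t.2 &
      (h == g.+1) && (g.+1 < nrow x) || (g.+1 == nrow x) && (h == 0)])
      [:: (129, 127); (134, 132)],
    has (fun t : nat * nat => [&& l == t.1, y == t.2 &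
      (g == h.+1) && (h.+1 < nrow x) || (h.+1 == nrow x) && (g == 0)])
      [:: (127, 129); (132, 134)] |
    has (fun s : bool * nat => has (fun t : bool * nat =>
      [&& l == port s.1 s.2, y == port t.1 t.2 &
        port_join x (s.2 * nrow x + g) (t.2 * nrow x + h) s.1 t.1]) slots) slots].

Lemma mem_slots b j : ((b, j) \in slots) = (j < 4).
Proof.
apply/allpairsP/idP => [[s [h1 h2 h3]]|lj].
  by case: h3 => _ ->; move: h2; rewrite mem_iota.
by exists (b, j); split; rewrite ?mem_iota //; case: (b).
Qed.

Lemma cell_arcE l y : cell_arc l y = (y \in nbr l).
Proof.
rewrite mem_nbr; apply/hasP/orP => [[[a b] h /= /orP[]/andP[/eqP -> /eqP ->]]|[] h].
- by left.
- by right.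
- by exists (l, y); rewrite //= !eqxx.
- by exists (y, l); rewrite //= !eqxx orbT.
Qed.

Lemma sat_adjE x i j : i < nv (nrow x) -> j < nv (nrow x) ->
  sat_adj x (i %/ K) (i %% K) (j %/ K) (j %% K) = gadj (xnf x) i j.
Proof.
move=> /cell_lt lg /cell_lt lh; rewrite /gadj /sat_adj cell_arcE.
move: (i %/ K) (i %% K) (j %/ K) (j %% K) lg lh => g l h y lg lh {i j}.
congr (_ || _); have m1 := nrow_gt1 x; have m0 := nrow_gt0 x.
apply/or3P/andP => [[/hasP[t]|/hasP[t]|/hasP[[b j] sj /hasP[[b' j'] sj']]]|].
- rewrite !inE => /orP[]/eqP -> /and3P[/eqP -> /eqP -> hh] /=.
    by split; [vm_compute|rewrite /xnf /= succ_mod //; case: ifP hh => h1 h2; apply/eqP; congr (_, _); lia].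
  by split; [vm_compute|rewrite /xnf /= succ_mod //; case: ifP hh => h1 h2; apply/eqP; congr (_, _); lia].
- rewrite !inE => /orP[]/eqP -> /and3P[/eqP -> /eqP -> hh] /=.
    by split; [vm_compute|rewrite /xnf /= pred_mod //; case: ifP => h1; apply/eqP; congr (_, _); lia].
  by split; [vm_compute|rewrite /xnf /= pred_mod //; case: ifP => h1; apply/eqP; congr (_, _); lia].
- rewrite !mem_slots in sj sj'; move=> /and3P[/eqP -> /eqP -> /= pj].
  split; first exact: ext_port.
  have lk := occurrence_lt lg sj; have lk' := occurrence_lt lh sj'.
  rewrite xnf_port // /xport; move: pj; rewrite /port_join.
  case: ifP => _; rewrite nrelP // => /andP[/eqP e /eqP ->].
    by rewrite -e !(code_divmod _ lh).
  by rewrite e prvf_nxtf // !(code_divmod _ lh).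
have x127 : xnf x g 127 = ((g + nrow x).-1 %% nrow x, 129) by [].
have x129 : xnf x g 129 = (g.+1 %% nrow x, 127) by [].
have x132 : xnf x g 132 = ((g + nrow x).-1 %% nrow x, 134) by [].
have x134 : xnf x g 134 = (g.+1 %% nrow x, 132) by [].
move=> [ex]; move: l ex; apply: ext_ind.
- rewrite x127 => /eqP[e1 e2]; apply: Or32; apply/hasP; exists (127, 129) => //.
  by rewrite /= -e2 -e1 (pred_mod lg) !eqxx /=; case: ifP => h0; lia.
- rewrite x129 => /eqP[e1 e2]; apply: Or31; apply/hasP; exists (129, 127) => //.
  by rewrite /= -e2 -e1 (succ_mod lg) !eqxx /=; case: ifP => h0; lia.
- rewrite x132 => /eqP[e1 e2]; apply: Or32; apply/hasP; exists (132, 134) => //.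
  by rewrite /= -e2 -e1 (pred_mod lg) !eqxx /=; case: ifP => h0; lia.
- rewrite x134 => /eqP[e1 e2]; apply: Or31; apply/hasP; exists (134, 132) => //.
  by rewrite /= -e2 -e1 (succ_mod lg) !eqxx /=; case: ifP => h0; lia.
move=> out j lj; rewrite xnf_port // => e; apply: Or33.
have lk := occurrence_lt lg lj; move: e; rewrite /xport; set k := j * _ + g in lk *.
set k' := (if _ then _ else _); set b' := (if _ then _ else _) => /eqP[e1 e2].
have lk' : k' < 4 * nrow x by rewrite /k'; case: ifP => _; [apply: nxtf_lt|apply: prvf_lt].
have ld : k' %/ nrow x < 4 by rewrite ltn_divLR.
apply/hasP; exists (out, j); first by rewrite mem_slots.
apply/hasP; exists (b', k' %/ nrow x); first by rewrite mem_slots.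
rewrite /= -e2 !eqxx !andTb -e1 -divn_eq /port_join -/k /b' /k'.
by case: (out == ksig x k); rewrite /= eqxx andbT nrelP ?nxtf_lt ?prvf_lt ?nxtf_prvf ?eqxx.
Qed.

Lemma ff_sat_adj A (W : A -> seq bool) V g l h y : ftm W V g -> ftm W V l -> ftm W V h ->
  ftm W V y -> ffm W V (fun a => sat_adj (W a) (g a) (l a) (h a) (y a)).
Proof.
move=> hg hl hh hy; have hm := ft_nrow W V.
apply: ff_or; first by apply: ff_and; [fo|apply: ff_hasl => e; fo].
apply: ff_or; first by apply: ff_hasl => e; fo.
apply: ff_or; first by apply: ff_hasl => e; fo.
apply: ff_hasl => s; apply: ff_hasl => t.
have k1 : ftm W V (fun a => s.2 * nrow (W a) + g a) by fo.
have k2 : ftm W V (fun a => t.2 * nrow (W a) + h a) by fo.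
apply: ff_and; first by fo.
apply: ff_and; first by fo.
apply: ff_if; first by apply: ff_eqb; [exact: ff_const|exact: ff_ksig].
  by apply: ff_and; [exact: ff_nrel|apply: ff_eqb; [exact: ff_const|apply: ff_not; exact: ff_ksig]].
by apply: ff_and; [exact: ff_nrel|apply: ff_eqb; [exact: ff_const|exact: ff_ksig]].
Qed.

Definition sat_code x := nseq (nv (nrow x)) true ++ false ::
  [seq sat_adj x (i %/ K) (i %% K) (j %/ K) (j %% K) | i <- iota 0 (nv (nrow x)),
    j <- iota 0 (nv (nrow x))].

Lemma sat_codeE x : sat_code x = graph_code (sat_graph x).
Proof.
rewrite /sat_code /graph_code; congr (_ ++ _ :: _).
rewrite -val_enum_ord allpairs_mapl allpairs_mapr.
by congr flatten; apply: eq_map => i; apply: eq_map => j; rewrite sat_adjE ?ltn_ord.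
Qed.

Lemma polytime_sat_code : polytime sat_code.
Proof.
apply: (@polytime_matrix (fun x => nv (nrow x))
  (fun x i j => sat_adj x (i %/ K) (i %% K) (j %/ K) (j %% K))).
  by apply: ft_mul; [exact: ft_nrow|exact: ft_const].
set W := wlift _; set V := vlift _.
apply: (@ff_ext _ W V (fun a => (0 < K) && ((0 < K) &&
  sat_adj a.1.1 (a.1.2 %/ K) (a.1.2 %% K) (a.2 %/ K) (a.2 %% K)))); first by move=> a; rewrite K0.
apply: (@ff_divmod _ W V (fun a => a.1.2) (fun=> K) (fun a q r => (0 < K) &&
  sat_adj a.1.1 q r (a.2 %/ K) (a.2 %% K))); [fv|exact: ft_const|].
apply: (@ff_divmod _ (wlift (wlift W)) (vlift (vlift V)) (fun a => a.1.1.2) (fun=> K)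
  (fun a q r => sat_adj a.1.1.1.1 a.1.2 a.2 q r)); [fv|exact: ft_const|].
by apply: (@ff_sat_adj _ (wlift (wlift (wlift (wlift W))))); fv.
Qed.

Lemma cnf_reduction (R : realType) x :
  (exists B, forall c, c < nc x -> has (fun u => Lit x c u && lit_val B u) (iota 0 (nu x))) <->
  (circular_flow_number R (sat_graph x) < 5%:E)%E.
Proof.
rewrite cnf_nae; split=> [[B]|]; [exact: nae_flow|exact: flow_nae].
Qed.
Lemma reduction_correct (R : realType) x : exists b : {G : graph | snark R G},
  sat_code x = graph_code (proj1_sig b) /\
  ((exists B, forall c, c < nc x ->
      has (fun u => Lit x c u && lit_val B u) (iota 0 (nu x))) <->
   (circular_flow_number R (proj1_sig b) < 5%:E)%E).
Proof.
exists (exist _ (sat_graph x) (sat_graph_snark x R)); split; first exact: sat_codeE.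
exact: cnf_reduction.
Qed.
End Rows.

Lemma snark_flow_NP_hard (R : realType) : NP_hard (snark_flow_lt5 R).
Proof.
move=> L [V [q [[M [p HM]] H]]].
have c0 := @nclauses_gt0 M p q; have l0 := @nlits_gt0 M p q.
exists (sat_code (@clause_lit M p q) (@nclauses M p q) (@nlits M p q)); split.
  by apply: polytime_sat_code => // *;
    first [exact: ff_clause_lit|exact: ft_nclauses|exact: ft_nlits].
move=> a; have [b [e1 e2]] : exists b : {G : graph | snark R G},
    sat_code (@clause_lit M p q) (@nclauses M p q) (@nlits M p q) a = graph_code (proj1_sig b) /\
    ((exists B, forall c, c < nclauses M p q a ->
        has (fun u => clause_lit M p q a c u && lit_val B u) (iota 0 (nlits M p q a))) <->
     (circular_flow_number R (proj1_sig b) < 5%:E)%E).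
  by apply: reduction_correct => // *;
    first [exact: ff_clause_lit|exact: ft_nclauses|exact: ft_nlits].
exists b; split; first exact: e1.
apply: iff_trans (H a) _; apply: iff_trans (@tableauP M p q V a HM) _.
exact: iff_trans (@cnf_tableau M p q a) e2.
Qed.

Theorem theorem27 (R : realType) : NP_complete (snark_flow_lt5 R).
Proof. split; [exact: snark_flow_in_NP|exact: snark_flow_NP_hard]. Qed.
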